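(* Let $\zeta\in\mathrm{Hom}(H'(+),\mathbb{C})$ and let $\lambda\in(\dot{\mathfrak h}\oplus\mathbb{C}c)^*$ with $\lambda(c)\neq0$. Then the $\tilde{\mathfrak g}$-module $\widetilde M'_{\zeta,\lambda}$ is irreducible.
   Context: Let $\mathfrak g$ be a finite-dimensional complex simple Lie algebra of rank $n$ with Cartan subalgebra $\dot{\mathfrak h}$, invariant symmetric non-degenerate form $(\cdot|\cdot)$, and fixed simple roots; $\mathfrak g_+$ is the sum of the positive root spaces. Let $\hat{\mathfrak g}$ be the non-twisted affine Lie algebra of $\mathfrak g$; its derived algebra is $\tilde{\mathfrak g}=[\hat{\mathfrak g},\hat{\mathfrak g}]=\mathfrak g\otimes\mathbb{C}[t^{\pm1}]\oplus\mathbb{C}c$, with $c$ central and $[x\otimes t^m,y\otimes t^k]=[x,y]\otimes t^{m+k}+\delta_{m+k,0}m(x|y)c$. Put $H'=\bigoplus_{r\ne0}\dot{\mathfrak h}\otimes t^r\oplus\mathbb{C}c$ and $H'(+)=\bigoplus_{r>0}\dot{\mathfrak h}\otimes t^r$ (an abelian Lie algebra). For a linear functional $\zeta:H'(+)\to\mathbb{C}$ and $a=\lambda(c)$, let $M'_{\zeta,a}=\mathcal U(H')\otimes_{\mathcal U(H'(+)\oplus\mathbb{C}c)}\mathbb{C}v$, where $xv=\zeta(x)v$ for $x\in H'(+)$ and $cv=av$. $M'_{\zeta,\lambda}$ is this module regarded as an $H'\oplus\dot{\mathfrak h}$-module with $\dot{\mathfrak h}$ acting by scalars through $\lambda$. Let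 $\widetilde{\mathcal P}=H'\oplus\dot{\mathfrak h}\oplus(\mathfrak g_+\otimes\mathbb{C}[t^{\pm1}])$, let $\mathfrak g_+\otimes\mathbb{C}[t^{\pm1}]$ act on $M'_{\zeta,\lambda}$ by zero, and put $\widetilde M'_{\zeta,\lambda}=\mathcal U(\tilde{\mathfrak g})\otimes_{\mathcal U(\widetilde{\mathcal P})}M'_{\zeta,\lambda}$. *)

(* Defs.v *)
From HB Require Import structures.
From mathcomp Require Import all_boot all_order all_algebra finmap boolp.
From mathcomp.multinomials Require Import monalg.

Set Implicit Arguments.
Unset Strict Implicit.
Unset Printing Implicit Defensive.

Import GRing.Theory Num.Theory.
Local Open Scope ring_scope.

HB.mixin Record isLieAlgebra (K : fieldType) L of GRing.Lmodule K L := {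
  lie : L -> L -> L;
  lie_linearl : forall (k : K) x1 x2 y,
    lie (k *: x1 + x2) y = k *: lie x1 y + lie x2 y;
  lie_linearr : forall (k : K) x y1 y2,
    lie x (k *: y1 + y2) = k *: lie x y1 + lie x y2;
  liexx : forall x, lie x x = 0;
  lie_jacobi : forall x y z,
    lie x (lie y z) + lie y (lie z x) + lie z (lie x y) = 0
}.

#[short(type="lieAlgType")]
HB.structure Definition LieAlgebra (K : fieldType) :=
  {L of isLieAlgebra K L & GRing.Lmodule K L}.

Arguments lie {K L} : simpl never, rename.

#[short(type="finLieAlgType")]
HB.structure Definition FinLieAlgebra (K : fieldType) :=
  {L of isLieAlgebra K L & Vector K L}.

Section LieTheory.
Variables (K : fieldType) (L : lieAlgType K).
Implicit Types x y z : L.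

Lemma lie_is_linearr x : linear (lie x).
Proof. by move=> k y1 y2; apply: lie_linearr. Qed.
HB.instance Definition _ x :=
  GRing.isLinear.Build K L L *:%R (lie x) (lie_is_linearr x).

Lemma lieDl x1 x2 y : lie (x1 + x2) y = lie x1 y + lie x2 y.
Proof. by rewrite -[x1]scale1r lie_linearl !scale1r. Qed.
Lemma lie0l y : lie 0 y = 0.
Proof. by apply: (addrI (lie 0 y)); rewrite -lieDl !addr0. Qed.
Lemma lieZl k x y : lie (k *: x) y = k *: lie x y.
Proof. by rewrite -[k *: x]addr0 lie_linearl lie0l addr0. Qed.
Lemma lieNl x y : lie (- x) y = - lie x y.
Proof. by rewrite -scaleN1r lieZl scaleN1r. Qed.
Lemma lie_suml I (r : seq I) (P : pred I) (F : I -> L) y :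
  lie (\sum_(i <- r | P i) F i) y = \sum_(i <- r | P i) lie (F i) y.
Proof.
by elim/big_rec2: _ => [|i u v _ <-]; rewrite ?lie0l ?lieDl.
Qed.
Lemma lieC x y : lie x y = - lie y x.
Proof.
have := liexx (x + y).
rewrite lieDl !linearD/= !liexx add0r addr0 => /eqP.
by rewrite addr_eq0 => /eqP.
Qed.
Lemma lie_leibniz x y z : lie (lie x y) z = lie x (lie y z) - lie y (lie x z).
Proof.
have /eqP := lie_jacobi x y z.
rewrite addr_eq0 => /eqP jac.
by rewrite [LHS]lieC -jac [lie z x]lieC linearN/=.
Qed.

End LieTheory.

Record lieHom (K : fieldType) (L1 L2 : lieAlgType K) := LieHom {
  lie_hom_fun :> {linear L1 -> L2};
  lie_homM : forall x y, lie_hom_fun (lie x y) =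
                         lie (lie_hom_fun x) (lie_hom_fun y) }.

Record lieSubalg (K : fieldType) (L : lieAlgType K) := LieSubalg {
  subalg_pred : {pred L};
  subalg_submod : submod_closed subalg_pred;
  subalg_lie : {in subalg_pred &, forall x y, lie x y \in subalg_pred} }.

Section Subalgebra.
Variables (K : fieldType) (L : lieAlgType K) (P : lieSubalg L).

Record subLie := SubLie {
  sub_elt : L;
  sub_eltP : sub_elt \in subalg_pred P }.

HB.instance Definition _ := [isSub for sub_elt].
HB.instance Definition _ := [Choice of subLie by <:].
HB.instance Definition _ :=
  GRing.isSubmodClosed.Build K L (subalg_pred P) (subalg_submod P).
HB.instance Definition _ := [SubChoice_isSubLmodule of subLie by <:].

Definition sub_lie (x y : subLie) : subLie :=
  SubLie (subalg_lie (sub_eltP x) (sub_eltP y)).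

Lemma sub_elt_linear : linear sub_elt.
Proof. by move=> k x y; exact: (linearP (val : subLie -> L)). Qed.

Lemma sub_elt_inj : injective sub_elt.
Proof. exact: val_inj. Qed.

Lemma sub_elt_lie x y : sub_elt (sub_lie x y) = lie (sub_elt x) (sub_elt y).
Proof. by []. Qed.

Fact sub_lie_linearl (k : K) x1 x2 y :
  sub_lie (k *: x1 + x2) y = k *: sub_lie x1 y + sub_lie x2 y.
Proof.
apply: sub_elt_inj; rewrite sub_elt_linear !sub_elt_lie.
by rewrite sub_elt_linear lie_linearl.
Qed.
Fact sub_lie_linearr (k : K) x y1 y2 :
  sub_lie x (k *: y1 + y2) = k *: sub_lie x y1 + sub_lie x y2.
Proof.
apply: sub_elt_inj; rewrite sub_elt_linear !sub_elt_lie.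
by rewrite sub_elt_linear lie_linearr.
Qed.
Fact sub_liexx x : sub_lie x x = 0.
Proof. by apply: val_inj; rewrite (linear0 (val : subLie -> L)) [LHS]liexx. Qed.
Fact sub_lie_jacobi x y z :
  sub_lie x (sub_lie y z) + sub_lie y (sub_lie z x) + sub_lie z (sub_lie x y)
  = 0.
Proof. apply: val_inj; rewrite !(linearD (val : subLie -> L)).
by rewrite (linear0 (val : subLie -> L)) [LHS]lie_jacobi. Qed.
HB.instance Definition _ := isLieAlgebra.Build K subLie
  sub_lie_linearl sub_lie_linearr sub_liexx sub_lie_jacobi.

HB.instance Definition _ :=
  GRing.isLinear.Build K subLie L *:%R sub_elt sub_elt_linear.

Definition subalg_val : lieHom subLie L :=
  @LieHom K subLie L sub_elt (fun _ _ => erefl).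

End Subalgebra.

Section SubalgebraInclusion.
Variables (K : fieldType) (L : lieAlgType K) (P Q : lieSubalg L).
Hypothesis sPQ : {subset subalg_pred P <= subalg_pred Q}.

Definition sub_incl_fun (x : subLie P) : subLie Q := SubLie (sPQ (sub_eltP x)).

Fact sub_incl_linear : linear sub_incl_fun.
Proof. by move=> k x y; apply: sub_elt_inj; rewrite sub_elt_linear. Qed.
HB.instance Definition _ :=
  GRing.isLinear.Build K (subLie P) (subLie Q) *:%R sub_incl_fun sub_incl_linear.

Fact sub_incl_lie x y :
  sub_incl_fun (lie x y) = lie (sub_incl_fun x) (sub_incl_fun y).
Proof. exact: val_inj. Qed.

Definition sub_incl : lieHom (subLie P) (subLie Q) :=
  @LieHom K (subLie P) (subLie Q) sub_incl_fun sub_incl_lie.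

End SubalgebraInclusion.

Record lieRep (K : fieldType) (L : lieAlgType K) (N : lmodType K) := LieRep {
  rep_act :> L -> N -> N;
  rep_linearl : forall (k : K) x y n,
    rep_act (k *: x + y) n = k *: rep_act x n + rep_act y n;
  rep_linearr : forall (k : K) x n1 n2,
    rep_act x (k *: n1 + n2) = k *: rep_act x n1 + rep_act x n2;
  rep_lie : forall x y n,
    rep_act (lie x y) n = rep_act x (rep_act y n) - rep_act y (rep_act x n) }.

(* W ranges over all subsets of N: with the axioms of boolp, every subset is a *)
(* boolean predicate.                                                         *)
Definition irreducible_rep (K : fieldType) (L : lieAlgType K) (N : lmodType K)
    (r : lieRep L N) : Prop :=
  (exists n : N, n != 0) /\
  (forall W : {pred N}, submod_closed W ->
     (forall x : L, {in W, forall n, r x n \in W}) ->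
     W =i pred1 0 \/ W =i predT).

(* The universal enveloping algebra: the associative unital K-algebra with    *)
(* generators UGen x for x in L, subject to K-linearity of UGen and to        *)
(* UGen [x, y] = UGen x * UGen y - UGen y * UGen x. Expressions in the        *)
(* generators are identified by the least congruence ueqv containing these    *)
(* relations and the axioms of K-algebras.                                    *)
Section Enveloping.
Variables (K : fieldType) (L : lieAlgType K).

Inductive uterm :=
| UConst of K
| UGen of L
| UAdd of uterm & uterm
| UMul of uterm & uterm.

Inductive ueqv : uterm -> uterm -> Prop :=
| ueqv_refl s : ueqv s s
| ueqv_sym s t : ueqv s t -> ueqv t s
| ueqv_trans s t u : ueqv s t -> ueqv t u -> ueqv s u
| ueqv_add s s' t t' : ueqv s s' -> ueqv t t' -> ueqv (UAdd s t) (UAdd s' t')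
| ueqv_mul s s' t t' : ueqv s s' -> ueqv t t' -> ueqv (UMul s t) (UMul s' t')
| ueqv_addA s t u : ueqv (UAdd s (UAdd t u)) (UAdd (UAdd s t) u)
| ueqv_addC s t : ueqv (UAdd s t) (UAdd t s)
| ueqv_add0 s : ueqv (UAdd (UConst 0) s) s
| ueqv_addN s : ueqv (UAdd (UMul (UConst (-1)) s) s) (UConst 0)
| ueqv_mulA s t u : ueqv (UMul s (UMul t u)) (UMul (UMul s t) u)
| ueqv_mul1 s : ueqv (UMul (UConst 1) s) s
| ueqv_mulDl s t u : ueqv (UMul (UAdd s t) u) (UAdd (UMul s u) (UMul t u))
| ueqv_mulDr s t u : ueqv (UMul s (UAdd t u)) (UAdd (UMul s t) (UMul s u))
| ueqv_constD k l : ueqv (UConst (k + l)) (UAdd (UConst k) (UConst l))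
| ueqv_constM k l : ueqv (UConst (k * l)) (UMul (UConst k) (UConst l))
| ueqv_constC k s : ueqv (UMul (UConst k) s) (UMul s (UConst k))
| ueqv_lin k x y :
    ueqv (UGen (k *: x + y)) (UAdd (UMul (UConst k) (UGen x)) (UGen y))
| ueqv_lie x y :
    ueqv (UGen (lie x y))
      (UAdd (UMul (UGen x) (UGen y))
            (UMul (UConst (-1)) (UMul (UGen y) (UGen x)))).

HB.instance Definition _ := gen_eqMixin uterm.
HB.instance Definition _ := gen_choiceMixin uterm.

Definition ueqvb (s t : uterm) := `[< ueqv s t >].

Fact ueqvb_refl : reflexive ueqvb.
Proof. by move=> s; apply/asboolP/ueqv_refl. Qed.
Fact ueqvb_sym : symmetric ueqvb.
Proof. by move=> s t; apply/asboolP/asboolP => /ueqv_sym. Qed.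
Fact ueqvb_trans : transitive ueqvb.
Proof. by move=> t s u /asboolP st /asboolP /(ueqv_trans st) ?; apply/asboolP. Qed.
Canonical ueqv_equiv := EquivRel ueqvb ueqvb_refl ueqvb_sym ueqvb_trans.

Definition uea := {eq_quot ueqvb}%qT.
HB.instance Definition _ := Choice.on uea.
HB.instance Definition _ := EqQuotient.on uea.

Definition uea_pi (s : uterm) : uea := \pi_uea%qT s.
Definition uea_repr (a : uea) : uterm := repr a.

Lemma uea_piP s t : reflect (ueqv s t) (uea_pi s == uea_pi t).
Proof. by rewrite [_ == _]eqmodE; apply: asboolP. Qed.
Lemma uea_pi_eq s t : ueqv s t -> uea_pi s = uea_pi t.
Proof. by move=> /uea_piP/eqP. Qed.
Lemma uea_reprK : cancel uea_repr uea_pi.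
Proof. exact: reprK. Qed.
Lemma uea_piK s : ueqv (uea_repr (uea_pi s)) s.
Proof. by apply/uea_piP; rewrite uea_reprK. Qed.

Definition uea_add a b := uea_pi (UAdd (uea_repr a) (uea_repr b)).
Definition uea_mul a b := uea_pi (UMul (uea_repr a) (uea_repr b)).
Definition uea_const k := uea_pi (UConst k).
Definition uea_gen x := uea_pi (UGen x).

Lemma uea_addE s t : uea_add (uea_pi s) (uea_pi t) = uea_pi (UAdd s t).
Proof. by apply/uea_pi_eq/ueqv_add; apply: uea_piK. Qed.
Lemma uea_mulE s t : uea_mul (uea_pi s) (uea_pi t) = uea_pi (UMul s t).
Proof. by apply/uea_pi_eq/ueqv_mul; apply: uea_piK. Qed.

Lemma uea_ind_pi (P : uea -> Prop) : (forall s, P (uea_pi s)) -> forall a, P a.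
Proof. by move=> H a; rewrite -[a]uea_reprK. Qed.

Let E := (uea_addE, uea_mulE).

Fact uea_addA : associative uea_add.
Proof.
do 3!elim/uea_ind_pi=> ?; rewrite !E.
exact/uea_pi_eq/ueqv_addA.
Qed.
Fact uea_addC : commutative uea_add.
Proof. by do 2!elim/uea_ind_pi=> ?; rewrite /uea_const !E; apply/uea_pi_eq/ueqv_addC. Qed.
Fact uea_add0 : left_id (uea_const 0) uea_add.
Proof. by elim/uea_ind_pi=> ?; rewrite /uea_const !E; apply/uea_pi_eq/ueqv_add0. Qed.
Fact uea_addN : left_inverse (uea_const 0) (uea_mul (uea_const (-1))) uea_add.
Proof. by elim/uea_ind_pi=> ?; rewrite /uea_const !E; apply/uea_pi_eq/ueqv_addN. Qed.
HB.instance Definition _ :=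
  GRing.isZmodule.Build uea uea_addA uea_addC uea_add0 uea_addN.

Fact uea_mulA : associative uea_mul.
Proof. by do 3!elim/uea_ind_pi=> ?; rewrite /uea_const !E; apply/uea_pi_eq/ueqv_mulA. Qed.
Fact uea_mul1l : left_id (uea_const 1) uea_mul.
Proof. by elim/uea_ind_pi=> ?; rewrite /uea_const !E; apply/uea_pi_eq/ueqv_mul1. Qed.
Fact uea_constC k a : uea_mul (uea_const k) a = uea_mul a (uea_const k).
Proof. by elim/uea_ind_pi: a => ?; rewrite /uea_const !E; apply/uea_pi_eq/ueqv_constC. Qed.
Fact uea_mul1r : right_id (uea_const 1) uea_mul.
Proof. by move=> a; rewrite -uea_constC uea_mul1l. Qed.
Fact uea_mulDl : left_distributive uea_mul uea_add.
Proof. by do 3!elim/uea_ind_pi=> ?; rewrite /uea_const !E; apply/uea_pi_eq/ueqv_mulDl. Qed.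
Fact uea_mulDr : right_distributive uea_mul uea_add.
Proof. by do 3!elim/uea_ind_pi=> ?; rewrite /uea_const !E; apply/uea_pi_eq/ueqv_mulDr. Qed.

Fixpoint augmentation (s : uterm) : K :=
  match s with
  | UConst k => k
  | UGen _ => 0
  | UAdd s t => augmentation s + augmentation t
  | UMul s t => augmentation s * augmentation t
  end.

Lemma augmentation_eqv s t : ueqv s t -> augmentation s = augmentation t.
Proof.
elim=> //= {s t}; try by move=> *; congruence.
- by move=> *; apply: addrA.
- by move=> *; apply: addrC.
- by move=> *; apply: add0r.
- by move=> *; rewrite mulN1r addNr.
- by move=> *; apply: mulrA.
- by move=> *; apply: mul1r.
- by move=> *; apply: mulrDl.
- by move=> *; apply: mulrDr.
- by move=> *; apply: mulrC.
- by move=> *; rewrite mulr0 addr0.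
- by move=> *; rewrite !mulr0 addr0.
Qed.

Fact uea_const1_neq0 : uea_const 1 != 0.
Proof.
apply/negP => /uea_piP/augmentation_eqv/eqP/=.
by rewrite oner_eq0.
Qed.

HB.instance Definition _ := GRing.Zmodule_isNzRing.Build uea
  uea_mulA uea_mul1l uea_mul1r uea_mulDl uea_mulDr uea_const1_neq0.

Definition uea_scale k (a : uea) : uea := uea_const k * a.

Fact uea_scaleA k l a : uea_scale k (uea_scale l a) = uea_scale (k * l) a.
Proof.
rewrite /uea_scale mulrA; congr (_ * a).
by rewrite [LHS]uea_mulE; apply/esym/uea_pi_eq/ueqv_constM.
Qed.
Fact uea_scale1 : left_id 1 uea_scale.
Proof. exact: mul1r. Qed.
Fact uea_scaleDr : right_distributive uea_scale +%R.
Proof. by move=> k a b; apply: mulrDr. Qed.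
Fact uea_scaleDl a : {morph uea_scale^~ a : k l / k + l}.
Proof.
move=> k l; rewrite /uea_scale -mulrDl; congr (_ * a).
by rewrite [RHS]uea_addE; apply/uea_pi_eq/ueqv_constD.
Qed.
HB.instance Definition _ := GRing.Zmodule_isLmodule.Build K uea
  uea_scaleA uea_scale1 uea_scaleDr uea_scaleDl.

Fact uea_scaleAl (k : K) (a b : uea) : k *: (a * b) = k *: a * b.
Proof. exact: mulrA. Qed.
HB.instance Definition _ := GRing.Lmodule_isLalgebra.Build K uea uea_scaleAl.
Fact uea_scaleAr (k : K) (a b : uea) : k *: (a * b) = a * (k *: b).
Proof.
rewrite /GRing.scale/= /uea_scale !mulrA; congr (_ * b).
exact: uea_constC.
Qed.
HB.instance Definition _ := GRing.Lalgebra_isAlgebra.Build K uea uea_scaleAr.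

Lemma uea_gen_linear : linear uea_gen.
Proof.
move=> k x y; rewrite [LHS](uea_pi_eq (ueqv_lin k x y)) -uea_addE.
by congr (_ + _); rewrite -uea_mulE.
Qed.

Lemma uea_gen_lie x y :
  uea_gen (lie x y) = uea_gen x * uea_gen y - uea_gen y * uea_gen x.
Proof.
rewrite [LHS](uea_pi_eq (ueqv_lie x y)) -uea_addE.
by congr (_ + _); rewrite -!uea_mulE.
Qed.

Section Action.
Variables (N : lmodType K) (r : lieRep L N).

Fixpoint uterm_act (s : uterm) (n : N) : N :=
  match s with
  | UConst k => k *: n
  | UGen x => r x n
  | UAdd s t => uterm_act s n + uterm_act t n
  | UMul s t => uterm_act s (uterm_act t n)
  end.

Lemma uterm_act_linear s : linear (uterm_act s).
Proof.
elim: s => [k|x|s IHs t IHt|s IHs t IHt] l n m /=.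
- by rewrite scalerDr !scalerA mulrC.
- exact: rep_linearr.
- by rewrite IHs IHt scalerDr addrACA.
- by rewrite IHt IHs.
Qed.

Lemma uterm_act_eqv s t : ueqv s t -> uterm_act s =1 uterm_act t.
Proof.
have actD u n m : uterm_act u (n + m) = uterm_act u n + uterm_act u m.
  by have := uterm_act_linear u 1 n m; rewrite !scale1r.
have act0 u : uterm_act u 0 = 0.
  by have /(_ (-1) 0 0) := uterm_act_linear u;
     rewrite scaler0 addr0 scaleN1r addNr.
have actZ u k n : uterm_act u (k *: n) = k *: uterm_act u n.
  by rewrite -[k *: n]addr0 uterm_act_linear act0 addr0.
elim=> //= {s t}.
- by move=> s t _ IH n; rewrite IH.
- by move=> s t u _ IH1 _ IH2 n; rewrite IH1 IH2.
- by move=> s s' t t' _ IH1 _ IH2 n; rewrite IH1 IH2.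
- by move=> s s' t t' _ IH1 _ IH2 n; rewrite IH2 IH1.
- by move=> s t u n; apply: addrA.
- by move=> s t n; apply: addrC.
- by move=> s n; rewrite scale0r add0r.
- by move=> s n; rewrite scaleN1r scale0r addNr.
- by move=> s n; rewrite scale1r.
- by move=> s t u n; rewrite actD.
- by move=> k l n; rewrite scalerDl.
- by move=> k l n; rewrite scalerA.
- by move=> k s n; rewrite actZ.
- by move=> k x y n; rewrite rep_linearl.
- by move=> x y n; rewrite scaleN1r rep_lie.
Qed.

Definition uea_act (a : uea) (n : N) : N := uterm_act (uea_repr a) n.

Lemma uea_actE s n : uea_act (uea_pi s) n = uterm_act s n.
Proof. exact/uterm_act_eqv/uea_piK. Qed.

End Action.
End Enveloping.

Section EnvelopingMap.
Variables (K : fieldType) (L1 L2 : lieAlgType K) (f : lieHom L1 L2).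

Fixpoint uterm_map (s : uterm L1) : uterm L2 :=
  match s with
  | UConst k => UConst L2 k
  | UGen x => UGen (f x)
  | UAdd s t => UAdd (uterm_map s) (uterm_map t)
  | UMul s t => UMul (uterm_map s) (uterm_map t)
  end.

Lemma uterm_map_eqv s t : ueqv s t -> ueqv (uterm_map s) (uterm_map t).
Proof.
elim=> /= *; rewrite ?linearP ?lie_homM; try by constructor.
by apply: ueqv_trans; eassumption.
Qed.

Definition uea_map (a : uea L1) : uea L2 := uea_pi (uterm_map (uea_repr a)).

Lemma uea_mapE s : uea_map (uea_pi s) = uea_pi (uterm_map s).
Proof. exact/uea_pi_eq/uterm_map_eqv/uea_piK. Qed.

Lemma uea_map_is_monoid_morphism : monoid_morphism uea_map.
Proof.
split=> [|a b]; first exact: uea_mapE.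
elim/uea_ind_pi: a => s; elim/uea_ind_pi: b => t.
by rewrite [_ * _]uea_mulE !uea_mapE/= -uea_mulE.
Qed.
Lemma uea_map_is_linear : linear uea_map.
Proof.
move=> k a b; elim/uea_ind_pi: a => s; elim/uea_ind_pi: b => t.
rewrite [k *: _]uea_mulE [_ + _]uea_addE !uea_mapE/= -uea_addE.
by rewrite -uea_mulE.
Qed.
HB.instance Definition _ :=
  GRing.isLinear.Build K (uea L1) (uea L2) *:%R uea_map uea_map_is_linear.
HB.instance Definition _ := GRing.isMonoidMorphism.Build (uea L1) (uea L2)
  uea_map uea_map_is_monoid_morphism.

End EnvelopingMap.

(* The tensor product U(L2) (x)_{U(L1)} N, where U(L1) acts on U(L2) from the *)
(* right through f: the abelian group with generators ITens a n subject to    *)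
(* biadditivity and ITens (a * f b) n = ITens a (b n) for b in U(L1).         *)
Section Induction.
Variables (K : fieldType) (L1 L2 : lieAlgType K) (f : lieHom L1 L2).
Variables (N : lmodType K) (r : lieRep L1 N).

Inductive iterm :=
| IZero
| IOpp of iterm
| IAdd of iterm & iterm
| ITens of uea L2 & N.

Inductive ieqv : iterm -> iterm -> Prop :=
| ieqv_refl s : ieqv s s
| ieqv_sym s t : ieqv s t -> ieqv t s
| ieqv_trans s t u : ieqv s t -> ieqv t u -> ieqv s u
| ieqv_opp s s' : ieqv s s' -> ieqv (IOpp s) (IOpp s')
| ieqv_add s s' t t' : ieqv s s' -> ieqv t t' -> ieqv (IAdd s t) (IAdd s' t')
| ieqv_addA s t u : ieqv (IAdd s (IAdd t u)) (IAdd (IAdd s t) u)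
| ieqv_addC s t : ieqv (IAdd s t) (IAdd t s)
| ieqv_add0 s : ieqv (IAdd IZero s) s
| ieqv_addN s : ieqv (IAdd (IOpp s) s) IZero
| ieqv_tensDl a b n : ieqv (ITens (a + b) n) (IAdd (ITens a n) (ITens b n))
| ieqv_tensDr a n m : ieqv (ITens a (n + m)) (IAdd (ITens a n) (ITens a m))
| ieqv_tensM a (b : uea L1) n :
    ieqv (ITens (a * uea_map f b) n) (ITens a (uea_act r b n)).

HB.instance Definition _ := gen_eqMixin iterm.
HB.instance Definition _ := gen_choiceMixin iterm.

Definition ieqvb (s t : iterm) := `[< ieqv s t >].

Fact ieqvb_refl : reflexive ieqvb.
Proof. by move=> s; apply/asboolP/ieqv_refl. Qed.
Fact ieqvb_sym : symmetric ieqvb.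
Proof. by move=> s t; apply/asboolP/asboolP => /ieqv_sym. Qed.
Fact ieqvb_trans : transitive ieqvb.
Proof. by move=> t s u /asboolP st /asboolP /(ieqv_trans st) ?; apply/asboolP. Qed.
Canonical ieqv_equiv := EquivRel ieqvb ieqvb_refl ieqvb_sym ieqvb_trans.

Definition ind := {eq_quot ieqvb}%qT.
HB.instance Definition _ := Choice.on ind.
HB.instance Definition _ := EqQuotient.on ind.

Definition ind_pi (s : iterm) : ind := \pi_ind%qT s.
Definition ind_repr (m : ind) : iterm := repr m.

Lemma ind_piP s t : reflect (ieqv s t) (ind_pi s == ind_pi t).
Proof. by rewrite [_ == _]eqmodE; apply: asboolP. Qed.
Lemma ind_pi_eq s t : ieqv s t -> ind_pi s = ind_pi t.
Proof. by move=> /ind_piP/eqP. Qed.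
Lemma ind_reprK : cancel ind_repr ind_pi.
Proof. exact: reprK. Qed.
Lemma ind_piK s : ieqv (ind_repr (ind_pi s)) s.
Proof. by apply/ind_piP; rewrite ind_reprK. Qed.
Lemma ind_ind_pi (P : ind -> Prop) : (forall s, P (ind_pi s)) -> forall m, P m.
Proof. by move=> H m; rewrite -[m]ind_reprK. Qed.

Definition ind_opp m := ind_pi (IOpp (ind_repr m)).
Definition ind_add m1 m2 := ind_pi (IAdd (ind_repr m1) (ind_repr m2)).

Lemma ind_oppE s : ind_opp (ind_pi s) = ind_pi (IOpp s).
Proof. by apply/ind_pi_eq/ieqv_opp; apply: ind_piK. Qed.
Lemma ind_addE s t : ind_add (ind_pi s) (ind_pi t) = ind_pi (IAdd s t).
Proof. by apply/ind_pi_eq/ieqv_add; apply: ind_piK. Qed.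

Let E := (ind_oppE, ind_addE).

Fact ind_addA : associative ind_add.
Proof. by do 3!elim/ind_ind_pi=> ?; rewrite !E; apply/ind_pi_eq/ieqv_addA. Qed.
Fact ind_addC : commutative ind_add.
Proof. by do 2!elim/ind_ind_pi=> ?; rewrite !E; apply/ind_pi_eq/ieqv_addC. Qed.
Fact ind_add0 : left_id (ind_pi IZero) ind_add.
Proof. by elim/ind_ind_pi=> ?; rewrite !E; apply/ind_pi_eq/ieqv_add0. Qed.
Fact ind_addN : left_inverse (ind_pi IZero) ind_opp ind_add.
Proof. by elim/ind_ind_pi=> ?; rewrite !E; apply/ind_pi_eq/ieqv_addN. Qed.
HB.instance Definition _ :=
  GRing.isZmodule.Build ind ind_addA ind_addC ind_add0 ind_addN.

Definition tens (a : uea L2) (n : N) : ind := ind_pi (ITens a n).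

Lemma tensDl a b n : tens (a + b) n = tens a n + tens b n.
Proof. by rewrite [RHS]ind_addE; apply/ind_pi_eq/ieqv_tensDl. Qed.
Lemma tensDr a n m : tens a (n + m) = tens a n + tens a m.
Proof. by rewrite [RHS]ind_addE; apply/ind_pi_eq/ieqv_tensDr. Qed.
Lemma tensM a b n : tens (a * uea_map f b) n = tens a (uea_act r b n).
Proof. exact/ind_pi_eq/ieqv_tensM. Qed.

Lemma ind_tens_ind (P : ind -> Prop) :
  P 0 -> (forall m, P m -> P (- m)) ->
  (forall m1 m2, P m1 -> P m2 -> P (m1 + m2)) ->
  (forall a n, P (tens a n)) -> forall m, P m.
Proof.
move=> P0 PN PD PT; elim/ind_ind_pi; elim=> //.
- by move=> s /PN; rewrite [- _]ind_oppE.
- by move=> s Ps t /(PD _ _ Ps); rewrite [_ + _]ind_addE.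
Qed.

Fixpoint imul (c : uea L2) (s : iterm) : iterm :=
  match s with
  | IZero => IZero
  | IOpp s => IOpp (imul c s)
  | IAdd s t => IAdd (imul c s) (imul c t)
  | ITens a n => ITens (c * a) n
  end.

Lemma imul_eqv c s t : ieqv s t -> ieqv (imul c s) (imul c t).
Proof.
elim=> /= *; rewrite ?mulrDr ?mulrA; try by constructor.
by apply: ieqv_trans; eassumption.
Qed.

Definition ind_mul (c : uea L2) (m : ind) : ind := ind_pi (imul c (ind_repr m)).

Lemma ind_mulE c s : ind_mul c (ind_pi s) = ind_pi (imul c s).
Proof. exact/ind_pi_eq/imul_eqv/ind_piK. Qed.
Lemma ind_mul_tens c a n : ind_mul c (tens a n) = tens (c * a) n.
Proof. exact: ind_mulE. Qed.

Lemma ind_mulDr c : {morph ind_mul c : m1 m2 / m1 + m2}.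
Proof.
by do 2!elim/ind_ind_pi=> ?; rewrite [_ + _]ind_addE !ind_mulE/= -ind_addE.
Qed.
Lemma ind_mulN c m : ind_mul c (- m) = - ind_mul c m.
Proof. by elim/ind_ind_pi: m => ?; rewrite [- _]ind_oppE !ind_mulE/= -ind_oppE. Qed.
Lemma ind_mul0 c : ind_mul c 0 = 0.
Proof. exact: ind_mulE. Qed.
Lemma ind_mulDl m : {morph ind_mul^~ m : c d / c + d}.
Proof.
move=> c d; elim/ind_tens_ind: m => [|m IH|m1 m2 IH1 IH2|a n].
- by rewrite !ind_mul0 addr0.
- by rewrite !ind_mulN IH opprD.
- by rewrite !ind_mulDr IH1 IH2 addrACA.
- by rewrite !ind_mul_tens mulrDl tensDl.
Qed.
Lemma ind_mulA c d m : ind_mul c (ind_mul d m) = ind_mul (c * d) m.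
Proof.
elim/ind_tens_ind: m => [|m IH|m1 m2 IH1 IH2|a n].
- by rewrite !ind_mul0.
- by rewrite !ind_mulN IH.
- by rewrite !ind_mulDr IH1 IH2.
- by rewrite !ind_mul_tens mulrA.
Qed.
Lemma ind_mul1 m : ind_mul 1 m = m.
Proof.
elim/ind_tens_ind: m => [|m IH|m1 m2 IH1 IH2|a n].
- by rewrite !ind_mul0.
- by rewrite !ind_mulN IH.
- by rewrite !ind_mulDr IH1 IH2.
- by rewrite !ind_mul_tens mul1r.
Qed.

Definition ind_scale (k : K) (m : ind) : ind := ind_mul k%:A m.

Fact ind_scaleA k l m : ind_scale k (ind_scale l m) = ind_scale (k * l) m.
Proof. by rewrite /ind_scale ind_mulA -scalerAl mul1r scalerA. Qed.
Fact ind_scale1 : left_id 1 ind_scale.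
Proof. by move=> m; rewrite /ind_scale scale1r ind_mul1. Qed.
Fact ind_scaleDr : right_distributive ind_scale +%R.
Proof. by move=> k m1 m2; apply: ind_mulDr. Qed.
Fact ind_scaleDl m : {morph ind_scale^~ m : k l / k + l}.
Proof. by move=> k l; rewrite /ind_scale scalerDl ind_mulDl. Qed.
HB.instance Definition _ := GRing.Zmodule_isLmodule.Build K ind
  ind_scaleA ind_scale1 ind_scaleDr ind_scaleDl.

Definition ind_act (x : L2) (m : ind) : ind := ind_mul (uea_gen x) m.

Fact ind_act_linearl (k : K) x y m :
  ind_act (k *: x + y) m = k *: ind_act x m + ind_act y m.
Proof.
rewrite /ind_act uea_gen_linear ind_mulDl; congr (_ + _).
by rewrite [RHS]ind_mulA -scalerAl mul1r.
Qed.
Fact ind_act_linearr (k : K) x m1 m2 :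
  ind_act x (k *: m1 + m2) = k *: ind_act x m1 + ind_act x m2.
Proof.
rewrite /ind_act ind_mulDr; congr (_ + _).
by rewrite [LHS]ind_mulA [RHS]ind_mulA -scalerAl mul1r -scalerAr mulr1.
Qed.
Fact ind_act_lie x y m :
  ind_act (lie x y) m = ind_act x (ind_act y m) - ind_act y (ind_act x m).
Proof.
rewrite /ind_act uea_gen_lie ind_mulDl !ind_mulA; congr (_ + _).
apply/eqP; rewrite -addr_eq0 -ind_mulDl addNr; apply/eqP.
by apply: (addrI (ind_mul 0 m)); rewrite -ind_mulDl !addr0.
Qed.

Definition ind_rep : lieRep L2 ind :=
  LieRep ind_act_linearl ind_act_linearr ind_act_lie.

End Induction.

(* The loop algebra g (x) K[t, t^-1]: a loop u is the Laurent polynomial      *)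
(* \sum_m u@_m (x) t^m, and << x *g m >> is x (x) t^m.                        *)
Definition loop (K : fieldType) (g : lieAlgType K) := {malg g[int]}.

Section LoopModule.
Variables (K : fieldType) (g : lieAlgType K).

HB.instance Definition _ := GRing.Zmodule.on (loop g).

Definition loop_scale (k : K) (u : loop g) : loop g :=
  [malg m in msupp u => k *: u@_m].

Lemma loop_scaleE k u m : (loop_scale k u)@_m = k *: u@_m.
Proof. by rewrite mcoeffE; case: msuppP; rewrite ?scaler0. Qed.

Fact loop_scaleA k l u : loop_scale k (loop_scale l u) = loop_scale (k * l) u.
Proof. by apply/malgP=> m; rewrite !loop_scaleE scalerA. Qed.
Fact loop_scale1 : left_id 1 loop_scale.
Proof. by move=> u; apply/malgP=> m; rewrite loop_scaleE scale1r. Qed.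
Fact loop_scaleDr : right_distributive loop_scale +%R.
Proof.
by move=> k u v; apply/malgP=> m; rewrite !(loop_scaleE, mcoeffD) scalerDr.
Qed.
Fact loop_scaleDl u : {morph loop_scale^~ u : k l / k + l}.
Proof.
by move=> k l; apply/malgP=> m; rewrite !(loop_scaleE, mcoeffD) scalerDl.
Qed.
HB.instance Definition _ := GRing.Zmodule_isLmodule.Build K (loop g)
  loop_scaleA loop_scale1 loop_scaleDr loop_scaleDl.

Lemma loop_coefP (k : K) (u v : loop g) m :
  (k *: u + v)@_m = k *: u@_m + v@_m.
Proof. by rewrite mcoeffD loop_scaleE. Qed.

Definition mono (x : g) (m : int) : loop g := << x *g m >>.

Lemma mono_linear m : linear (mono^~ m).
Proof.
move=> k x y; apply/malgP=> n; rewrite loop_coefP !mcoeffU.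
by case: eqP => _; rewrite ?mulr1n // !mulr0n scaler0 addr0.
Qed.

Lemma loop_mono_ind (P : loop g -> Prop) :
  P 0 -> (forall u v, P u -> P v -> P (u + v)) -> (forall x m, P (mono x m)) ->
  forall u, P u.
Proof.
move=> P0 PD PU u; rewrite [u]monalgE.
by elim/big_rec: _ => // m v _; apply: PD; apply: PU.
Qed.

Section Extension.
Variables (V : lmodType K) (F : int -> g -> V).
Hypothesis FL : forall m, linear (F m).

Definition loop_ext (u : loop g) : V := \sum_(m <- msupp u) F m u@_m.

Lemma loop_ext_eq0 m : F m 0 = 0.
Proof. by have := FL m (-1) 0 0; rewrite scaler0 addr0 scaleN1r addNr. Qed.

Lemma loop_extEw (d : {fset int}) u : (msupp u `<=` d)%fset ->
  loop_ext u = \sum_(m <- d) F m u@_m.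
Proof.
move=> le; rewrite [LHS](big_fset_incl _ le) => //= x xd /mcoeff_outdom ->.
exact: loop_ext_eq0.
Qed.

Lemma loop_ext_linear : linear loop_ext.
Proof.
move=> k u v.
pose d := (msupp u `|` msupp v `|` msupp (k *: u + v))%fset.
rewrite !(@loop_extEw d) ?fsubsetUr //; last first.
- by rewrite /d -fsetUA fsubsetUl.
- by rewrite /d fsetUAC fsubsetUr.
rewrite scaler_sumr -big_split/=; apply: eq_bigr => m _.
by rewrite loop_coefP FL.
Qed.

Lemma loop_ext_mono x m : loop_ext (mono x m) = F m x.
Proof. by rewrite (loop_extEw msuppU_le) big_seq_fset1 mcoeffUU. Qed.

End Extension.

(* [x t^m, y t^n] = [x, y] t^(m + n), extended bilinearly. *)
Definition loop_lie (u v : loop g) : loop g :=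
  \sum_(m <- msupp u) \sum_(n <- msupp v) mono (lie u@_m v@_n) (m + n).

Let loop_lieE u v : loop_lie u v =
  loop_ext (fun m x => loop_ext (fun n y => mono (lie x y) (m + n)) v) u.
Proof. by []. Qed.

Let inner m x n : linear (fun y => mono (lie x y) (m + n)).
Proof. by move=> k y z; rewrite lie_linearr mono_linear. Qed.
Let outer m v :
  linear (fun x => loop_ext (fun n y => mono (lie x y) (m + n)) v).
Proof.
move=> k x y; rewrite /loop_ext scaler_sumr -big_split/=.
by apply: eq_bigr => n _; rewrite lie_linearl mono_linear.
Qed.

Fact loop_lie_linearl (k : K) u1 u2 v :
  loop_lie (k *: u1 + u2) v = k *: loop_lie u1 v + loop_lie u2 v.
Proof. by rewrite !loop_lieE loop_ext_linear // => m; apply: outer. Qed.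
Fact loop_lie_linearr (k : K) u v1 v2 :
  loop_lie u (k *: v1 + v2) = k *: loop_lie u v1 + loop_lie u v2.
Proof.
rewrite !loop_lieE /(loop_ext _ u) scaler_sumr -big_split/=.
by apply: eq_bigr => m _; apply: loop_ext_linear => n; apply: inner.
Qed.
Lemma loop_lie_mono x m y n :
  loop_lie (mono x m) (mono y n) = mono (lie x y) (m + n).
Proof.
rewrite loop_lieE loop_ext_mono; last by move=> k; apply: outer.
by rewrite loop_ext_mono // => k; apply: inner.
Qed.

Lemma loop_lieDl u1 u2 v : loop_lie (u1 + u2) v = loop_lie u1 v + loop_lie u2 v.
Proof. by rewrite -[u1]scale1r loop_lie_linearl !scale1r. Qed.
Lemma loop_lieDr u v1 v2 : loop_lie u (v1 + v2) = loop_lie u v1 + loop_lie u v2.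
Proof. by rewrite -[v1]scale1r loop_lie_linearr !scale1r. Qed.
Lemma loop_lie0l v : loop_lie 0 v = 0.
Proof. by apply: (addrI (loop_lie 0 v)); rewrite -loop_lieDl !addr0. Qed.
Lemma loop_lie0r v : loop_lie v 0 = 0.
Proof. by apply: (addrI (loop_lie v 0)); rewrite -loop_lieDr !addr0. Qed.

Lemma loop_lieC u v : loop_lie u v = - loop_lie v u.
Proof.
elim/loop_mono_ind: u => [|u1 u2 IH1 IH2|x m].
- by rewrite loop_lie0l loop_lie0r oppr0.
- by rewrite loop_lieDl loop_lieDr IH1 IH2 opprD.
elim/loop_mono_ind: v => [|v1 v2 IH1 IH2|y n].
- by rewrite loop_lie0l loop_lie0r oppr0.
- by rewrite loop_lieDl loop_lieDr IH1 IH2 opprD.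
by rewrite !loop_lie_mono lieC addrC /mono monalgUN.
Qed.

Fact loop_jacobi u v w :
  loop_lie u (loop_lie v w) + loop_lie v (loop_lie w u)
  + loop_lie w (loop_lie u v) = 0.
Proof.
have sum6 (a b c a' b' c' : loop g) :
  a + b + c = 0 -> a' + b' + c' = 0 -> (a + a') + (b + b') + (c + c') = 0.
  by move=> e e'; rewrite !(addrACA _ a') (addrACA _ (a' + b')) e e' addr0.
elim/loop_mono_ind: u => [|u1 u2 IH1 IH2|x m].
- by rewrite !(loop_lie0l, loop_lie0r) !addr0.
- by rewrite !(loop_lieDl, loop_lieDr) sum6.
elim/loop_mono_ind: v => [|v1 v2 IH1 IH2|y n].
- by rewrite !(loop_lie0l, loop_lie0r) !addr0.
- by rewrite !(loop_lieDl, loop_lieDr) sum6.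
elim/loop_mono_ind: w => [|w1 w2 IH1 IH2|z p].
- by rewrite !(loop_lie0l, loop_lie0r) !addr0.
- by rewrite !(loop_lieDl, loop_lieDr) sum6.
rewrite !loop_lie_mono (addrC p m) (addrCA n) !addrA (addrC p m).
rewrite (addrAC m p) /mono -!monalgUD lie_jacobi.
by rewrite monalgU0.
Qed.


End LoopModule.

Record invForm (K : fieldType) (g : lieAlgType K) := InvForm {
  form :> g -> g -> K;
  form_linearl : forall (k : K) x1 x2 y,
    form (k *: x1 + x2) y = k * form x1 y + form x2 y;
  form_sym : forall x y, form x y = form y x;
  form_inv : forall x y z, form (lie x y) z = form x (lie y z);
  form_nondeg : forall x, (forall y, form x y = 0) -> x = 0 }.

Section FormTheory.
Variables (K : fieldType) (g : lieAlgType K) (B : invForm g).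

Lemma form_linearr k x y1 y2 : B x (k *: y1 + y2) = k * B x y1 + B x y2.
Proof. by rewrite form_sym form_linearl !(form_sym B x). Qed.
Lemma formDl x1 x2 y : B (x1 + x2) y = B x1 y + B x2 y.
Proof. by rewrite -[x1]scale1r form_linearl scale1r mul1r. Qed.
Lemma formDr x y1 y2 : B x (y1 + y2) = B x y1 + B x y2.
Proof. by rewrite form_sym formDl !(form_sym B x). Qed.
Lemma form0l y : B 0 y = 0.
Proof. by apply: (addrI (B 0 y)); rewrite -formDl !addr0. Qed.
Lemma form0r y : B y 0 = 0.
Proof. by rewrite form_sym form0l. Qed.
Lemma formZl k x y : B (k *: x) y = k * B x y.
Proof. by rewrite -[k *: x]addr0 form_linearl form0l addr0. Qed.

End FormTheory.

Section Affine.
Variables (K : numFieldType) (g : lieAlgType K) (B : invForm g).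

Lemma lmod_self_opp (V : lmodType K) (v : V) : v = - v -> v = 0.
Proof.
move/eqP; rewrite -addr_eq0 -mulr2n -scaler_nat => /eqP e.
apply: (can_inj (scalerK _)) (_ : 2%:R *: v = 2%:R *: 0); last first.
  by rewrite scaler0.
by rewrite pnatr_eq0.
Qed.

Fact loop_liexx (u : loop g) : loop_lie u u = 0.
Proof. exact/lmod_self_opp/loop_lieC. Qed.
HB.instance Definition _ := isLieAlgebra.Build K (loop g)
  (@loop_lie_linearl K g) (@loop_lie_linearr K g) loop_liexx (@loop_jacobi K g).

(* \sum_(m, n) delta_(m + n, 0) m (u_m | v_n) *)
Definition cocycle (u v : loop g) : K :=
  \sum_(m <- msupp u) m%:~R * B u@_m v@_(- m).

Let outer v m : linear (fun x => m%:~R * B x v@_(- m) : K^o).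
Proof. by move=> k x y; rewrite form_linearl mulrDr mulrCA. Qed.

Let cocycleE u v :
  cocycle u v = loop_ext (fun m x => m%:~R * B x v@_(- m) : K^o) u.
Proof. by []. Qed.

Lemma cocycle_linearl (k : K) u1 u2 v :
  cocycle (k *: u1 + u2) v = k * cocycle u1 v + cocycle u2 v.
Proof. by rewrite !cocycleE loop_ext_linear // => m; apply: outer. Qed.
Lemma cocycle_linearr (k : K) u v1 v2 :
  cocycle u (k *: v1 + v2) = k * cocycle u v1 + cocycle u v2.
Proof.
rewrite mulr_sumr -big_split/=; apply: eq_bigr => m _.
by rewrite loop_coefP form_linearr mulrDr mulrCA.
Qed.
Lemma cocycle_mono x m y n :
  cocycle (mono x m) (mono y n) = if m + n == 0 then m%:~R * B x y else 0.
Proof.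
rewrite cocycleE loop_ext_mono; last exact: outer.
rewrite mcoeffU addrC addr_eq0; case: eqP => _; rewrite ?mulr1n//.
by rewrite mulr0n form0r mulr0.
Qed.
Lemma cocycleDl u1 u2 v : cocycle (u1 + u2) v = cocycle u1 v + cocycle u2 v.
Proof. by rewrite -[u1]scale1r cocycle_linearl scale1r mul1r. Qed.
Lemma cocycleDr u v1 v2 : cocycle u (v1 + v2) = cocycle u v1 + cocycle u v2.
Proof. by rewrite -[v1]scale1r cocycle_linearr scale1r mul1r. Qed.
Lemma cocycle0l v : cocycle 0 v = 0.
Proof. by apply: (addrI (cocycle 0 v)); rewrite -cocycleDl !addr0. Qed.
Lemma cocycle0r v : cocycle v 0 = 0.
Proof. by apply: (addrI (cocycle v 0)); rewrite -cocycleDr !addr0. Qed.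

Lemma cocycleC u v : cocycle u v = - cocycle v u.
Proof.
elim/loop_mono_ind: u => [|u1 u2 IH1 IH2|x m].
- by rewrite cocycle0l cocycle0r oppr0.
- by rewrite cocycleDl cocycleDr IH1 IH2 opprD.
elim/loop_mono_ind: v => [|v1 v2 IH1 IH2|y n].
- by rewrite cocycle0l cocycle0r oppr0.
- by rewrite cocycleDl cocycleDr IH1 IH2 opprD.
rewrite !cocycle_mono (addrC n) form_sym; case: eqP; last by rewrite oppr0.
by move/eqP; rewrite addr_eq0 => /eqP->; rewrite rmorphN mulNr.
Qed.

Lemma cocycle_jacobi u v w :
  cocycle u (lie v w) + cocycle v (lie w u) + cocycle w (lie u v) = 0.
Proof.
have sum6 (a b c a' b' c' : K) :
  a + b + c = 0 -> a' + b' + c' = 0 -> (a + a') + (b + b') + (c + c') = 0.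
  by move=> e e'; rewrite !(addrACA _ a') (addrACA _ (a' + b')) e e' addr0.
elim/loop_mono_ind: u => [|u1 u2 IH1 IH2|x m].
- by rewrite !(lie0l, linear0, cocycle0l, cocycle0r) !addr0.
- by rewrite !(lieDl, linearD, cocycleDl, cocycleDr)/= sum6.
elim/loop_mono_ind: v => [|v1 v2 IH1 IH2|y n].
- by rewrite !(lie0l, linear0, cocycle0l, cocycle0r) !addr0.
- by rewrite !(lieDl, linearD, cocycleDl, cocycleDr)/= sum6.
elim/loop_mono_ind: w => [|w1 w2 IH1 IH2|z p].
- by rewrite !(lie0l, linear0, cocycle0l, cocycle0r) !addr0.
- by rewrite !(lieDl, linearD, cocycleDl, cocycleDr)/= sum6.
rewrite ![lie (mono _ _) _]loop_lie_mono !cocycle_mono.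
rewrite (addrC p m) (addrCA n) !addrA (addrC p m) (addrAC m p).
case: eqP => [e|]; last by rewrite !addr0.
rewrite -[B y _]form_inv [B (lie y z) _]form_sym [B z _]form_sym form_inv.
by rewrite -!mulrDl -!rmorphD/= e mul0r.
Qed.

Definition affine of invForm g : Type := (loop g * K^o)%type.
HB.instance Definition _ (C : invForm g) := GRing.Lmodule.on (affine C).

Definition affine_lie (u v : affine B) : affine B :=
  (lie u.1 v.1, cocycle u.1 v.1).

Fact affine_lie_linearl (k : K) u1 u2 v :
  affine_lie (k *: u1 + u2) v = k *: affine_lie u1 v + affine_lie u2 v.
Proof. by congr pair; [apply: lie_linearl|apply: cocycle_linearl]. Qed.
Fact affine_lie_linearr (k : K) u v1 v2 :
  affine_lie u (k *: v1 + v2) = k *: affine_lie u v1 + affine_lie u v2.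
Proof. by congr pair; [apply: lie_linearr|apply: cocycle_linearr]. Qed.
Fact affine_liexx u : affine_lie u u = 0.
Proof.
congr pair; first exact: liexx.
exact: (@lmod_self_opp K^o _ (cocycleC _ _)).
Qed.
Fact affine_lie_jacobi u v w :
  affine_lie u (affine_lie v w) + affine_lie v (affine_lie w u)
  + affine_lie w (affine_lie u v) = 0.
Proof. by congr pair; [apply: lie_jacobi|apply: cocycle_jacobi]. Qed.
HB.instance Definition _ := isLieAlgebra.Build K (affine B)
  affine_lie_linearl affine_lie_linearr affine_liexx affine_lie_jacobi.

End Affine.

Section Structure.
Variables (K : numFieldType) (g : finLieAlgType K).

Definition simple_lie : Prop :=
  (exists x y : g, lie x y != 0) /\
  (forall I : {vspace g},
     (forall x : g, {in I, forall y, lie x y \in I}) -> I = 0%VS \/ I = fullv).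

Definition ad (x : g) : 'End(g) := linfun (lie x).

Definition diagonalizable_end (f : 'End(g)) : Prop :=
  exists2 X : seq g, basis_of fullv X & {in X, forall x, exists k, f x = k *: x}.

(* Cartan subalgebras of a complex semisimple Lie algebra: self-centralizing  *)
(* commutative subspaces acting by diagonalizable endomorphisms.              *)
Definition is_cartan (h : {vspace g}) : Prop :=
  [/\ {in h &, forall x y, lie x y = 0},
      forall x, {in h, forall y, lie y x = 0} -> x \in h
    & {in h, forall x, diagonalizable_end (ad x)}].

Section Roots.
Variable h : {vspace g}.

Definition dual := 'Hom(subvs_of h, K^o).

(* {x | [H, x] = a(H) x for all H in h}, by testing on a basis of h *)
Definition root_space (a : dual) : {vspace g} :=
  (\bigcap_(i < \dim h)
     passmx.leigenspace (ad (vbasis h)`_i) (a (vsproj h (vbasis h)`_i)))%VS.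

Lemma root_spaceP (a : dual) (x : g) :
  reflect (forall H : subvs_of h, lie (vsval H) x = a H *: x)
    (x \in root_space a).
Proof.
have bE (i : 'I_(\dim h)) : vsval (vsproj h (vbasis h)`_i) = (vbasis h)`_i.
  by rewrite vsprojK // vbasis_mem // mem_nth // size_tuple.
apply: (iffP idP) => [xa H|xa]; last first.
  rewrite memvE; apply/subv_bigcapP => i _; rewrite -memvE memv_ker.
  rewrite add_lfunE opp_lfunE scale_lfunE id_lfunE lfunE/=.
  by rewrite -bE xa vsvalK subrr.
have {}xa (i : 'I_(\dim h)) :
    lie (vbasis h)`_i x = a (vsproj h (vbasis h)`_i) *: x.
  move: xa; rewrite memvE => /subv_bigcapP/(_ i isT).
  by rewrite -memvE memv_ker add_lfunE opp_lfunE scale_lfunE id_lfunE lfunE/= subr_eq0 => /eqP.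
have HE : H = \sum_i coord (vbasis h) i (vsval H) *: vsproj h (vbasis h)`_i.
  apply: val_inj; rewrite /= [LHS](coord_vbasis (subvsP H)) linear_sum.
  by apply: eq_bigr => i _; rewrite linearZ/= bE.
rewrite [in RHS]HE linear_sum scaler_suml/= [in LHS](coord_vbasis (subvsP H)).
rewrite lie_suml; apply: eq_bigr => i _.
by rewrite lieZl xa [a (_ *: _)]linearZ; apply: scalerA.
Qed.

Definition is_root (a : dual) : bool := (a != 0) && (root_space a != 0%VS).

Definition nonneg_comb (D : seq dual) (a : dual) : Prop :=
  exists k : nat -> nat, a = \sum_(i < size D) D`_i *+ k i.

Definition is_base (D : seq dual) : Prop :=
  [/\ basis_of fullv D, {in D, forall a, is_root a}
    & forall a, is_root a -> nonneg_comb D a \/ nonneg_comb D (- a)].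

End Roots.

(* The rank of g is \dim cartan. *)
Record cartan_datum := CartanDatum {
  cartan : {vspace g};
  cartanP : is_cartan cartan;
  roots : seq (dual cartan);
  rootsP : forall a, (a \in roots) = is_root a;
  simple_roots : seq (dual cartan);
  simple_rootsP : is_base simple_roots }.

Variable D : cartan_datum.
Local Notation h := (cartan D).

Definition positive (a : dual h) : bool := `[< nonneg_comb (simple_roots D) a >].

Definition nplus : {vspace g} :=
  (\sum_(a <- roots D | positive a) root_space a)%VS.


Lemma dual_separates (H : subvs_of h) : (forall a : dual h, a H = 0) -> H = 0.
Proof.
move=> aH; rewrite [H](coord_vbasis (memvf H)) big1// => i _.
have := aH (linfun (coord (vbasis fullv) i : subvs_of h -> K^o)).
by rewrite lfunE/= => ->; rewrite scale0r.
Qed.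

Lemma height_exists :
  exists H0 : subvs_of h,
    forall a : dual h, a \in simple_roots D -> a H0 = 1.
Proof.
have [Db _ _] := simple_rootsP D.
set S := simple_roots D in Db *.
pose ev (H : subvs_of h) : 'rV[K]_(size S) := \row_(i < size S) S`_i H.
have evL : linear ev.
  by move=> k x y; apply/rowP=> i; rewrite !mxE linearP.
pose evM := GRing.isLinear.Build K (subvs_of h) 'rV[K]_(size S) *:%R ev evL.
pose evF : {linear subvs_of h -> 'rV[K]_(size S)} := HB.pack ev evM.
have ker0 : lker (linfun evF) = 0%VS.
  apply/eqP/lker0P => x y; rewrite !lfunE/= => /rowP exy.
  apply/eqP; rewrite -subr_eq0; apply/eqP/dual_separates => a.
  rewrite (coord_basis (X := in_tuple S) Db (memvf a)) sum_lfunE big1// => i _.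
  have := exy i; rewrite !mxE scale_lfunE linearB/= => ->.
  by rewrite subrr scaler0.
have : \dim (limg (linfun evF)) = \dim {:'rV[K]_(size S)}.
  have := limg_ker_dim (linfun evF) fullv.
  rewrite ker0 capv0 dimv0 add0n => ->.
  have nS : size S = \dim h.
    by rewrite -(size_basis (X := in_tuple S) Db) dimvf /dim/= muln1.
  by rewrite !dimvf /dim/= mul1n nS.
move/eqP; rewrite (dimv_leqif_eq (subvf _)) => /eqP imE.
have : const_mx 1 \in limg (linfun evF) by rewrite imE memvf.
case/memv_imgP=> H0 _; rewrite lfunE/= => /rowP e; exists H0 => a aS.
have ai : (index a S < size S)%N by rewrite index_mem.
by have := e (Ordinal ai); rewrite !mxE/= nth_index.
Qed.


Lemma root_nplus (a : dual h) (x : g) :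
  a \in roots D -> positive a -> x \in root_space a -> x \in nplus.
Proof.
move=> aR pa; rewrite /nplus (big_rem a)//= pa => xa.
exact: (subvP (addvSl _ _)).
Qed.

Lemma nplus_ind (P : g -> Prop) :
  P 0 -> (forall x y, P x -> P y -> P (x + y)) ->
  (forall (a : dual h) x,
     a \in roots D -> positive a -> x \in root_space a -> P x) ->
  forall x, x \in nplus -> P x.
Proof.
move=> P0 PD PR; rewrite /nplus.
have: {subset roots D <= roots D} by [].
elim: {-2}(roots D) => [|a r IH] rR x.
  by rewrite big_nil memv0 => /eqP->.
have {}IH : forall x : g, x \in (\sum_(a <- r | positive a) root_space a)%VS -> P x.
  by apply: IH => b br; apply: rR; rewrite inE br orbT.
rewrite big_cons; case: ifP => pa; last exact: IH.
case/memv_addP=> y ya [z zr ->]; apply: PD; last exact: IH.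
by apply: PR ya => //; apply: rR; rewrite mem_head.
Qed.

Lemma positive_height (H0 : subvs_of h) (a : dual h) :
  (forall b : dual h, b \in simple_roots D -> b H0 = 1) ->
  a \in roots D -> positive a -> exists k : nat, a H0 = k.+1%:R.
Proof.
move=> H01; rewrite rootsP => /andP[a0 _] /asboolP[k ak].
have aH : a H0 = (\sum_(i < size (simple_roots D)) k i)%:R.
  rewrite ak sum_lfunE natr_sum; apply: eq_bigr => i _.
  rewrite -scaler_nat scale_lfunE H01 ?mem_nth//.
  exact: mulr1.
case e: (\sum_(i < _) k i)%N aH => [|n] ->; last by exists n.
move/eqP: e; rewrite sum_nat_eq0 => /forallP/= k0.
by move: a0; rewrite ak big1 ?eqxx// => i _; rewrite (eqP (k0 i)).
Qed.

Lemma nplus_direct : (h :&: nplus = 0)%VS.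
Proof.
have [H0 H01] := height_exists.
pose hs := [seq (a : dual h) H0 : K | a <- [seq a <- roots D | positive a]].
pose T (x : g) := foldr (fun k y => lie (vsval H0) y - k *: y) x hs.
have T0 : T 0 = 0.
  by rewrite /T; elim: (hs) => //= k l ->; rewrite linear0 scaler0 subrr.
have TD x y : T (x + y) = T x + T y.
  rewrite /T; elim: (hs) => //= k l ->.
  by rewrite linearD/= scalerDr opprD addrACA.
have TE e x : lie (vsval H0) x = e *: x -> T x = \prod_(k <- hs) (e - k) *: x.
  move=> xe; rewrite /T; elim: (hs) => [|k l /= ->].
    by rewrite big_nil scale1r.
  rewrite big_cons linearZ/= xe !scalerA -scalerBl; congr (_ *: _).
  by rewrite mulrBl mulrC.
apply/eqP; rewrite -subv0; apply/subvP => x; rewrite memv_cap => /andP[xh xn].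
rewrite memv0.
have Tx0 : T x = 0.
  apply: (nplus_ind (P := fun x => T x = 0) _ _ _ xn) => // [y z Ty Tz|a y aR pa ya].
    by rewrite TD Ty Tz addr0.
  rewrite (TE (a H0)); last by move/root_spaceP: ya => ->.
  rewrite (_ : \prod_(k <- hs) _ = 0) ?scale0r//; apply/eqP.
  rewrite prodf_seq_eq0; apply/hasP; exists (a H0); last by rewrite subrr eqxx.
  by apply: map_f; rewrite mem_filter pa.
have [hC _ _] := cartanP D.
move: Tx0; rewrite (TE 0); last by rewrite scale0r hC// subvsP.
move/eqP; rewrite scaler_eq0 => /orP[|//].
rewrite prodf_seq_eq0 => /hasP[k /mapP[a]].
rewrite mem_filter => /andP[pa aR] -> /=.
have [n ->] := positive_height H01 aR pa.
by rewrite sub0r oppr_eq0 pnatr_eq0.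
Qed.

Lemma lie_cartan_nplus x y : x \in h -> y \in nplus -> lie x y \in nplus.
Proof.
move=> xh; move: y; apply: nplus_ind => [|y1 y2 y1n y2n|a z aR pa za].
- by rewrite linear0 mem0v.
- by rewrite linearD memvD.
rewrite -(vsprojK xh) (root_spaceP _ _ za) memvZ//.
exact: root_nplus za.
Qed.

Lemma lie_nplus x y : x \in nplus -> y \in nplus -> lie x y \in nplus.
Proof.
have [H0 H01] := height_exists.
move=> xn yn; move: x xn; apply: nplus_ind => [|x1 x2 x1n x2n|a x aR pa xa].
- by rewrite lie0l mem0v.
- by rewrite lieDl memvD.
move: y yn; apply: nplus_ind => [|y1 y2 y1n y2n|b y bR pb yb].
- by rewrite linear0 mem0v.
- by rewrite linearD memvD.
have [->|xy0] := eqVneq (lie x y) 0; first exact: mem0v.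
have xyab : lie x y \in root_space (a + b).
  apply/root_spaceP => H.
  have := lie_leibniz (vsval H) x y.
  rewrite (root_spaceP _ _ xa) (root_spaceP _ _ yb) lieZl linearZ/= => /eqP.
  by rewrite eq_sym subr_eq => /eqP->; rewrite add_lfunE scalerDl addrC.
apply: (root_nplus _ _ xyab).
- rewrite rootsP; apply/andP; split.
    apply/eqP => /(congr1 (fun f : dual h => f H0)).
    have [m am] := positive_height H01 aR pa.
    have [n bn] := positive_height H01 bR pb.
    rewrite add_lfunE am bn zero_lfunE => /eqP.
    by rewrite -natrD pnatr_eq0.
  by apply: contraNneq xy0 => e0; rewrite e0 memv0 in xyab.
- move/asboolP: pa => [k ->]; move/asboolP: pb => [l ->]; apply/asboolP.
  exists (fun i => k i + l i)%N; rewrite -big_split; apply: eq_bigr => i _.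
  by rewrite mulrnDr.
Qed.

Definition borel : {vspace g} := (h + nplus)%VS.

Lemma lie_borel x y : x \in borel -> y \in borel -> lie x y \in nplus.
Proof.
have [hC _ _] := cartanP D.
move=> /memv_addP[x1 x1h [x2 x2n ->]] /memv_addP[y1 y1h [y2 y2n ->]].
rewrite lieDl !linearD/= hC// add0r; apply: memvD.
  exact: lie_cartan_nplus.
apply: memvD; last exact: lie_nplus.
by rewrite lieC memvN; apply: lie_cartan_nplus.
Qed.

Definition cartan_proj : 'End(g) := daddv_pi h nplus.

Lemma cartan_proj_in x : cartan_proj x \in h.
Proof. exact: memv_pi. Qed.
Lemma cartan_proj_nplus x : x \in nplus -> cartan_proj x = 0.
Proof.
move=> xn; have xU : x \in (h + nplus)%VS by apply: (subvP (addvSr _ _)).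
apply: (addIr (daddv_pi nplus h x)); rewrite add0r.
rewrite /cartan_proj daddv_pi_add ?nplus_direct// daddv_pi_id//.
by rewrite capvC nplus_direct.
Qed.
Lemma cartan_projP x : x \in borel -> x - cartan_proj x \in nplus.
Proof.
move=> xb; rewrite -{1}(daddv_pi_add nplus_direct xb) addrAC subrr add0r.
exact: memv_pi.
Qed.

Variable B : invForm g.

Lemma form_cartan_nplus x y : x \in h -> y \in nplus -> B x y = 0.
Proof.
have [H0 H01] := height_exists; have [hC _ _] := cartanP D.
move=> xh; move: y; apply: nplus_ind => [|y1 y2 e1 e2|a y aR pa ya].
- exact: form0r.
- by rewrite formDr e1 e2 addr0.
have [n an] := positive_height H01 aR pa.
have : B (lie x (vsval H0)) y = 0 by rewrite hC ?subvsP// form0l.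
rewrite form_inv (root_spaceP _ _ ya) form_sym (formZl B) an form_sym => /eqP.
by rewrite mulf_eq0 pnatr_eq0 => /eqP.
Qed.

Lemma form_nplus x y : x \in nplus -> y \in nplus -> B x y = 0.
Proof.
have [H0 H01] := height_exists.
move=> xn yn; move: x xn; apply: nplus_ind => [|x1 x2 e1 e2|a x aR pa xa].
- exact: form0l.
- by rewrite formDl e1 e2 addr0.
move: y yn; apply: nplus_ind => [|y1 y2 e1 e2|b y bR pb yb].
- exact: form0r.
- by rewrite formDr e1 e2 addr0.
have [m am] := positive_height H01 aR pa.
have [n bn] := positive_height H01 bR pb.
have := form_inv B x (vsval H0) y.
rewrite (root_spaceP _ _ yb) lieC (root_spaceP _ _ xa) -scaleNr.
rewrite (formZl B) (form_sym B x (_ *: y)) (formZl B) (form_sym B y x) am bn.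
move/eqP; rewrite -subr_eq0 -mulrBl -opprD -natrD mulf_eq0 oppr_eq0 pnatr_eq0.
by move/eqP.
Qed.

Lemma form_borel x y : x \in borel -> y \in borel ->
  B (cartan_proj x) (cartan_proj y) = B x y.
Proof.
have split_form x1 x2 y1 y2 : x1 \in h -> x2 \in nplus -> y1 \in h ->
    y2 \in nplus -> B (x1 + x2) (y1 + y2) = B x1 y1.
  move=> x1h x2n y1h y2n; rewrite formDl !formDr (form_nplus x2n y2n).
  rewrite (form_cartan_nplus x1h y2n) (form_sym B x2).
  by rewrite (form_cartan_nplus y1h x2n) !addr0.
move=> /cartan_projP xn /cartan_projP yn.
rewrite -(split_form _ _ _ _ (cartan_proj_in x) xn (cartan_proj_in y) yn).
by rewrite ![cartan_proj _ + _]addrC !subrK.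
Qed.

End Structure.

Section Graded.
Variables (K : numFieldType) (g : finLieAlgType K) (B : invForm g).

Lemma loop_lie_in (S T W : int -> {vspace g}) (u v : loop g) :
  (forall m n x y, x \in S m -> y \in T n -> lie x y \in W (m + n)) ->
  (forall m, u@_m \in S m) -> (forall m, v@_m \in T m) ->
  forall m, (lie u v)@_m \in W m.
Proof.
move=> STW uS vT k; rewrite raddf_sum/= memv_suml// => m _.
rewrite raddf_sum/= memv_suml// => n _.
by rewrite mcoeffU; case: eqP => [<-|_]; rewrite ?mulr1n ?mulr0n ?mem0v// STW.
Qed.

(* The subspace (+)_m S_m (x) t^m of the affine algebra, plus K c if central. *)
Definition graded (S : int -> {vspace g}) (central : bool) : {pred affine B} :=
  fun u => `[< (forall m, u.1@_m \in S m) /\ (central \/ u.2 = 0) >].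

Lemma gradedP (S : int -> {vspace g}) (central : bool) (u : affine B) :
  reflect ((forall m, u.1@_m \in S m) /\ (central \/ u.2 = 0))
          (u \in graded S central).
Proof. exact: asboolP. Qed.

Lemma graded_submod S central : submod_closed (graded S central).
Proof.
split=> [|k u v /gradedP[uS uc] /gradedP[vS vc]]; apply/gradedP; split.
- by move=> m; rewrite mcoeff0 mem0v.
- by right.
- by move=> m; rewrite loop_coefP memvD ?memvZ.
case: uc => [|u0]; first by left.
case: vc => [|v0]; first by left.
by right; rewrite /= u0 v0 scaler0 addr0.
Qed.

Lemma cocycle_in0 (S T : int -> {vspace g}) (u v : loop g) :
  (forall m x y, x \in S m -> y \in T (- m) -> m%:~R * B x y = 0) ->
  (forall m, u@_m \in S m) -> (forall m, v@_m \in T m) -> cocycle B u v = 0.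
Proof. by move=> ST uS vT; rewrite /cocycle big1// => m _; apply: ST. Qed.

Definition graded_subalg (S : int -> {vspace g}) (central : bool)
    (SS : forall m n x y, x \in S m -> y \in S n -> lie x y \in S (m + n))
    (Sc : central \/
       forall m x y, x \in S m -> y \in S (- m) -> m%:~R * B x y = 0) :
  lieSubalg (affine B).
Proof.
exists (graded S central); first exact: graded_submod.
move=> u v /gradedP[uS _] /gradedP[vS _]; apply/gradedP; split.
  exact: (loop_lie_in SS).
by case: Sc => [|Sc]; [left|right; apply: (cocycle_in0 Sc)].
Defined.

End Graded.

Section Modules.
Variables (K : numFieldType) (g : finLieAlgType K) (B : invForm g).
Variable D : cartan_datum g.
Local Notation h := (cartan D).

Definition heis_deg (m : int) : {vspace g} := if m == 0 then 0%VS else h.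
Definition heis_pos_deg (m : int) : {vspace g} := if 0 < m then h else 0%VS.

Lemma heis_degS m : (heis_deg m <= h)%VS.
Proof. by rewrite /heis_deg; case: ifP; rewrite ?sub0v ?subvv. Qed.
Lemma heis_pos_degS m : (heis_pos_deg m <= heis_deg m)%VS.
Proof.
rewrite /heis_pos_deg /heis_deg; case: ltrP; rewrite ?sub0v// => m0.
by rewrite Order.POrderTheory.gt_eqF// subvv.
Qed.

Lemma heis_comm m n x y : x \in heis_deg m -> y \in heis_deg n -> lie x y = 0.
Proof.
have [hC _ _] := cartanP D.
by move=> /(subvP (heis_degS m)) ? /(subvP (heis_degS n)) ?; apply: hC.
Qed.

Lemma heis_pos_comm m n x y :
  x \in heis_pos_deg m -> y \in heis_pos_deg n -> lie x y = 0.
Proof.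
move=> /(subvP (heis_pos_degS m)) xm /(subvP (heis_pos_degS n)).
exact: heis_comm xm.
Qed.

Lemma heis_pos_pair m x y :
  x \in heis_pos_deg m -> y \in heis_pos_deg (- m) -> m%:~R * B x y = 0.
Proof.
rewrite /heis_pos_deg oppr_gt0; case: (ltrgtP 0 m) => [m0|m0|<-].
- by rewrite memv0 => _ /eqP->; rewrite form0r mulr0.
- by rewrite memv0 => /eqP->; rewrite form0l mulr0.
- by rewrite mul0r.
Qed.

Fact heis_lie m n x y :
  x \in heis_deg m -> y \in heis_deg n -> lie x y \in heis_deg (m + n).
Proof. by move=> xm yn; rewrite (heis_comm xm yn) mem0v. Qed.
Fact heis_pos_lie m n x y :
  x \in heis_pos_deg m -> y \in heis_pos_deg n ->
  lie x y \in heis_pos_deg (m + n).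
Proof. by move=> xm yn; rewrite (heis_pos_comm xm yn) mem0v. Qed.
Fact borel_lie (m n : int) x y :
  x \in borel D -> y \in borel D -> lie x y \in borel D.
Proof. by move=> xb yb; apply: (subvP (addvSr _ _)); apply: lie_borel. Qed.

(* H' = (+)_(r != 0) h t^r (+) K c *)
Definition Heis : lieSubalg (affine B) :=
  graded_subalg heis_lie (or_introl (erefl true)).
(* H'(+) = (+)_(r > 0) h t^r *)
Definition HeisPos : lieSubalg (affine B) :=
  graded_subalg (central := false) heis_pos_lie (or_intror heis_pos_pair).
(* H'(+) (+) K c *)
Definition HeisPosC : lieSubalg (affine B) :=
  graded_subalg heis_pos_lie (or_introl (erefl true)).
(* P~ = H' (+) h (+) nplus (x) K[t, t^-1]
      = (h (+) nplus) (x) K[t, t^-1] (+) K c *)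
Definition Ptilde : lieSubalg (affine B) :=
  graded_subalg borel_lie (or_introl (erefl true)).

Lemma HeisPosC_Heis : {subset subalg_pred HeisPosC <= subalg_pred Heis}.
Proof.
move=> u /gradedP[uS _]; apply/gradedP; split; last by left.
by move=> m; apply: (subvP (heis_pos_degS m)).
Qed.

Definition pos_part_pair (x : affine B) : affine B := (x.1, 0).
Fact pos_part_subproof (x : subLie HeisPosC) :
  pos_part_pair (sub_elt x) \in subalg_pred HeisPos.
Proof.
have /gradedP[xS _] := sub_eltP x.
by apply/gradedP; split=> //; right.
Qed.
Definition pos_part (x : subLie HeisPosC) : subLie HeisPos :=
  SubLie (pos_part_subproof x).
Lemma pos_part_linear : linear pos_part.
Proof.
move=> k x y; apply: sub_elt_inj; rewrite sub_elt_linear.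
transitivity (pos_part_pair (k *: sub_elt x + sub_elt y)).
  by rewrite -sub_elt_linear.
by congr pair; rewrite /= scaler0 addr0.
Qed.

Section Inducing.
Variables (zeta : {linear subLie HeisPos -> K^o}) (a : K).

Definition char_act (x : subLie HeisPosC) (v : K^o) : K^o :=
  (zeta (pos_part x) + a * (sub_elt x).2) * v.

Fact char_linearl (k : K) x y v :
  char_act (k *: x + y) v = k *: char_act x v + char_act y v.
Proof.
rewrite /char_act pos_part_linear linearP sub_elt_linear/=.
rewrite [k *: (_ * _)]mulrA -mulrDl; congr (_ * _).
by rewrite !mulrDr -!addrA; congr (_ + _); rewrite addrCA (mulrCA a).
Qed.
Fact char_linearr (k : K) x v1 v2 :
  char_act x (k *: v1 + v2) = k *: char_act x v1 + char_act x v2.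
Proof. by rewrite /char_act mulrDr; congr (_ + _); apply: mulrCA. Qed.
Fact char_lie x y v : char_act (lie x y) v =
  char_act x (char_act y v) - char_act y (char_act x v).
Proof.
rewrite [X in _ = X - _]mulrCA subrr /char_act.
have /gradedP[xS _] := sub_eltP x; have /gradedP[yS _] := sub_eltP y.
rewrite (_ : pos_part _ = 0).
  have -> : (sub_elt (lie x y)).2 = 0 by exact: (cocycle_in0 heis_pos_pair xS yS).
  by rewrite linear0 mulr0 addr0 mul0r.
apply: sub_elt_inj; congr pair.
apply/malgP => m; apply/eqP; rewrite mcoeff0 -memv0.
apply: (loop_lie_in (W := fun=> 0%VS) _ xS yS) => {}m n x' y' x'm y'n.
by rewrite (heis_pos_comm x'm y'n) mem0v.
Qed.

(* K v, with x v = zeta(x) v for x in H'(+) and c v = a v *)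
Definition char_rep : lieRep (subLie HeisPosC) K^o :=
  LieRep char_linearl char_linearr char_lie.

Definition Mprime := ind (sub_incl HeisPosC_Heis) char_rep.
HB.instance Definition _ := GRing.Lmodule.on Mprime.
Definition Mprime_rep : lieRep (subLie Heis) Mprime :=
  ind_rep (sub_incl HeisPosC_Heis) char_rep.
End Inducing.

Lemma Ptilde_coef (x : subLie Ptilde) m : (sub_elt x).1@_m \in borel D.
Proof. by have /gradedP[] := sub_eltP x. Qed.

Definition heis_loop (u : loop g) : loop g :=
  [malg m in msupp u => if m == 0 then 0 else cartan_proj D u@_m].
Lemma heis_loopE u m :
  (heis_loop u)@_m = if m == 0 then 0 else cartan_proj D u@_m.
Proof. by rewrite mcoeffE; case: msuppP => // _; rewrite linear0 if_same. Qed.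

Definition heis_part_pair (x : affine B) : affine B := (heis_loop x.1, x.2).
Fact heis_part_subproof (x : subLie Ptilde) :
  heis_part_pair (sub_elt x) \in subalg_pred Heis.
Proof.
apply/gradedP; split; last by left.
move=> m; rewrite heis_loopE /heis_deg; case: eqP => _; first exact: mem0v.
exact: cartan_proj_in.
Qed.
(* The components in H' and in h of an element of P~ *)
Definition heis_part (x : subLie Ptilde) : subLie Heis :=
  SubLie (heis_part_subproof x).
Definition cartan_part (x : subLie Ptilde) : subvs_of h :=
  vsproj h (cartan_proj D (sub_elt x).1@_0).

Lemma heis_part_linear : linear heis_part.
Proof.
move=> k x y; apply: sub_elt_inj; rewrite sub_elt_linear.
transitivity (heis_part_pair (k *: sub_elt x + sub_elt y)).
  by rewrite -sub_elt_linear.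
congr pair; apply/malgP => m; rewrite loop_coefP !heis_loopE loop_coefP.
by case: eqP => _; rewrite ?linearP// scaler0 addr0.
Qed.
Lemma cartan_part_linear : linear cartan_part.
Proof.
by move=> k x y; rewrite /cartan_part sub_elt_linear/= loop_coefP !linearP.
Qed.

Lemma heis_part_lie x y :
  heis_part (lie x y) = lie (heis_part x) (heis_part y).
Proof.
have xyn m : (lie (sub_elt x).1 (sub_elt y).1)@_m \in nplus D.
  apply: (loop_lie_in (S := fun=> borel D) (T := fun=> borel D)
    (W := fun=> nplus D)).
  - by move=> *; apply: lie_borel.
  - exact: Ptilde_coef.
  - exact: Ptilde_coef.
apply: sub_elt_inj; congr pair.
  apply/malgP => m; rewrite heis_loopE cartan_proj_nplus// if_same.
  apply/esym/eqP; rewrite -memv0.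
  have /gradedP[xS _] := sub_eltP (heis_part x).
  have /gradedP[yS _] := sub_eltP (heis_part y).
  apply: (loop_lie_in (W := fun=> 0%VS) _ xS yS) => {}m n x' y' x'm y'n.
  by rewrite (heis_comm x'm y'n) mem0v.
pose d := msupp (sub_elt x).1.
have le : (msupp (heis_loop (sub_elt x).1) `<=` d)%fset.
  apply/fsubsetP => m; rewrite -mcoeff_neq0 heis_loopE.
  by case: msuppP => //; rewrite linear0 if_same eqxx.
rewrite [RHS](big_fset_incl _ le)/=; last first.
  by move=> m _ /mcoeff_outdom->; rewrite form0l mulr0.
apply: eq_bigr => m _; rewrite !heis_loopE oppr_eq0.
case: eqP => [->|_]; first by rewrite !mul0r.
by rewrite form_borel ?Ptilde_coef.
Qed.

Lemma cartan_part_lie x y : cartan_part (lie x y) = 0.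
Proof.
rewrite /cartan_part cartan_proj_nplus ?linear0//.
apply: (loop_lie_in (S := fun=> borel D) (T := fun=> borel D)
  (W := fun=> nplus D)).
- by move=> *; apply: lie_borel.
- exact: Ptilde_coef.
- exact: Ptilde_coef.
Qed.

Section Verma.
Variable zeta : {linear subLie HeisPos -> K^o}.
(* (H, k) stands for H + k c in h (+) K c. *)
Variable lam : {linear (subvs_of h * K^o)%type -> K^o}.

Definition level : K := lam (0, 1).

(* x = x' + H + y with x' in H', H in h and y in nplus (x) K[t, t^-1] acts as  *)
(* x' + lam(H).                                                               *)
Definition MP := Mprime zeta level.
HB.instance Definition _ := GRing.Lmodule.on MP.

Definition MP_act (x : subLie Ptilde) (n : MP) : MP :=
  Mprime_rep zeta level (heis_part x) n + (lam (cartan_part x, 0) : K) *: n.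

Fact MP_linearl (k : K) x y n :
  MP_act (k *: x + y) n = k *: MP_act x n + MP_act y n.
Proof.
rewrite /MP_act heis_part_linear rep_linearl cartan_part_linear.
rewrite scalerDr addrACA; congr (_ + _).
rewrite scalerA -scalerDl; congr (_ *: _).
have -> : (k *: cartan_part x + cartan_part y, 0) =
    k *: (cartan_part x, 0) + (cartan_part y, 0) :> (subvs_of h * K^o)%type.
  by congr pair; rewrite /= scaler0 addr0.
exact: linearP.
Qed.
Fact MP_linearr (k : K) x n1 n2 :
  MP_act x (k *: n1 + n2) = k *: MP_act x n1 + MP_act x n2.
Proof.
rewrite /MP_act rep_linearr !scalerDr addrACA; congr (_ + _ + (_ + _)).
by rewrite !scalerA mulrC.
Qed.
Fact MP_lie x y n :
  MP_act (lie x y) n = MP_act x (MP_act y n) - MP_act y (MP_act x n).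
Proof.
rewrite /MP_act heis_part_lie cartan_part_lie rep_lie.
rewrite (_ : lam (0, 0) = 0) ?scale0r ?addr0; last exact: linear0.
set k : K := lam (cartan_part x, 0); set l : K := lam (cartan_part y, 0).
have r_lin (z : subLie Heis) (c : K) n1 n2 :
    Mprime_rep zeta level z (n1 + c *: n2) =
    Mprime_rep zeta level z n1 + c *: Mprime_rep zeta level z n2.
  by rewrite addrC rep_linearr addrC.
rewrite !r_lin !scalerDr !scalerA (mulrC l k).
have cancel4 (a c p q r : MP) : a - c = a + p + (q + r) - (c + q + (p + r)).
  rewrite -(addrA a) -(addrA c) (addrCA q) [- (c + _)]opprD addrACA.
  by rewrite subrr addr0.
exact: cancel4.
Qed.

Definition MP_rep : lieRep (subLie Ptilde) MP :=
  LieRep MP_linearl MP_linearr MP_lie.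

Lemma rep0 (L : lieAlgType K) (N : lmodType K) (r : lieRep L N) n : r 0 n = 0.
Proof.
by have := rep_linearl r (-1) 0 0 n; rewrite scaler0 addr0 scaleN1r addNr.
Qed.

Lemma MP_act_nplus (x : subLie Ptilde) (n : MP) :
  (forall m, (sub_elt x).1@_m \in nplus D) -> (sub_elt x).2 = 0 ->
  MP_act x n = 0.
Proof.
move=> xn xc; rewrite /MP_act /cartan_part cartan_proj_nplus// linear0.
rewrite (_ : lam (0, 0) = 0) ?scale0r ?addr0; last exact: linear0.
rewrite (_ : heis_part x = 0) ?rep0//; apply: sub_elt_inj; congr pair => //.
by apply/malgP => m; rewrite heis_loopE cartan_proj_nplus// if_same mcoeff0.
Qed.

Lemma MP_act_heis (x : subLie Ptilde) (y : subLie Heis) (n : MP) :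
  sub_elt x = sub_elt y -> MP_act x n = Mprime_rep zeta level y n.
Proof.
move=> xy; have /gradedP[yS _] := sub_eltP y.
rewrite /MP_act /cartan_part xy.
have /eqP -> : (sub_elt y).1@_0 == 0 by rewrite -memv0; have := yS 0.
rewrite !linear0 scale0r addr0.
congr (Mprime_rep _ _ _ n); apply: sub_elt_inj.
rewrite [sub_elt y]surjective_pairing; congr pair; last by rewrite /= xy.
apply/malgP => m; rewrite heis_loopE xy; have := yS m; rewrite /heis_deg.
case: eqP => [->|_ ym]; first by rewrite memv0 => /eqP.
by rewrite /cartan_proj daddv_pi_id// nplus_direct.
Qed.

Lemma MP_act_cartan (x : subLie Ptilde) (H : subvs_of h) (n : MP) :
  sub_elt x = (mono (vsval H) 0, 0) -> MP_act x n = (lam (H, 0) : K) *: n.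
Proof.
move=> xH; rewrite /MP_act /cartan_part xH mcoeffUU.
rewrite /cartan_proj daddv_pi_id ?nplus_direct ?subvsP// vsvalK.
rewrite (_ : heis_part x = 0) ?rep0 ?add0r//; apply: sub_elt_inj.
congr pair; last by rewrite /= xH.
apply/malgP => m; rewrite heis_loopE xH mcoeffU mcoeff0 eq_sym.
by case: eqP => // _; rewrite mulr0n linear0.
Qed.

Definition Mtilde := ind (subalg_val Ptilde) MP_rep.
HB.instance Definition _ := GRing.Lmodule.on Mtilde.
Definition Mtilde_rep : lieRep (affine B) Mtilde :=
  ind_rep (subalg_val Ptilde) MP_rep.

End Verma.
End Modules.

(* Main.v *)
Require Import Defs.
From mathcomp Require Import all_boot all_order all_algebra reals complex.
From HB Require Import structures.
From mathcomp Require Import finmap boolp functions zify.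
From mathcomp.multinomials Require Import monalg.
Import Defs.

(* Write M' and M~ for the two induced modules, and a for the nonzero level.

   M' is irreducible: for x in h and r > 0, x t^r - zeta(x t^r) acts on words in
   the y t^-s as a derivation with values r a (x | y) if r = s and 0 otherwise.
   These operators shorten words, so a nonzero submodule contains a nonzero vector
   killed by all of them; the Euler operator
   \sum (s a)^-1 h_b t^-s (h^b t^s - zeta(h^b t^s)) multiplies a word by its
   length, so this vector is a multiple of the generator.

   For M~, heights show that a nonzero submodule contains a nonzero w killed by
   nplus[t, t^-1]; it suffices to see that w lies in 1 (x) M'. By freeness of M~
   over nminus[t, t^-1], the operator (r a)^-1 (rho^vee t^r - zeta(rho^vee t^r)) of
   M' extends to an operator Theta_r of M~ commuting with nminus[t, t^-1]. For r
   large, Theta_r kills the coefficients of w in M'; hence in Theta_r (e t^(-k-r) w)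
   with e in nplus, up to shorter words, a letter y t^l of w is replaced by
   (rho^vee | [e, y]) if k = l and by 0 otherwise. With dual families (e_b), (y_b)
   for the pairing (rho^vee | [e, y]), the operator
   \sum_(k, b) y_b t^k Theta_r e_b t^(-k-r) multiplies words of length d by d up to
   shorter words. It kills w, so the least possible length of w is 0. *)

Set Implicit Arguments.
Unset Strict Implicit.
Unset Printing Implicit Defensive.

Import Order.TTheory GRing.Theory Num.Theory.
Local Open Scope ring_scope.

Arguments rep_act {K L N} r x n : simpl never, rename.

(** * Induced modules *)

Section RepTheory.
Variables (K : fieldType) (L : lieAlgType K) (N : lmodType K).
Variable r : lieRep L N.

HB.instance Definition _ x :=
  GRing.isLinear.Build K N N *:%R (rep_act r x) (fun k => rep_linearr r k x).

Lemma repDl x y n : r (x + y) n = r x n + r y n.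
Proof. by rewrite -[x in LHS]scale1r rep_linearl scale1r. Qed.
Lemma rep0l n : r 0 n = 0.
Proof. by apply: (addrI (r 0 n)); rewrite -repDl !addr0. Qed.
Lemma repZl k x n : r (k *: x) n = k *: r x n.
Proof. by rewrite -[k *: x]addr0 rep_linearl rep0l addr0. Qed.
Lemma rep_suml I (s : seq I) (P : pred I) (F : I -> L) n :
  r (\sum_(i <- s | P i) F i) n = \sum_(i <- s | P i) r (F i) n.
Proof. by elim/big_rec2: _ => [|i u v _ <-]; rewrite ?rep0l ?repDl. Qed.
Lemma repDr x n m : r x (n + m) = r x n + r x m.
Proof. exact: linearD. Qed.
Lemma rep_comm x y n : r x (r y n) = r y (r x n) + r (lie x y) n.
Proof. by rewrite rep_lie addrC subrK. Qed.

Lemma uea_act_linear (a : uea L) : linear (uea_act r a).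
Proof. by move=> k n m; rewrite /uea_act uterm_act_linear. Qed.
HB.instance Definition _ a :=
  GRing.isLinear.Build K N N *:%R (uea_act r a) (uea_act_linear a).

Lemma uea_actM a b n : uea_act r (a * b) n = uea_act r a (uea_act r b n).
Proof.
elim/uea_ind_pi: a => s; elim/uea_ind_pi: b => t.
by rewrite [_ * _]uea_mulE !uea_actE.
Qed.
Lemma uea_actD a b n : uea_act r (a + b) n = uea_act r a n + uea_act r b n.
Proof.
elim/uea_ind_pi: a => s; elim/uea_ind_pi: b => t.
by rewrite [_ + _]uea_addE !uea_actE.
Qed.

Lemma uea_act_gen x n : uea_act r (uea_gen x) n = r x n.
Proof. exact: uea_actE. Qed.
Lemma uea_act1 n : uea_act r 1 n = n.
Proof. by rewrite uea_actE /= scale1r. Qed.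
Lemma uea_actA k n : uea_act r k%:A n = k *: n.
Proof. by rewrite /GRing.scale/= /uea_scale uea_actM uea_act1 uea_actE. Qed.

End RepTheory.

Definition trivial_rep (K : fieldType) (L : lieAlgType K) (N : lmodType K) :
  lieRep L N.
Proof. by exists (fun _ _ => 0) => *; rewrite ?scaler0 ?addr0 ?subr0. Defined.

Section IndTheory.
Variables (K : fieldType) (L1 L2 : lieAlgType K) (f : lieHom L1 L2).
Variables (N : lmodType K) (r : lieRep L1 N).
Local Notation I := (ind f r).
Local Notation rI := (ind_rep f r).
Implicit Types (w : I) (n : N).

Definition tens1 n : I := tens f r 1 n.

Lemma ind_scaleE k w : k *: w = ind_mul k%:A w.
Proof. by []. Qed.

Lemma ind_rep_tens x a n : rI x (tens f r a n) = tens f r (uea_gen x * a) n.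
Proof. exact: ind_mul_tens. Qed.

Lemma ind_rep_tens1 x n : rI (f x) (tens1 n) = tens1 (r x n).
Proof.
rewrite ind_rep_tens mulr1 /tens1 -(uea_act_gen r x) -tensM mul1r.
by congr tens; rewrite [RHS]uea_mapE.
Qed.

Lemma uea_map_const k : uea_map f k%:A = k%:A.
Proof. by rewrite linearZ/= rmorph1. Qed.

Lemma tens1_linear : linear tens1.
Proof.
move=> k n m; rewrite [LHS]tensDr; congr (_ + _).
rewrite ind_scaleE ind_mul_tens mulr1 -[k%:A]mul1r -(uea_map_const k).
by rewrite tensM uea_actA.
Qed.
HB.instance Definition _ :=
  GRing.isLinear.Build K N I *:%R tens1 tens1_linear.

Lemma uea_act_ind a w : uea_act rI a w = ind_mul a w.
Proof.
elim/uea_ind_pi: a => s; rewrite uea_actE.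
elim: s w => [k|x|s IHs t IHt|s IHs t IHt] w /=.
- rewrite ind_scaleE; congr ind_mul.
  by rewrite /GRing.scale/= /uea_scale mulr1.
- by [].
- by rewrite IHs IHt -ind_mulDl [_ + _]uea_addE.
- by rewrite IHt IHs ind_mulA [_ * _]uea_mulE.
Qed.

(** Since a (x) n = a (1 (x) n), the vectors [tens1 n] generate; the action of a is unfolded along a
    term that represents it. *)
Lemma ind_gen_ind (P : I -> Prop) :
  P 0 -> (forall k w1 w2, P w1 -> P w2 -> P (k *: w1 + w2)) ->
  (forall n, P (tens1 n)) -> (forall x w, P w -> P (rI x w)) -> forall w, P w.
Proof.
move=> P0 PL PT PG.
have PD w1 w2 : P w1 -> P w2 -> P (w1 + w2).
  by move=> p1 p2; rewrite -[w1]scale1r; apply: PL.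
have PZ k w : P w -> P (k *: w) by move=> p; rewrite -[_ *: _]addr0; apply: PL.
elim/ind_tens_ind=> // [w pw|a n]; first by rewrite -scaleN1r; apply: PZ.
have -> : tens f r a n = uea_act rI a (tens1 n).
  by rewrite uea_act_ind ind_mul_tens mulr1.
elim/uea_ind_pi: a => s; rewrite uea_actE.
have: P (tens1 n) by [].
elim: s (tens1 n) => //= [s IHs t IHt w pw|s IHs t IHt w pw].
- by apply: PD; [apply: IHs|apply: IHt].
- by apply/IHs/IHt.
Qed.

(** Frobenius reciprocity: the map is evaluated on formal sums of tensors, where the relation
    [ieqv_tensM] is respected by equivariance of [h]. *)
Lemma ind_lift (V : lmodType K) (rV : lieRep L2 V) (h : {linear N -> V}) :
  (forall x n, h (r x n) = rV (f x) (h n)) ->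
  exists Psi : {linear I -> V}, (forall n, Psi (tens1 n) = h n) /\
    (forall x w, Psi (rI x w) = rV x (Psi w)).
Proof.
move=> hP.
pose fix ev (s : iterm L2 N) : V := match s with
  | IZero => 0 | IOpp s => - ev s | IAdd s t => ev s + ev t
  | ITens a n => uea_act rV a (h n) end.
have hU b n : h (uea_act r b n) = uea_act rV (uea_map f b) (h n).
  elim/uea_ind_pi: b => s; rewrite uea_mapE !uea_actE.
  elim: s n => //= [k n|s IHs t IHt n|s IHs t IHt n].
  - exact: linearZ.
  - by rewrite linearD IHs IHt.
  - by rewrite IHs IHt.
have ev_eqv s t : ieqv f r s t -> ev s = ev t.
  elim=> //= {s t}; try by move=> *; congruence.
  - by move=> *; apply: addrA.
  - by move=> *; apply: addrC.
  - by move=> *; apply: add0r.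
  - by move=> *; apply: addNr.
  - by move=> *; apply: uea_actD.
  - by move=> *; rewrite !linearD.
  - by move=> *; rewrite uea_actM hU.
pose Psi (w : I) := ev (ind_repr w).
have PsiE s : Psi (ind_pi f r s) = ev s by exact/ev_eqv/ind_piK.
have PsiD w1 w2 : Psi (w1 + w2) = Psi w1 + Psi w2.
  elim/ind_ind_pi: w1 => s; elim/ind_ind_pi: w2 => t.
  by rewrite [_ + _]ind_addE !PsiE.
have PsiN w : Psi (- w) = - Psi w.
  by elim/ind_ind_pi: w => s; rewrite [- _]ind_oppE !PsiE.
have Psi0 : Psi 0 = 0 by exact: PsiE.
have PsiM a w : Psi (ind_mul a w) = uea_act rV a (Psi w).
  elim/ind_tens_ind: w => [|w IH|w1 w2 IH1 IH2|b n].
  - by rewrite ind_mul0 Psi0 linear0.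
  - by rewrite ind_mulN !PsiN IH linearN.
  - by rewrite ind_mulDr !PsiD IH1 IH2 linearD.
  - by rewrite ind_mul_tens !PsiE/= uea_actM.
have PsiL : linear Psi.
  by move=> k w1 w2; rewrite PsiD ind_scaleE PsiM uea_actA.
pose m := GRing.isLinear.Build K I V *:%R Psi PsiL.
exists (HB.pack Psi m : {linear I -> V}); split=> [n|x w] /=.
  by rewrite PsiE/= uea_act1.
by rewrite PsiM uea_act_gen.
Qed.

Lemma ind_central x k w :
  (forall y, lie (f x) y = 0) -> (forall n, r x n = k *: n) ->
  rI (f x) w = k *: w.
Proof.
move=> xC xr; elim/ind_gen_ind: w => [|l w1 w2 e1 e2|n|y w e].
- by rewrite linear0 scaler0.
- by rewrite linearP/= e1 e2 scalerDr !scalerA mulrC.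
- by rewrite ind_rep_tens1 xr linearZ.
- by rewrite rep_comm xC rep0l addr0 e linearZ.
Qed.

End IndTheory.

Section LinearMaps.
Variables (K : fieldType) (U V : lmodType K).

Definition linear_pred : {pred U -> V} := fun h => `[< linear h >].

Fact linear_pred_submod : submod_closed linear_pred.
Proof.
split=> [|k g h /asboolP gL /asboolP hL]; apply/asboolP => l x y.
  by rewrite scaler0 addr0.
have E z : (k *: g + h) z = k *: g z + h z by [].
by rewrite !E gL hL !scalerDr addrACA !scalerA mulrC.
Qed.

Record lin_map := LinMap { lin_map_fun :> U -> V;
  lin_map_funP : lin_map_fun \in linear_pred }.
HB.instance Definition _ := [isSub for lin_map_fun].
HB.instance Definition _ := [Choice of lin_map by <:].
HB.instance Definition _ :=
  GRing.isSubmodClosed.Build K (U -> V) linear_pred linear_pred_submod.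
HB.instance Definition _ := [SubChoice_isSubLmodule of lin_map by <:].

Lemma lin_map_linear (h : lin_map) : linear h.
Proof. exact/asboolP/(lin_map_funP h). Qed.
HB.instance Definition _ (h : lin_map) :=
  GRing.isLinear.Build K U V *:%R (lin_map_fun h) (lin_map_linear h).

Lemma lin_mapP (g h : lin_map) : g =1 h -> g = h.
Proof. by move=> gh; apply/val_inj/funext. Qed.
Lemma lin_map_comb k (g h : lin_map) x : (k *: g + h) x = k *: g x + h x.
Proof. by []. Qed.
End LinearMaps.

Lemma lie_derivr (K : fieldType) (L : lieAlgType K) (x y z : L) :
  lie x (lie y z) = lie (lie x y) z + lie y (lie x z).
Proof. by rewrite lie_leibniz subrK. Qed.

Lemma lieDr (K : fieldType) (L : lieAlgType K) (x y z : L) :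
  lie x (y + z) = lie x y + lie x z.
Proof. exact: linearD. Qed.

(** * Freeness of an induced module over a complementary subalgebra *)

Section IndFree.
Variables (K : fieldType) (L1 L2 LN : lieAlgType K).
Variables (f : lieHom L1 L2) (i : lieHom LN L2).
Variables (pP : {linear L2 -> L1}) (pN : {linear L2 -> LN}).
Hypothesis splitE : forall x, x = f (pP x) + i (pN x).
Hypothesis pPf : forall x, pP (f x) = x.
Hypothesis pNf : forall x, pN (f x) = 0.
Hypothesis pPi : forall y, pP (i y) = 0.
Hypothesis pNi : forall y, pN (i y) = y.
Variables (M : lmodType K) (r : lieRep L1 M).

(** Straightening: the words in [i y] applied to [tens1 n] span a subspace stable under L2, because
    x (y w) = y (x w) + [x, y] w and because x splits into its two components on reaching
    [tens1 n]. *)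
Lemma ind_word_ind (P : ind f r -> Prop) :
  P 0 -> (forall k w1 w2, P w1 -> P w2 -> P (k *: w1 + w2)) ->
  (forall n, P (tens1 f r n)) ->
  (forall y w, P w -> P (ind_rep f r (i y) w)) -> forall w, P w.
Proof.
move=> P0 PL PT PN.
have PD w1 w2 : P w1 -> P w2 -> P (w1 + w2).
  by move=> p1 p2; rewrite -[w1]scale1r; apply: PL.
suff H w : P w /\ forall x, P (ind_rep f r x w).
  by move=> w; have [] := H w.
(* The span of the words, as the smallest predicate with these closure properties: membership can
   then be eliminated into a stronger statement. *)
pose Q w := forall P : ind f r -> Prop,
  P 0 -> (forall k w1 w2, P w1 -> P w2 -> P (k *: w1 + w2)) ->
  (forall n, P (tens1 f r n)) ->
  (forall y w, P w -> P (ind_rep f r (i y) w)) -> P w.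
have QT n : Q (tens1 f r n) by move=> ? ? ? T ?; apply: T.
have QN y v : Q v -> Q (ind_rep f r (i y) v).
  by move=> q ? ? ? ? G; apply: (G); apply: q.
have QL k v1 v2 : Q v1 -> Q v2 -> Q (k *: v1 + v2).
  by move=> q1 q2 ? ? G ? ?; apply: (G); [apply: q1|apply: q2].
have QD v1 v2 : Q v1 -> Q v2 -> Q (v1 + v2).
  by move=> q1 q2; rewrite -[v1]scale1r; apply: QL.
have Q0 : Q 0 by move=> ? ? ? ? ?.
have Qx v : Q v -> forall x, Q (ind_rep f r x v).
  (* The bracket [x, y] may be anywhere in L2, so the induction carries stability under all x at
     once. *)
  move=> qv; suff [] : Q v /\ forall x, Q (ind_rep f r x v) by [].
  apply: (qv (fun v => Q v /\ forall x, Q (ind_rep f r x v))).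
  - by split=> // x; rewrite linear0.
  - move=> k w1 w2 [q1 h1] [q2 h2]; split; first exact: QL.
    by move=> x; rewrite rep_linearr; apply: QL; [apply: h1|apply: h2].
  - move=> n; split=> // x; rewrite [x]splitE repDl ind_rep_tens1.
    by apply: QD => //; apply: QN.
  - move=> y w1 [q1 h1]; split; first exact: QN.
    by move=> x; rewrite rep_comm; apply: QD => //; apply: QN.
have Qw : Q w by elim/ind_gen_ind: w => // x w qw; apply: Qx.
split=> [|x]; first exact: (Qw P).
exact: (Qx _ Qw x P).
Qed.

Section Free.

Fact zero_submod : submod_closed (pred1 (0 : LN)).
Proof.
split=> [|k x y /eqP-> /eqP->]; first exact: eqxx.
by rewrite scaler0 addr0 inE.
Qed.
Fact zero_lie : {in pred1 (0 : LN) &, forall x y, lie x y \in pred1 (0 : LN)}.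
Proof. by move=> x y /eqP-> _; rewrite lie0l inE. Qed.
Definition zero_subalg : lieSubalg LN := LieSubalg zero_submod zero_lie.
Local Notation zero_rep := (trivial_rep (subLie zero_subalg) M).
Local Notation zf := (subalg_val zero_subalg).
(* U(LN) (x)_K M *)
Local Notation Z := (ind zf zero_rep).
Local Notation rZ := (ind_rep zf zero_rep).

(** The inducing subalgebra is zero, so the compatibility condition of [ind_lift] is void. *)
Lemma free_lift (V : lmodType K) (rV : lieRep LN V) (h : {linear M -> V}) :
  exists T : {linear Z -> V},
    (forall n, T (tens1 zf zero_rep n) = h n) /\
    (forall y w, T (rZ y w) = rV y (T w)).
Proof.
apply: ind_lift => x n.
have /eqP x0 : sub_elt x == 0 := sub_eltP x.
have -> : zf x = 0 by [].
by rewrite rep0l linear0.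

Qed.

(* Hom(L2, Z) is an LN-module, so Z, being free, maps to it; reading this map
   Z -> Hom(L2, Z) as L2 -> End(Z) extends the action of LN on Z to L2, and Z is
   then the induced module. *)
Definition hom_act (y : LN) (phi : lin_map L2 Z) : L2 -> Z :=
  fun x => rZ y (phi x) + phi (lie x (i y)).
Fact hom_actP y phi : hom_act y phi \in @linear_pred _ L2 Z.
Proof.
apply/asboolP => k u v.
by rewrite /hom_act lie_linearl !linearP scalerDr addrACA.
Qed.
Fact hom_linearl (k : K) x y phi :
  LinMap (hom_actP (k *: x + y) phi) =
  k *: LinMap (hom_actP x phi) + LinMap (hom_actP y phi).
Proof.
apply/lin_mapP => u; rewrite lin_map_comb /= /hom_act.
by rewrite rep_linearl !linearP scalerDr addrACA.
Qed.
Fact hom_linearr (k : K) x phi psi :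
  LinMap (hom_actP x (k *: phi + psi)) =
  k *: LinMap (hom_actP x phi) + LinMap (hom_actP x psi).
Proof.
apply/lin_mapP => u; rewrite lin_map_comb /= /hom_act !lin_map_comb.
by rewrite linearP scalerDr addrACA.
Qed.
Fact hom_lie x y phi :
  LinMap (hom_actP (lie x y) phi) =
  LinMap (hom_actP x (LinMap (hom_actP y phi))) -
  LinMap (hom_actP y (LinMap (hom_actP x phi))).
Proof.
apply/lin_mapP => u.
rewrite -scaleN1r addrC lin_map_comb scaleN1r addrC /= /hom_act /= /hom_act.
rewrite !repDr rep_lie lie_homM lie_derivr [lie (i x) _]lieC linearB /=.
set A := rZ x (rZ y _); set B := rZ y (rZ x _).
set C := phi (lie _ _); set D := phi (lie _ _).
set E := rZ x _; set F := rZ y _.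
apply/eqP; rewrite eq_sym subr_eq eq_sym addrACA [A - B + _]addrA subrK.
by rewrite [E + D]addrC [C - D + _]addrA subrK [C + E]addrC addrACA.
Qed.
Definition hom_rep : lieRep LN (lin_map L2 Z) :=
  LieRep hom_linearl hom_linearr hom_lie.

(** The action on 1 (x) m forced by the splitting of x: the component in L1 acts on m, the other one
    multiplies from the left. *)
Fact hom_baseP m :
  (fun x => tens1 zf zero_rep (r (pP x) m) + rZ (pN x) (tens1 zf zero_rep m))
    \in @linear_pred _ L2 Z.
Proof.
apply/asboolP => k u v.
by rewrite !linearP /= !rep_linearl linearP scalerDr addrACA.
Qed.
Fact hom_base_linear : linear (fun m => LinMap (hom_baseP m)).
Proof.
move=> k m n; apply/lin_mapP => x.
by rewrite lin_map_comb /= !linearP scalerDr addrACA.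
Qed.

(** The lift is the composite of [Psi] into Z, by Frobenius reciprocity, and [T] from Z to V, by
    freeness of Z. The work is to show that [rho] is a representation of L2; no ordered basis is
    involved. *)
Theorem ind_free (V : lmodType K) (rV : lieRep LN V) (h : {linear M -> V}) :
  exists T : {linear ind f r -> V},
    (forall n, T (tens1 f r n) = h n) /\
    (forall y w, T (ind_rep f r (i y) w) = rV y (T w)).
Proof.
pose hb : {linear M -> lin_map L2 Z} :=
  HB.pack (fun m => LinMap (hom_baseP m))
   (GRing.isLinear.Build K M (lin_map L2 Z) *:%R _ hom_base_linear).
have [rho [rho1 rhoN]] := free_lift hom_rep hb.
have rhoNE y t x : rho (rZ y t) x = rZ y (rho t x) + rho t (lie x (i y)).
  by rewrite rhoN.
have rhoL k t1 t2 x : rho (k *: t1 + t2) x = k *: rho t1 x + rho t2 x.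
  by rewrite linearP.
have rhoD t1 t2 x : rho (t1 + t2) x = rho t1 x + rho t2 x by rewrite linearD.
have rhoDr t x1 x2 : rho t (x1 + x2) = rho t x1 + rho t x2 by exact: linearD.
have rhoNr t x : rho t (- x) = - rho t x by exact: linearN.
have rho_i y t : rho t (i y) = rZ y t.
  elim/ind_gen_ind: t y => [|k t1 t2 e1 e2|n|y' t e] y.
  - by rewrite !linear0.
  - by rewrite rhoL e1 e2 rep_linearr.
  - by rewrite rho1 /= pPi rep0l linear0 add0r pNi.
  - by rewrite rhoNE e -lie_homM e -rep_comm.
have rho_f x n : rho (tens1 zf zero_rep n) (f x) = tens1 zf zero_rep (r x n).
  by rewrite rho1 /= pPf pNf rep0l addr0.
have commN y t x : rho (rho t (i y)) x = rho (rho t x) (i y) + rho t (lie x (i y)).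
  by rewrite !rho_i rhoNE.
(* [commN] is the bracket relation with one argument from LN; by bilinearity and antisymmetry only
   pairs from L1 remain. *)
have commW t : (forall p q, rho (rho t (f q)) (f p) =
      rho (rho t (f p)) (f q) + rho t (lie (f p) (f q))) ->
    forall x y, rho (rho t y) x = rho (rho t x) y + rho t (lie x y).
  move=> commf x y.
  have commNf y' q : rho (rho t (f q)) (i y') =
      rho (rho t (i y')) (f q) + rho t (lie (i y') (f q)).
    by rewrite [rho (rho t (i y')) _]commN [lie (i y') _]lieC rhoNr addrK.
  have commf' q : rho (rho t (f q)) x = rho (rho t x) (f q) + rho t (lie x (f q)).
    rewrite [x]splitE; move: (pP x) (pN x) => p n.
    by rewrite lieDl !rhoDr rhoD commf commNf addrACA.
  rewrite [y]splitE; move: (pP y) (pN y) => q n.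
  by rewrite lieDr !rhoDr rhoD commf' commN addrACA.
have comm t x y : rho (rho t y) x = rho (rho t x) y + rho t (lie x y).
  elim/ind_gen_ind: t x y => [|k t1 t2 e1 e2|n|z t e] x y.
  - by rewrite !linear0 !addr0.
  - by rewrite !rhoL e1 e2 scalerDr addrACA.
  - apply: commW => p q.
    by rewrite !rho_f -lie_homM rho_f rep_comm linearD.
  (* For a word z t, the relation for t is used on a, b and their brackets with z; the Jacobi
     identity matches the terms. *)
  - apply: commW => {x y} p q; set a := f p; set b := f q.
    rewrite !rhoNE !rhoD !rhoNE lie_leibniz.
    rewrite [rho (rho t b) a]e [rho (rho t b) (lie _ _)]e.
    rewrite [rho (rho t (lie _ _)) a]e repDr.
    rewrite [lie b (lie a (i z))]lieC opprK rhoDr.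
    by rewrite [LHS](AC (2*2*2) ((1*5*3)*(2*(6*4)))).
pose rhoA x t := rho t x.
have rhoA_linl k x y t : rhoA (k *: x + y) t = k *: rhoA x t + rhoA y t.
  by rewrite /rhoA linearP.
have rhoA_lie x y t : rhoA (lie x y) t = rhoA x (rhoA y t) - rhoA y (rhoA x t).
  by rewrite /rhoA comm addrC addKr.
pose rhoR := LieRep rhoA_linl (fun k x t1 t2 => rhoL k t1 t2 x) rhoA_lie.
pose t1 : {linear M -> Z} := tens1 zf zero_rep.
have [|Psi [Psi1 PsiL]] := @ind_lift _ _ _ f _ r Z rhoR t1.
  by move=> x n; rewrite -[RHS]/(rho (tens1 zf zero_rep n) (f x)) rho_f.
have [T [T1 TN]] := free_lift rV h.
exists (T \o Psi); split=> [n|y w] /=; first by rewrite Psi1 T1.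
by rewrite PsiL -[rhoR _ _]/(rho (Psi w) (i y)) rho_i TN.
Qed.

End Free.
End IndFree.

(** * Triangular decomposition of the finite-dimensional algebra *)

(** Non-degeneracy on the side of Y makes the columns of the Gram matrix independent. The rows of a
    left inverse of it give vectors of U dual to the basis of Y. *)
Lemma dual_family (K : fieldType) (V : vectType K) (b : V -> V -> K^o)
    (U Y : {vspace V}) :
  (forall y, linear (b^~ y)) -> (forall e, linear (b e)) ->
  (forall y, y \in Y -> (forall e, e \in U -> b e y = 0) -> y = 0) ->
  exists2 s : seq (V * V), (forall p, p \in s -> p.1 \in U /\ p.2 \in Y) &
    forall y, y \in Y -> y = \sum_(p <- s) b p.1 y *: p.2.
Proof.
move=> bl br nd.
pose A : 'M[K]_(\dim U, \dim Y) := \matrix_(i, j) b (vbasis U)`_i (vbasis Y)`_j.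
have bsl I (s : seq I) F y : b (\sum_(i <- s) F i) y = \sum_(i <- s) b (F i) y.
  pose m := GRing.isLinear.Build K V K^o *:%R _ (bl y).
  exact: (linear_sum (HB.pack (b^~ y) m : {linear V -> K^o})).
have bsr I (s : seq I) F e : b e (\sum_(i <- s) F i) = \sum_(i <- s) b e (F i).
  pose m := GRing.isLinear.Build K V K^o *:%R _ (br e).
  exact: (linear_sum (HB.pack (b e) m : {linear V -> K^o})).
have bZl k e y : b (k *: e) y = k * b e y.
  pose m := GRing.isLinear.Build K V K^o *:%R _ (bl y).
  exact: (linearZ_LR (HB.pack (b^~ y) m : {linear V -> K^o})).
have bZr k e y : b e (k *: y) = k * b e y.
  pose m := GRing.isLinear.Build K V K^o *:%R _ (br e).
  exact: (linearZ_LR (HB.pack (b e) m : {linear V -> K^o})).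
have fullA : row_full A.
  rewrite /row_full -mxrank_tr; apply: inj_row_free => v vA.
  pose y := \sum_j v 0 j *: (vbasis Y)`_j.
  have vb (j : 'I_(\dim Y)) : (vbasis Y)`_j \in Y.
    by rewrite vbasis_mem // mem_nth // size_tuple.
  have yY : y \in Y by apply: memv_suml => j _; apply: memvZ.
  have y0 : y = 0.
    apply: nd => // e eU; rewrite (coord_vbasis eU) bsl big1// => i _.
    rewrite bZl bsr; have /rowP/(_ i) := vA; rewrite !mxE => vi.
    rewrite (eq_bigr (fun j => v 0 j * A^T j i)) ?vi ?mulr0// => j _.
    by rewrite bZr !mxE.
  apply/rowP => j; rewrite mxE.
  have := basis_free (vbasisP Y) => /freeP/(_ (fun j => v 0 j)); apply.
  exact: y0.
have [X XA] := row_fullP fullA.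
pose e j := \sum_i X j i *: (vbasis U)`_i.
exists [seq (e j, (vbasis Y)`_(nat_of_ord j)) | j : 'I_(\dim Y)].
  move=> p /mapP[j _ ->]; split=> /=; last first.
    by rewrite vbasis_mem // mem_nth // size_tuple.
  apply: memv_suml => i _; apply: memvZ.
  by rewrite vbasis_mem // mem_nth // size_tuple.
move=> y yY; rewrite big_map [in LHS](coord_vbasis yY) big_enum /=.
apply: eq_bigr => j _; congr (_ *: _).
rewrite [in RHS](coord_vbasis yY) bsr.
transitivity (\sum_k coord (vbasis Y) k y * (X *m A) j k); last first.
  apply: eq_bigr => k _; rewrite bZr; congr (_ * _).
  by rewrite bsl mxE; apply: eq_bigr => i _; rewrite bZl mxE.
rewrite XA (bigD1 j)//= mxE eqxx mulr1 big1 ?addr0// => k kj.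
by rewrite mxE eq_sym (negbTE kj) mulr0.
Qed.

Section Decomposition.
Variables (K : numFieldType) (g : finLieAlgType K) (D : cartan_datum g).
Variable B : invForm g.
Local Notation h := (cartan D).

(** * Simultaneous diagonalization and root spaces *)

Section EigenSplit.
Variable f : {linear g -> g}.
(** Evaluates at x the polynomial in f whose roots are listed. *)
Let T := foldl (fun x k => f x - k *: x).

Let TL S k x y : T (k *: x + y) S = k *: T x S + T y S.
Proof.
elim: S x y => //= l S IH x y; rewrite -IH; congr (T _ S).
rewrite linearP scalerDr scalerBr !scalerA mulrC opprD.
exact: addrACA.
Qed.

(** By induction f x - k x is a sum of eigenvectors z_l with l different from k. Dividing each by l
    - k gives x' with (f - k) x' = (f - k) x, so x - x' is an eigenvector for k. The subspace U
    carries further conditions to the components. *)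
Lemma eigen_split (U : g -> Prop) S x :
  (forall k y z, U y -> U z -> U (k *: y + z)) -> (forall y, U y -> U (f y)) ->
  uniq S -> U x -> T x S = 0 ->
  exists z : K -> g, [/\ forall k, k \in S -> U (z k) /\ f (z k) = k *: z k
    & x = \sum_(k <- S) z k].
Proof.
move=> UL Uf; elim: S x => [|k S IH] x /=.
  by move=> _ _ ->; exists (fun=> 0); split=> //; rewrite big_nil.
move=> /andP[kS Su] Ux Tx.
have Uy : U (f x - k *: x).
  by rewrite addrC -scaleNr; apply: UL => //; apply: Uf.
have [z [zP xE]] := IH _ Su Uy Tx.
have U0 : U 0 by rewrite -(addNr x) -scaleN1r; apply: UL.
pose z' l := (l - k)^-1 *: z l.
pose x' := \sum_(l <- S) z' l.
have lk l : l \in S -> l - k != 0.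
  by move=> lS; rewrite subr_eq0; apply: contraNneq kS => <-.
have Ux' : U x'.
  rewrite /x' big_seq; elim/big_rec: _ => // l v /zP[Uz _] Uv; exact: UL.
have x'E : f x' - k *: x' = f x - k *: x.
  rewrite xE linear_sum scaler_sumr -sumrB !big_seq; apply: eq_bigr => l lS.
  have [_ fz] := zP _ lS.
  rewrite linearZ/= fz !scalerA -scalerBl [k * _]mulrC -mulrBr.
  by rewrite mulVf ?lk// scale1r.
exists (fun l => if l == k then x - x' else z' l); split=> [l|].
  rewrite inE; case: eqP => [-> _|_ /= lS].
    split; first by rewrite addrC -scaleN1r; apply: UL.
    rewrite linearB scalerBr/= -[f x](subrK (k *: x)) -x'E.
    by rewrite addrC !addrA addNr add0r addrC.
  have [Uz fz] := zP _ lS; split.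
    by rewrite -[z' l]addr0; apply: UL.
  by rewrite linearZ/= fz !scalerA mulrC.
rewrite big_cons eqxx -[LHS](subrK x'); congr (_ + _).
rewrite /x' !big_seq; apply: eq_bigr => l lS.
by case: eqP lS kS => // -> ->.
Qed.

Lemma diag_annihilator (X : seq g) : basis_of fullv X ->
  {in X, forall x, exists k, f x = k *: x} ->
  exists2 S, uniq S & forall x, T x S = 0.
Proof.
move=> Xb Xf.
have [S SP] : exists S : seq K, {in X, forall x, exists2 k, k \in S & f x = k *: x}.
  elim: (X) Xf => [|x s IH] sf; first by exists [::].
  have [|S SP] := IH; first by move=> y ys; apply: sf; rewrite inE ys orbT.
  have [k fx] := sf x (mem_head _ _); exists (k :: S) => y.
  rewrite inE => /orP[/eqP->|/SP[l lS fy]]; [exists k|exists l] => //.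
    exact: mem_head.
  by rewrite inE lS orbT.
exists (undup S); first exact: undup_uniq.
have T0 s : T 0 s = 0 by elim: s => //= k s; rewrite linear0 scaler0 subrr.
have TS I (r : seq I) F s : (forall i, T (F i) s = 0) -> T (\sum_(i <- r) F i) s = 0.
  move=> F0; elim/big_rec: _ => // i x _ x0.
  by rewrite -[F i]scale1r TL F0 scaler0 add0r.
move=> x; rewrite (coord_basis (X := in_tuple X) Xb (memvf x)); apply: TS => i.
rewrite -[_ *: _]addr0 TL T0 addr0.
have [|k kS fx] := SP X`_i; first by rewrite mem_nth.
suff -> : T X`_i (undup S) = 0 by rewrite scaler0.
have {kS} : k \in undup S by rewrite mem_undup.
have Te y : f y = k *: y -> forall s, k \in s -> T y s = 0.
  move=> fy s; elim: s y fy => //= l s IH y fy.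
  rewrite inE => /orP[/eqP<-|ks]; first by rewrite fy subrr T0.
  by apply: IH => //; rewrite fy -scalerBl linearZ/= fy !scalerA mulrC.
exact: Te.
Qed.
End EigenSplit.

Lemma joint_eigen_ind (l : seq g) (P : g -> Prop) :
  {in l, forall x, diagonalizable_end (ad x)} ->
  {in l &, forall x y z, lie x (lie y z) = lie y (lie x z)} ->
  P 0 -> (forall x y, P x -> P y -> P (x + y)) ->
  (forall x, {in l, forall y, exists k, lie y x = k *: x} -> P x) ->
  forall x, P x.
Proof.
elim: l => [|y l IH] dl cl P0 PD PE; first by move=> x; apply: PE.
have yl z : z \in l -> z \in y :: l by rewrite inE => ->; rewrite orbT.
apply: IH => // [z /yl|z w /yl zl /yl|x xE]; [exact: dl|exact: cl|].
have [X Xb XE] := dl y (mem_head _ _).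
have [|S Su TS] := @diag_annihilator (lie y) X Xb.
  by move=> z /XE[k]; rewrite lfunE/= => yz; exists k.
(* Each component of x keeps the eigenvalues of x for the operators in [l], hence is a joint
   eigenvector. *)
pose U z := {in l, forall w k, lie w x = k *: x -> lie w z = k *: z}.
have [|||z [zP xS]] := @eigen_split (lie y) U S x _ _ Su _ (TS x).
- move=> k u v Uu Uv w wl m wx; rewrite linearP/= (Uu _ wl _ wx) (Uv _ wl _ wx).
  by rewrite scalerDr !scalerA mulrC.
- move=> u Uu w wl m wx; rewrite cl ?mem_head ?yl// (Uu _ wl _ wx).
  by rewrite linearZ.
- by [].
rewrite xS big_seq; elim/big_rec: _ => // k u /zP[Uz yz] Pu; apply: PD => //.
apply: PE => w; rewrite inE => /orP[/eqP->|wl]; first by exists k.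
by have [m wx] := xE _ wl; exists m; apply: Uz.
Qed.

(** Root space decomposition: ad of a basis of h is a commuting diagonalizable family. A joint
    eigenvector of weight 0 centralizes h, hence lies in h. *)
Lemma root_split_ind (P : g -> Prop) :
  (forall x y, P x -> P y -> P (x + y)) ->
  (forall x, x \in h -> P x) ->
  (forall a x, a \in roots D -> x \in root_space a -> P x) -> forall x, P x.
Proof.
move=> PD Ph PR; have [hC hZ hD] := cartanP D.
have P0 : P 0 by apply: Ph; apply: mem0v.
have hb x : x \in (vbasis h : seq g) -> x \in h by apply: vbasis_mem.
apply: (joint_eigen_ind (l := vbasis h)) => // [x /hb|x y /hb xh /hb yh z|x xE].
- exact: hD.
- by rewrite lie_derivr (hC x y)// lie0l add0r.
have [k kE] : exists k : 'I_(\dim h) -> K,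
    forall i : 'I_(\dim h), lie (vbasis h)`_i x = k i *: x.
  have kx (i : 'I_(\dim h)) : exists c, lie (vbasis h)`_i x = c *: x.
    by apply: xE; rewrite mem_nth // size_tuple.
  by have [k kP] := fin_all_exists kx; exists k.
(* The weight of x, extended linearly from its eigenvalues on a basis of h. *)
pose F (H : subvs_of h) : K^o := \sum_i k i * coord (vbasis h) i (vsval H).
have FL : linear F.
  move=> c H1 H2; rewrite /F scaler_sumr -big_split; apply: eq_bigr => i _ /=.
  by rewrite !linearP /= mulrDr; congr (_ + _); apply: mulrCA.
pose a : dual h := linfun (HB.pack F (GRing.isLinear.Build K _ K^o *:%R F FL)
  : {linear subvs_of h -> K^o}).
have xa : x \in root_space a.
  apply/root_spaceP => H; rewrite lfunE/= [in LHS](coord_vbasis (subvsP H)).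
  rewrite lie_suml scaler_suml; apply: eq_bigr => i _.
  by rewrite lieZl kE scalerA mulrC.
have [->//|x0] := eqVneq x 0.
have [a0|a0] := eqVneq a 0.
  apply: Ph; apply: hZ => y yh.
  by rewrite -(vsprojK yh) (root_spaceP _ _ xa) a0 zero_lfunE scale0r.
apply: (PR a) => //; rewrite rootsP; apply/andP; split=> //.
by apply: contraNneq x0 => r0; rewrite r0 memv0 in xa.
Qed.

(* rho^vee *)
Definition height_elt : g := vsval (projT1 (cid (height_exists D))).
Local Notation H0 := height_elt.

Lemma height_elt_in : H0 \in h.
Proof. exact: subvsP. Qed.

Definition of_height (j : int) (x : g) := lie H0 x = j%:~R *: x.

Lemma of_height0 x : x \in h -> of_height 0 x.
Proof.
have [hC _ _] := cartanP D.
by move=> xh; rewrite /of_height scale0r hC// height_elt_in.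
Qed.
Lemma of_height_lie i j x y :
  of_height i x -> of_height j y -> of_height (i + j) (lie x y).
Proof.
rewrite /of_height lie_derivr => -> ->.
by rewrite lieZl linearZ/= -scalerDl -intrD.
Qed.

Lemma nonneg_comb_height (a : dual h) :
  a != 0 -> nonneg_comb (simple_roots D) a ->
  exists n : nat, a (projT1 (cid (height_exists D))) = n.+1%:R.
Proof.
move=> a0 [k ak]; set H := projT1 _.
have H1 b : b \in simple_roots D -> b H = 1.
  exact: (projT2 (cid (height_exists D))).
have aH : a H = (\sum_(i < size (simple_roots D)) k i)%:R.
  rewrite ak sum_lfunE natr_sum; apply: eq_bigr => i _.
  by rewrite -scaler_nat scale_lfunE H1 ?mem_nth//; apply: mulr1.
case e: (\sum_(i < _) k i)%N aH => [|n] aH; last by exists n.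
move/eqP: e; rewrite sum_nat_eq0 => /forallP/= k0.
by move: a0; rewrite ak big1 ?eqxx// => i _; rewrite (eqP (k0 i)).
Qed.

(** By the base property a root that is not positive is negative. *)
Definition nminus : {vspace g} :=
  (\sum_(a <- roots D | ~~ positive a) root_space a)%VS.

Lemma nplus_height_ind (P : g -> Prop) :
  P 0 -> (forall x y, P x -> P y -> P (x + y)) ->
  (forall (n : nat) x, x \in nplus D -> of_height n.+1%:Z x -> P x) ->
  forall x, x \in nplus D -> P x.
Proof.
move=> P0 PD PH; apply: nplus_ind => // a x aR pa xa.
have a0 : a != 0 by move: aR; rewrite rootsP => /andP[].
have [n an] := nonneg_comb_height a0 (asboolW pa).
apply: (PH n); first exact: root_nplus xa.
by rewrite /of_height (root_spaceP _ _ xa) an.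
Qed.

Lemma nminus_root (a : dual h) x :
  a \in roots D -> ~~ positive a -> x \in root_space a -> x \in nminus.
Proof.
move=> aR pa; rewrite /nminus (big_rem a)//= pa => xa.
exact: (subvP (addvSl _ _)).
Qed.

Lemma nminus_height_ind (P : g -> Prop) :
  P 0 -> (forall x y, P x -> P y -> P (x + y)) ->
  (forall (n : nat) x, x \in nminus -> of_height (- n.+1%:Z) x -> P x) ->
  forall x, x \in nminus -> P x.
Proof.
move=> P0 PD PH; rewrite /nminus.
have: {subset roots D <= roots D} by [].
elim: {-2}(roots D) => [|a s IH] sR x.
  by rewrite big_nil memv0 => /eqP->.
have {}IH : forall x : g, x \in (\sum_(a <- s | ~~ positive a) root_space a)%VS -> P x.
  by apply: IH => b bs; apply: sR; rewrite inE bs orbT.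
rewrite big_cons; case: ifP => pa; last exact: IH.
case/memv_addP=> y ya [z zs ->]; apply: PD; last exact: IH.
have aR : a \in roots D by apply: sR; rewrite mem_head.
have [a0 _] : a != 0 /\ root_space a != 0%VS.
  by apply/andP; rewrite -[_ && _]/(is_root a) -rootsP.
have [_ _ /(_ a)] := simple_rootsP D; rewrite -rootsP => /(_ aR)[ca|na].
  by case/asboolP: pa.
have [|n an] := nonneg_comb_height _ na; first by rewrite oppr_eq0.
apply: (PH n); first exact: nminus_root ya.
rewrite /of_height (root_spaceP _ _ ya) rmorphN /= -[n.+1%:~R]an.
by rewrite opp_lfunE opprK.
Qed.

Lemma triangular_ind (P : g -> Prop) :
  (forall x y, P x -> P y -> P (x + y)) ->
  (forall x, x \in h -> P x) -> (forall x, x \in nplus D -> P x) ->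
  (forall x, x \in nminus -> P x) -> forall x, P x.
Proof.
move=> PD Ph Pp Pm; apply: root_split_ind => // a x aR xa.
have [pa|pa] := boolP (positive a); first exact/Pp/(root_nplus aR).
exact/Pm/(nminus_root aR).
Qed.

(** Invariance under ad rho^vee gives (i + j) (x | y) = 0. *)
Lemma form_height i j x y :
  of_height i x -> of_height j y -> i + j != 0 -> B x y = 0.
Proof.
rewrite /of_height => xi yj ij; have := form_inv B x H0 y.
rewrite lieC xi yj -scaleNr (formZl B) (form_sym B x (_ *: y)) (formZl B).
rewrite (form_sym B y) => /eqP; rewrite -subr_eq0 -mulrBl mulf_eq0.
rewrite -opprD oppr_eq0 -intrD intr_eq0 (negbTE ij) => /eqP.
by [].
Qed.

Lemma form_nminus x y : x \in nminus -> y \in nminus -> B x y = 0.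
Proof.
move=> xm ym; move: x xm; apply: nminus_height_ind => [|x1 x2 e1 e2|m x _ xm].
- exact: form0l.
- by rewrite formDl e1 e2 addr0.
move: y ym; apply: nminus_height_ind => [|y1 y2 e1 e2|n y _ ym].
- exact: form0r.
- by rewrite formDr e1 e2 addr0.
by apply: (form_height xm ym); rewrite -opprD oppr_eq0.
Qed.

Lemma form_cartan_nminus x y : x \in h -> y \in nminus -> B x y = 0.
Proof.
move=> xh; move: y; apply: nminus_height_ind => [|y1 y2 e1 e2|n y _ ym].
- exact: form0r.
- by rewrite formDr e1 e2 addr0.
by apply: (form_height (of_height0 xh) ym); rewrite add0r oppr_eq0.
Qed.

Lemma form_eq0 x : {in h, forall y, B x y = 0} ->
  {in nplus D, forall y, B x y = 0} -> {in nminus, forall y, B x y = 0} -> x = 0.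
Proof.
move=> xh xp xm; apply: (form_nondeg (i := B)) => y; move: y.
by apply: triangular_ind => // y z e1 e2; rewrite formDr e1 e2 addr0.
Qed.

(** A common element is orthogonal to h, nplus and nminus, hence zero by non-degeneracy. *)
Lemma borel_nminus_direct : (borel D :&: nminus = 0)%VS.
Proof.
apply/eqP; rewrite -subv0; apply/subvP => x; rewrite memv_cap memv0.
case/andP=> /memv_addP[a ah [b bp ->]] xm; apply/eqP/form_eq0 => y yn.
- by rewrite form_sym form_cartan_nminus.
- by rewrite formDl (form_cartan_nplus (D := D))// (form_nplus (D := D))// addr0.
- exact: form_nminus.
Qed.

Lemma borel_nminus_full : (borel D + nminus = fullv)%VS.
Proof.
apply/eqP; rewrite eqEsubv subvf; apply/subvP => x _; move: x.
apply: triangular_ind => [x y||x xn|x xn]; first exact: memvD.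
- by move=> x xh; apply: (subvP (addvSl _ _)); apply: (subvP (addvSl _ _)).
- by apply: (subvP (addvSl _ _)); apply: (subvP (addvSr _ _)).
- exact: (subvP (addvSr _ _)).
Qed.

Lemma triangular_split x : exists a b c,
  [/\ a \in h, b \in nplus D, c \in nminus & x = a + b + c].
Proof.
have : x \in (borel D + nminus)%VS by rewrite borel_nminus_full memvf.
by case/memv_addP=> ? /memv_addP[a ah [b bp ->]] [c cm ->]; exists a, b, c.
Qed.

(** An element of positive height is orthogonal to h and nplus, so its components in h and nminus
    pair to zero with everything. Brackets are later located by their height in this way. *)
Lemma of_height_nplus (n : nat) x : of_height n.+1%:Z x -> x \in nplus D.
Proof.
have [a [b [c [ah bp cm xE]]]] := triangular_split x => xn.
have Bh y : y \in h -> B x y = 0.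
  by move=> yh; apply: (form_height xn (of_height0 yh)); rewrite addr0.
have Bp y : y \in nplus D -> B x y = 0.
  move: y; apply: nplus_height_ind => [|y1 y2 e1 e2|m y _ ym].
  - exact: form0r.
  - by rewrite formDr e1 e2 addr0.
  - exact: (form_height xn ym).
have a0 : a = 0.
  apply: form_eq0 => y yn; last by rewrite form_cartan_nminus.
    have := Bh y yn; rewrite xE !formDl (form_sym B b) (form_cartan_nplus B yn bp).
    by rewrite (form_sym B c) (form_cartan_nminus yn cm) !addr0.
  by rewrite (form_cartan_nplus (D := D)).
have c0 : c = 0.
  apply: form_eq0 => y yn; last by rewrite form_nminus.
    by rewrite form_sym form_cartan_nminus.
  by have := Bp y yn; rewrite xE a0 add0r formDl (form_nplus (D := D))// add0r.
by rewrite xE a0 c0 add0r addr0.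
Qed.

Lemma of_height_nminus (n : nat) x : of_height (- n.+1%:Z) x -> x \in nminus.
Proof.
have [a [b [c [ah bp cm xE]]]] := triangular_split x => xn.
have Bh y : y \in h -> B x y = 0.
  by move=> yh; apply: (form_height xn (of_height0 yh)); rewrite addr0.
have Bm y : y \in nminus -> B x y = 0.
  move: y; apply: nminus_height_ind => [|y1 y2 e1 e2|m y _ ym].
  - exact: form0r.
  - by rewrite formDr e1 e2 addr0.
  - by apply: (form_height xn ym); rewrite -opprD oppr_eq0.
have a0 : a = 0.
  apply: form_eq0 => y yn; last by rewrite form_cartan_nminus.
    have := Bh y yn; rewrite xE !formDl (form_sym B b) (form_cartan_nplus B yn bp).
    by rewrite (form_sym B c) (form_cartan_nminus yn cm) !addr0.
  by rewrite (form_cartan_nplus (D := D)).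
have b0 : b = 0.
  apply: form_eq0 => y yn; first by rewrite form_sym (form_cartan_nplus (D := D)).
    by rewrite (form_nplus (D := D)).
  by have := Bm y yn; rewrite xE a0 add0r formDl (form_nminus cm)// addr0.
by rewrite xE a0 b0 !add0r.
Qed.

Lemma of_height0_cartan x : of_height 0 x -> x \in h.
Proof.
have [a [b [c [ah bp cm xE]]]] := triangular_split x => xn.
have Bp y : y \in nplus D -> B x y = 0.
  move: y; apply: nplus_height_ind => [|y1 y2 e1 e2|m y _ ym].
  - exact: form0r.
  - by rewrite formDr e1 e2 addr0.
  - by apply: (form_height xn ym); rewrite add0r.
have Bm y : y \in nminus -> B x y = 0.
  move: y; apply: nminus_height_ind => [|y1 y2 e1 e2|m y _ ym].
  - exact: form0r.
  - by rewrite formDr e1 e2 addr0.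
  - by apply: (form_height xn ym); rewrite add0r oppr_eq0.
have b0 : b = 0.
  apply: form_eq0 => y yn; first by rewrite form_sym (form_cartan_nplus (D := D)).
    by rewrite (form_nplus (D := D)).
  have := Bm y yn; rewrite xE !formDl form_cartan_nminus// (form_nminus cm)//.
  by rewrite add0r addr0.
have c0 : c = 0.
  apply: form_eq0 => y yn; last by rewrite form_nminus.
    by rewrite form_sym form_cartan_nminus.
  have := Bp y yn; rewrite xE !formDl (form_cartan_nplus (D := D))// b0 form0l.
  by rewrite !add0r.
by rewrite xE b0 c0 !addr0.
Qed.

Lemma lie_nminus x y : x \in nminus -> y \in nminus -> lie x y \in nminus.
Proof.
move=> xm ym; move: x xm; apply: nminus_height_ind => [|x1 x2 e1 e2|m x _ xm].
- by rewrite lie0l mem0v.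
- by rewrite lieDl memvD.
move: y ym; apply: nminus_height_ind => [|y1 y2 e1 e2|n y _ ym].
- by rewrite linear0 mem0v.
- by rewrite lieDr memvD.
have := of_height_lie xm ym; rewrite -opprD -PoszD addSn.
exact: of_height_nminus.
Qed.

Lemma lie_cartan_nminus x y : x \in h -> y \in nminus -> lie x y \in nminus.
Proof.
move=> xh; move: y; apply: nminus_height_ind => [|y1 y2 e1 e2|n y _ ym].
- by rewrite linear0 mem0v.
- by rewrite lieDr memvD.
have := of_height_lie (of_height0 xh) ym; rewrite add0r.
exact: of_height_nminus.
Qed.

Lemma cartan_dual_family : exists2 s : seq (g * g),
  (forall p, p \in s -> p.1 \in h /\ p.2 \in h) &
  forall x, x \in h -> x = \sum_(p <- s) B p.1 x *: p.2.
Proof.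
apply: (@dual_family K g (fun x y => B x y : K^o)).
- by move=> y k u v; rewrite form_linearl.
- by move=> y k u v; rewrite form_linearr.
move=> y yh y0; apply: form_eq0 => z zn.
- by rewrite form_sym y0.
- by rewrite (form_cartan_nplus (D := D)).
- by rewrite form_cartan_nminus.
Qed.

(** For e of height n + 1, (rho^vee | [e, y]) = (n + 1) (e | y), so this pairing is non-degenerate
    on nminus because the invariant form is. *)
Lemma nminus_dual_family : exists2 s : seq (g * g),
  (forall p, p \in s -> p.1 \in nplus D /\ p.2 \in nminus) &
  forall x, x \in nminus -> x = \sum_(p <- s) B H0 (lie p.1 x) *: p.2.
Proof.
apply: (@dual_family K g (fun x y => B H0 (lie x y) : K^o)).
- by move=> y k u v; rewrite lie_linearl form_linearr.
- by move=> y k u v; rewrite lie_linearr form_linearr.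
move=> y ym y0; apply: form_eq0 => z zn; last exact: form_nminus.
  by rewrite form_sym form_cartan_nminus.
rewrite form_sym; move: z zn; apply: nplus_height_ind => [|z1 z2 e1 e2|n z zn zh].
- exact: form0l.
- by rewrite formDl e1 e2 addr0.
have := y0 z zn; rewrite -form_inv zh (formZl B) => /eqP.
by rewrite mulf_eq0 intr_eq0 => /eqP.
Qed.

End Decomposition.

(** * Heisenberg modules of nonzero level *)

(** Descent: while some operator does not kill w, replace w by its nonzero image, one step lower;
    step 0 contains only 0. It serves for both modules. *)
Lemma killed_vector (V : zmodType) (G : nat -> V -> Prop) (W : V -> Prop)
    (ops : (V -> V) -> Prop) :
  (forall w, G 0 w -> w = 0) ->
  (forall f d w, ops f -> G d.+1 w -> G d (f w)) ->
  (forall f w, ops f -> W w -> W (f w)) ->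
  forall d w, G d w -> W w -> w != 0 ->
  exists w', [/\ W w', w' != 0 & forall f, ops f -> f w' = 0].
Proof.
move=> G0 GS Wf; elim=> [|d IH] w Gw Ww w0; first by rewrite (G0 _ Gw) eqxx in w0.
have [wf|] := pselect (forall f, ops f -> f w = 0); first by exists w.
move=> /existsNP[f] /not_implyP[fo /eqP fw0].
exact: (IH (f w) (GS f d w fo Gw) (Wf f w fo Ww) fw0).
Qed.

Section Heisenberg.
Variables (K : numFieldType) (g : finLieAlgType K) (D : cartan_datum g).
Variable B : invForm g.
Local Notation h := (cartan D).
(** [hop x m] stands for the action of x t^m on M', [v0] for the generator, [zc x m] for zeta(x
    t^m), [a] for the level. *)
Variables (M : lmodType K) (hop : g -> int -> M -> M) (a : K).
Variables (v0 : M) (zc : g -> int -> K).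
Hypothesis a0 : a != 0.
Hypothesis hop_linl : forall k x y m q,
  hop (k *: x + y) m q = k *: hop x m q + hop y m q.
Hypothesis hop_linr : forall x m, linear (hop x m).
Hypothesis hopC : forall x y m n q, x \in h -> y \in h ->
  hop x m (hop y n q) = hop y n (hop x m q) +
    (if m + n == 0 then m%:~R * B x y * a else 0) *: q.
Hypothesis hop_v0 : forall x (m : int), x \in h -> 0 < m -> hop x m v0 = zc x m *: v0.
Hypothesis hop_ind : forall P : M -> Prop,
  P 0 -> (forall k p q, P p -> P q -> P (k *: p + q)) -> P v0 ->
  (forall x (s : nat) q, x \in h -> P q -> P (hop x (- s.+1%:Z) q)) ->
  forall q, P q.

HB.instance Definition _ x m :=
  GRing.isLinear.Build K M M *:%R (hop x m) (hop_linr x m).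

(* Words of fewer than d letters x t^-s, 0 < s <= R, applied to v0, and their sums *)
Inductive heis_word (R : nat) : nat -> M -> Prop :=
| heis_word0 d : heis_word R d 0
| heis_word_lin d k p q : heis_word R d p -> heis_word R d q ->
    heis_word R d (k *: p + q)
| heis_word_v0 d : heis_word R d.+1 v0
| heis_word_cons d x s q : x \in h -> (s < R)%N -> heis_word R d q ->
    heis_word R d.+1 (hop x (- s.+1%:Z) q).

Lemma heis_wordD R d p q :
  heis_word R d p -> heis_word R d q -> heis_word R d (p + q).
Proof. by move=> ? ?; rewrite -[p]scale1r; apply: heis_word_lin. Qed.
Lemma heis_wordZ R d k p : heis_word R d p -> heis_word R d (k *: p).
Proof.
by move=> ?; rewrite -[_ *: _]addr0; apply: heis_word_lin => //; apply: heis_word0.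
Qed.

Lemma heis_word_mono R R' d d' q :
  (R <= R')%N -> (d <= d')%N -> heis_word R d q -> heis_word R' d' q.
Proof.
move=> RR' dd' H; elim: H d' dd' => {d q}
  [d|d k p q _ IHp _ IHq|d|d x s q xh sR _ IH] d' dd'.
- exact: heis_word0.
- by apply: heis_word_lin; [apply: IHp|apply: IHq].
- by case: d' dd' => // d' _; apply: heis_word_v0.
- case: d' dd' => // d' dd'; apply: heis_word_cons => //; first lia.
  exact: IH.
Qed.

Lemma heis_word_eq0 R q : heis_word R 0 q -> q = 0.
Proof.
move=> H; elim: {-2}0%N q / H (erefl 0%N) => // d k p q _ IHp _ IHq d0.
by rewrite IHp// IHq// scaler0 addr0.
Qed.

Lemma heis_word1 R q : heis_word R 1 q -> exists k, q = k *: v0.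
Proof.
move=> H; elim: {-2}1%N q / H (erefl 1%N) =>
  [d _|d k p q _ IHp _ IHq d1|d _|d x s q _ _ H _ [d0]].
- by exists 0; rewrite scale0r.
- have [k1 ->] := IHp d1; have [k2 ->] := IHq d1.
  by exists (k * k1 + k2); rewrite scalerA scalerDl.
- by exists 1; rewrite scale1r.
- by exists 0; rewrite d0 in H; rewrite (heis_word_eq0 H) linear0 scale0r.
Qed.

Lemma heis_word_ex q : exists R d, heis_word R d q.
Proof.
elim/hop_ind: q => [|k p q [R [d pd]] [R' [d' qd]]||x s q xh [R [d qd]]].
- by exists 0%N, 0%N; apply: heis_word0.
- exists (maxn R R'), (maxn d d'); apply: heis_word_lin.
    by apply: heis_word_mono pd; lia.
  by apply: heis_word_mono qd; lia.
- by exists 0%N, 1%N; apply: heis_word_v0.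
- exists (maxn R s.+1), d.+1; apply: heis_word_cons => //; first lia.
  by apply: heis_word_mono qd; lia.
Qed.

(* For r > 0 this is the derivation y t^-s |-> delta_(r, s) r a (x | y) of words. *)
Definition delta x r q := hop x r q - zc x r *: q.

Lemma delta_linear x r : linear (delta x r).
Proof.
move=> k p q; rewrite /delta linearP/= scalerBr scalerDr opprD addrACA.
by rewrite !scalerA mulrC.
Qed.
HB.instance Definition _ x r :=
  GRing.isLinear.Build K M M *:%R (delta x r) (delta_linear x r).

Lemma delta_v0 x r : x \in h -> 0 < r -> delta x r v0 = 0.
Proof. by move=> xh r0; rewrite /delta hop_v0// subrr. Qed.

Lemma delta_hop x y r n q : x \in h -> y \in h ->
  delta x r (hop y n q) = hop y n (delta x r q) +
    (if r + n == 0 then r%:~R * B x y * a else 0) *: q.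
Proof.
move=> xh yh; rewrite /delta hopC// [hop y n (_ - _)]linearB/=.
by rewrite [hop y n (zc _ _ *: _)]linearZ/= addrAC.
Qed.

Lemma delta_word R d x r q : x \in h -> 0 < r ->
  heis_word R d q -> heis_word R d.-1 (delta x r q).
Proof.
move=> xh r0; elim=> {d q} [d|d k p q _ IHp _ IHq|d|d y s q yh sR wq IH] /=.
- by rewrite linear0; apply: heis_word0.
- by rewrite linearP; apply: heis_word_lin.
- by rewrite delta_v0//; apply: heis_word0.
rewrite delta_hop//; apply: heis_wordD; last exact: heis_wordZ.
case: d wq IH => [/heis_word_eq0->|d _ IH]; last exact: heis_word_cons.
by rewrite !linear0.
Qed.

(** The letters have degrees at least -R, so none of them pairs with degree r. *)
Lemma delta_far R d x (r : nat) q : x \in h -> (R < r)%N ->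
  heis_word R d q -> delta x r q = 0.
Proof.
move=> xh Rr; elim=> {d q} [d|d k p q _ IHp _ IHq|d|d y s q yh sR wq IH].
- by rewrite linear0.
- by rewrite linearP/= IHp IHq scaler0 addr0.
- by rewrite delta_v0//; lia.
rewrite delta_hop// IH linear0 add0r.
by case: eqP => [|_]; [lia|rewrite scale0r].
Qed.

Section Euler.
Variable s : seq (g * g).
Hypothesis sh : forall p, p \in s -> p.1 \in h /\ p.2 \in h.
Hypothesis sE : forall x, x \in h -> x = \sum_(p <- s) B p.1 x *: p.2.

(** The Euler sum cut off at R, which is enough on words whose letters have degrees at least -R. *)
Definition heis_euler R q : M := \sum_(r < R) \sum_(p <- s)
  (r.+1%:R * a)^-1 *: hop p.2 (- r.+1%:Z) (delta p.1 r.+1 q).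

Lemma heis_euler_linear R : linear (heis_euler R).
Proof.
move=> k p q; rewrite /heis_euler scaler_sumr -big_split; apply: eq_bigr => r _.
rewrite scaler_sumr -big_split; apply: eq_bigr => z _ /=.
by rewrite delta_linear hop_linr scalerDr !scalerA mulrC.
Qed.
HB.instance Definition _ R :=
  GRing.isLinear.Build K M M *:%R (heis_euler R) (heis_euler_linear R).

Lemma hop_Dl x y m q : hop (x + y) m q = hop x m q + hop y m q.
Proof. by rewrite -[x]scale1r hop_linl !scale1r. Qed.
Lemma hop_0l m q : hop 0 m q = 0.
Proof. by apply: (addrI (hop 0 m q)); rewrite -hop_Dl !addr0. Qed.
Lemma hop_Zl k x m q : hop (k *: x) m q = k *: hop x m q.
Proof. by rewrite -[k *: x]addr0 hop_linl hop_0l addr0. Qed.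
Lemma hop_suml I (l : seq I) (F : I -> g) m q :
  hop (\sum_(i <- l) F i) m q = \sum_(i <- l) hop (F i) m q.
Proof.
by elim/big_rec2: _ => [|i u v _ <-]; rewrite ?hop_0l ?hop_Dl.
Qed.

(** Letters of negative degree commute, so only the derivation gives a correction, and only in the
    degree of y. There the normalization cancels the commutator factor and the dual family
    reassembles y. *)
Lemma heis_euler_hop R y (n : nat) q : y \in h -> (n < R)%N ->
  heis_euler R (hop y (- n.+1%:Z) q) =
  hop y (- n.+1%:Z) (heis_euler R q) + hop y (- n.+1%:Z) q.
Proof.
move=> yh nR; have -> : hop y (- n.+1%:Z) (heis_euler R q) =
    \sum_(r < R) \sum_(p <- s) (r.+1%:R * a)^-1 *:
      hop p.2 (- r.+1%:Z) (hop y (- n.+1%:Z) (delta p.1 r.+1 q)).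
  rewrite linear_sum; apply: eq_bigr => r _; rewrite linear_sum !big_seq.
  apply: eq_bigr => p /sh[_ ph]; rewrite linearZ/= hopC//.
  by case: eqP => [|_]; [lia|rewrite scale0r addr0].
rewrite [X in _ + hop X _ _](sE yh) hop_suml.
rewrite [X in _ + X](_ : _ = \sum_(r < R) \sum_(p <- s) (r.+1%:R * a)^-1 *:
   hop p.2 (- r.+1%:Z) ((if r == n :> nat then r.+1%:R * B p.1 y * a else 0) *: q)).
  rewrite -big_split; apply: eq_bigr => r _; rewrite -big_split !big_seq.
  apply: eq_bigr => p /sh[ph _] /=; rewrite -scalerDr -linearD; congr (_ *: hop _ _ _).
  by rewrite delta_hop// subr_eq0 eqz_nat eqSS.
rewrite (bigD1 (Ordinal nR))//= eqxx [X in _ = _ + X]big1 ?addr0 => [|r rn].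
  apply: eq_bigr => p _; rewrite linearZ/= hop_Zl scalerA; congr (_ *: _).
  by rewrite [_ * _ * a]mulrAC mulKf// mulf_neq0// pnatr_eq0.
rewrite big1// => p _; case: eqP => [rn'|_]; last by rewrite scale0r linear0 scaler0.
by case/eqP: rn; apply: val_inj.
Qed.

(** The bound d allows at most d - 1 letters, hence the eigenvalue d - 1 on the longest words; for d
    = 0 only 0 occurs, so the truncated predecessor is harmless. *)
Lemma heis_euler_word R d q : heis_word R d q ->
  heis_word R d.-1 (heis_euler R q - d.-1%:R *: q).
Proof.
elim=> {d q} [d|d k p q _ IHp _ IHq|d|d y n q yh nR wq IH] /=.
- by rewrite linear0 scaler0 subrr; apply: heis_word0.
- rewrite linearP/= scalerDr opprD addrACA scalerA mulrC -scalerA -scalerBr.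
  exact: heis_word_lin.
- rewrite [heis_euler R v0]big1 => [|r _]; last first.
    by rewrite big_seq big1// => p /sh[ph _]; rewrite delta_v0// !linear0.
  by case: d => [|d]; rewrite ?scale0r ?subrr ?sub0r -?scaleNr;
    [apply: heis_word0|apply/heis_wordZ/heis_word_v0].
case: d wq IH => [/heis_word_eq0->|d wq IH].
  by rewrite !linear0 ?scaler0 ?subr0 //; exact: heis_word0.
rewrite heis_euler_hop// -[d.+1]addn1 natrD scalerDl scale1r opprD addrACA subrr addr0.
by rewrite -linearZ -linearB/= addn1; apply: heis_word_cons.
Qed.
End Euler.

Lemma hop_irreducible (W : M -> Prop) :
  (forall k p q, W p -> W q -> W (k *: p + q)) ->
  (forall x m q, x \in h -> W q -> W (hop x m q)) ->
  forall q, W q -> q != 0 -> forall p, W p.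
Proof.
move=> WL Wh q Wq q0.
have WZ k p : W p -> W (k *: p).
  move=> Wp; rewrite -[_ *: _](_ : (k - 1) *: p + p = _); first exact: WL.
  by rewrite scalerBl scale1r subrK.
have [R [d wq]] := heis_word_ex q.
pose ops (f : M -> M) := exists (x : g) (r : int), [/\ x \in h, 0 < r & f = delta x r].
pose Wd p := W p /\ exists d, heis_word R d p.
have [|||p [[Wp [e we]] p0 kp]] :=
  @killed_vector M (heis_word R) Wd ops (@heis_word_eq0 R) _ _ d q wq _ q0.
- by move=> f e p [x [r [xh r0 ->]]] /(delta_word xh r0).
- move=> f p [x [r [xh r0 ->]]] [Wp [e we]]; split; last first.
    by exists e.-1; apply: delta_word.
  by rewrite /delta addrC -scaleNr; apply: WL => //; apply: Wh.
- by split=> //; exists d.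
have [s sh sE] := cartan_dual_family D B.
have Ep : heis_euler s R p = 0.
  rewrite /heis_euler big1// => r _; rewrite big_seq big1// => z /sh[zh _].
  by rewrite (kp (delta z.1 r.+1)) ?linear0 ?scaler0//; exists z.1, r.+1%:Z.
(* The Euler operator kills p and multiplies its longest words by a nonzero number, so a bound above
   1 can be lowered. *)
have [k pE] : exists k, p = k *: v0.
  elim: e we => [/heis_word_eq0 p00|[|e] IH wp]; first by rewrite p00 eqxx in p0.
    exact: heis_word1 wp.
  apply: IH; have := heis_euler_word sh sE wp.
  rewrite Ep sub0r /= => /(heis_wordZ (- e.+1%:R^-1)).
  by rewrite scaleNr scalerN opprK scalerA mulVf ?scale1r// pnatr_eq0.
have Wv : W v0.
  have k0 : k != 0 by apply: contraNneq p0 => k0; rewrite pE k0 scale0r.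
  by rewrite -[v0](scalerK k0) -pE; apply: WZ.
have W0 : W 0 by rewrite -(scale0r p); apply: WZ.
by elim/hop_ind=> // x n u xh Wu; apply: Wh.
Qed.


(** * Imaginary Verma modules, abstractly *)

Section Verma.
Local Notation H0 := (height_elt D).
(** [act x m] stands for the action of x t^m on M~, and [tau] for the map sending q to 1 (x) q. *)
Variables (T : lmodType K) (act : g -> int -> T -> T) (tau : {linear M -> T}).
Hypothesis act_linl : forall k x y m w,
  act (k *: x + y) m w = k *: act x m w + act y m w.
Hypothesis act_linr : forall x m, linear (act x m).
Hypothesis actC : forall x y m n w, act x m (act y n w) =
  act y n (act x m w) + act (lie x y) (m + n) w +
  (if m + n == 0 then m%:~R * B x y * a else 0) *: w.
Hypothesis act_tau : forall x m q, x \in h -> act x m (tau q) = tau (hop x m q).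
Hypothesis act_nplus : forall x m q, x \in nplus D -> act x m (tau q) = 0.
Hypothesis act_ind : forall P : T -> Prop,
  P 0 -> (forall k u w, P u -> P w -> P (k *: u + w)) ->
  (forall q, P (tau q)) ->
  (forall y m w, y \in nminus D -> P w -> P (act y m w)) -> forall w, P w.
(* T is free over the enveloping algebra of nminus[t, t^-1]. *)
Hypothesis tau_lift : forall th : {linear M -> M}, exists Th : {linear T -> T},
  (forall q, Th (tau q) = tau (th q)) /\
  (forall y m w, y \in nminus D -> Th (act y m w) = act y m (Th w)).

HB.instance Definition _ x m :=
  GRing.isLinear.Build K T T *:%R (act x m) (act_linr x m).

Lemma act_Dl x y m w : act (x + y) m w = act x m w + act y m w.
Proof. by rewrite -[x]scale1r act_linl !scale1r. Qed.
Lemma act_0l m w : act 0 m w = 0.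
Proof. by apply: (addrI (act 0 m w)); rewrite -act_Dl !addr0. Qed.
Lemma act_Zl k x m w : act (k *: x) m w = k *: act x m w.
Proof. by rewrite -[k *: x]addr0 act_linl act_0l addr0. Qed.
Lemma act_suml I (l : seq I) (F : I -> g) m w :
  act (\sum_(i <- l) F i) m w = \sum_(i <- l) act (F i) m w.
Proof.
by elim/big_rec2: _ => [|i u v _ <-]; rewrite ?act_0l ?act_Dl.
Qed.

(* Sums of weight vectors lying fewer than H levels below tau(M) *)
Inductive height_word : nat -> T -> Prop :=
| height_word0 H : height_word H 0
| height_word_lin H k u w : height_word H u -> height_word H w ->
    height_word H (k *: u + w)
| height_word_tau H q : height_word H.+1 (tau q)
| height_word_cons H (n : nat) y m w : y \in nminus D ->
    of_height D (- n.+1%:Z) y -> height_word H w ->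
    height_word (H + n.+1) (act y m w).

Lemma height_word_mono H H' w :
  (H <= H')%N -> height_word H w -> height_word H' w.
Proof.
move=> HH' Hw; elim: Hw H' HH' => {H w}
  [H|H k u w _ IHu _ IHw|H q|H n y m w ym yn _ IH] H' HH'.
- exact: height_word0.
- by apply: height_word_lin; [apply: IHu|apply: IHw].
- by case: H' HH' => // H' _; apply: height_word_tau.
- rewrite -(subnK (_ : n.+1 <= H')%N); last lia.
  by apply: height_word_cons => //; apply: IH; lia.
Qed.

Lemma height_word_eq0 w : height_word 0 w -> w = 0.
Proof.
move=> H; elim: {-2}0%N w / H (erefl 0%N) => //.
  by move=> d k u w _ IHu _ IHw d0; rewrite IHu// IHw// scaler0 addr0.
by move=> H n y m w _ _ _ _; rewrite addnS.
Qed.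

Lemma height_word_ex w : exists H, height_word H w.
Proof.
elim/act_ind: w => [|k u w [H Hu] [H' Hw]|q|y m w ym [H Hw]].
- by exists 0%N; apply: height_word0.
- exists (maxn H H'); apply: height_word_lin.
    by apply: height_word_mono Hu; lia.
  by apply: height_word_mono Hw; lia.
- by exists 1%N; apply: height_word_tau.
move: y ym; apply: nminus_height_ind => [|y z [H1 e1] [H2 e2]|n y ym yn].
- by rewrite act_0l; exists 0%N; apply: height_word0.
- exists (maxn H1 H2); rewrite act_Dl -[act y m w]scale1r.
  apply: height_word_lin; first by apply: height_word_mono e1; lia.
  by apply: height_word_mono e2; lia.
- by exists (H + n.+1)%N; apply: height_word_cons.
Qed.

Lemma height_wordD H u w :
  height_word H u -> height_word H w -> height_word H (u + w).
Proof. by move=> ? ?; rewrite -[u]scale1r; apply: height_word_lin. Qed.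
Lemma height_wordZ H k w : height_word H w -> height_word H (k *: w).
Proof.
by move=> ?; rewrite -[_ *: _]addr0; apply: height_word_lin => //; apply: height_word0.
Qed.

(** Moving x past a letter y leaves [x, y] and a scalar; the height of [x, y] decides between the
    induction hypothesis and a new letter. The truncated subtraction says that nothing lies above
    tau(M). *)
Lemma height_word_raise H (n : nat) x m w : of_height D n x ->
  height_word H w -> height_word (H - n) (act x m w).
Proof.
move=> xn Hw; elim: Hw n x m xn => {H w}
  [H|H k u w _ IHu _ IHw|H q|H j y k w ym yj Hw IH] n x m xn.
- by rewrite linear0; apply: height_word0.
- by rewrite linearP; apply: height_word_lin; [apply: IHu|apply: IHw].
- case: n xn => [|n] xn.
    by rewrite subn0 act_tau ?(of_height0_cartan B)//; apply: height_word_tau.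
  by rewrite act_nplus ?(of_height_nplus B xn)//; apply: height_word0.
rewrite actC; apply: height_wordD; first apply: height_wordD.
- have [nH|Hn] := leqP n H.
    rewrite (_ : _ - n = H - n + j.+1)%N; last lia.
    by apply: height_word_cons => //; apply: IH.
  (* Here x lifts w beyond the top, so the induction hypothesis puts the image at level 0. *)
  have -> : act x m w = 0.
    by apply: height_word_eq0; have := IH n x m xn; rewrite (_ : H - n = 0)%N//; lia.
  by rewrite linear0; apply: height_word0.
- have xy := of_height_lie xn yj.
  have [jn|nj] := leqP j.+1 n.
    rewrite (_ : n%:Z - _ = (n - j.+1)%N :> int) in xy; last lia.
    by apply: height_word_mono (IH _ _ (m + k) xy); lia.
  rewrite (_ : n%:Z - _ = - (j - n).+1%:Z :> int) in xy; last lia.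
  rewrite (_ : _ - n = H + (j - n).+1)%N; last lia.
  by apply: height_word_cons => //; apply: (of_height_nminus B xy).
(* The central term survives only if the heights of x and y cancel, and then H is the required
   bound. *)
- have [nj|nj] := eqVneq n j.+1.
    by apply: height_wordZ; apply: height_word_mono Hw; lia.
  rewrite (form_height B xn yj) ?mulr0 ?mul0r ?if_same ?scale0r.
    exact: height_word0.
  by rewrite subr_eq0 eqz_nat.
Qed.

(* Words of fewer than d letters y t^m, |m| <= R, applied to tau(q) with q a sum of
   Heisenberg words of degrees at most R, and their sums *)
Inductive verma_word (R : nat) : nat -> T -> Prop :=
| verma_word0 d : verma_word R d 0
| verma_word_lin d k u w : verma_word R d u -> verma_word R d w ->
    verma_word R d (k *: u + w)
| verma_word_tau d d' q : heis_word R d' q -> verma_word R d.+1 (tau q)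
| verma_word_cons d y (m : int) w : y \in nminus D -> (`|m| <= R)%N ->
    verma_word R d w -> verma_word R d.+1 (act y m w).

(** Length alone: R serves to choose Theta_r, but new letters such as [x, y] t^(m + n) leave any
    fixed degree bound. *)
Definition verma_fil d w := exists R, verma_word R d w.

Lemma verma_word_mono R R' d d' w :
  (R <= R')%N -> (d <= d')%N -> verma_word R d w -> verma_word R' d' w.
Proof.
move=> RR' dd' H; elim: H d' dd' => {d w}
  [d|d k u w _ IHu _ IHw|d e q wq|d y m w ym mR _ IH] d' dd'.
- exact: verma_word0.
- by apply: verma_word_lin; [apply: IHu|apply: IHw].
- case: d' dd' => // d' _; apply: (@verma_word_tau _ _ e).
  exact: heis_word_mono wq.
- case: d' dd' => // d' dd'; apply: verma_word_cons => //; first lia.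
  exact: IH.
Qed.

Lemma verma_word_eq0 R w : verma_word R 0 w -> w = 0.
Proof.
move=> H; elim: {-2}0%N w / H (erefl 0%N) => // d k u w _ IHu _ IHw d0.
by rewrite IHu// IHw// scaler0 addr0.
Qed.

Lemma verma_word1 R w : verma_word R 1 w -> exists q, w = tau q.
Proof.
move=> H; elim: {-2}1%N w / H (erefl 1%N) =>
  [d _|d k u w _ IHu _ IHw d1|d d' q _ _|d y m w _ _ H _ [d0]].
- by exists 0; rewrite linear0.
- have [q1 ->] := IHu d1; have [q2 ->] := IHw d1.
  by exists (k *: q1 + q2); rewrite linearP.
- by exists q.
- by exists 0; rewrite d0 in H; rewrite (verma_word_eq0 H) !linear0.
Qed.

Lemma verma_fil0 d : verma_fil d 0.
Proof. by exists 0%N; apply: verma_word0. Qed.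
Lemma verma_fil_lin d k u w : verma_fil d u -> verma_fil d w -> verma_fil d (k *: u + w).
Proof.
move=> [R uR] [R' wR']; exists (maxn R R'); apply: verma_word_lin.
  by apply: verma_word_mono uR; lia.
by apply: verma_word_mono wR'; lia.
Qed.
Lemma verma_filD d u w : verma_fil d u -> verma_fil d w -> verma_fil d (u + w).
Proof. by move=> ? ?; rewrite -[u]scale1r; apply: verma_fil_lin. Qed.
Lemma verma_filZ d k w : verma_fil d w -> verma_fil d (k *: w).
Proof. by move=> ?; rewrite -[_ *: _]addr0; apply: verma_fil_lin => //; apply: verma_fil0. Qed.
Lemma verma_fil_sum d I (l : seq I) (P : pred I) (F : I -> T) :
  (forall i, P i -> verma_fil d (F i)) -> verma_fil d (\sum_(i <- l | P i) F i).
Proof. by move=> fF; elim/big_rec: _ => [|i w /fF]; [apply: verma_fil0|apply: verma_filD]. Qed.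
Lemma verma_fil_mono d d' w : (d <= d')%N -> verma_fil d w -> verma_fil d' w.
Proof. by move=> dd' [R wR]; exists R; apply: verma_word_mono wR. Qed.
Lemma verma_fil_cons d y m w : y \in nminus D -> verma_fil d w -> verma_fil d.+1 (act y m w).
Proof.
move=> ym [R wR]; exists (maxn R `|m|); apply: verma_word_cons => //; first lia.
by apply: verma_word_mono wR; lia.
Qed.
Lemma verma_fil_ex w : exists d, verma_fil d w.
Proof.
elim/act_ind: w => [|k u w [d du] [d' dw]|q|y m w ym [d dw]].
- by exists 0%N; apply: verma_fil0.
- exists (maxn d d'); apply: verma_fil_lin.
    by apply: verma_fil_mono du; lia.
  by apply: verma_fil_mono dw; lia.
- have [R [d wq]] := heis_word_ex q.
  by exists 1%N, R; apply: verma_word_tau wq.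
- by exists d.+1; apply: verma_fil_cons.
Qed.

(** * The operators Theta_r for large r *)

Section Far.
Variables (R r : nat).
Hypothesis Rr : (R < r)%N.

(* As R < r this kills all Heisenberg words of degrees at most R. *)
Definition far_der q := (r%:R * a)^-1 *: delta H0 r q.

Lemma far_der_linear : linear far_der.
Proof.
by move=> k p q; rewrite /far_der delta_linear scalerDr !scalerA mulrC.
Qed.
HB.instance Definition _ :=
  GRing.isLinear.Build K M M *:%R far_der far_der_linear.

Lemma far_der_hop x m q : x \in h ->
  far_der (hop x m q) = hop x m (far_der q) + (if m + r%:Z == 0 then B H0 x else 0) *: q.
Proof.
move=> xh; rewrite /far_der delta_hop ?height_elt_in// scalerDr linearZ/=.
rewrite scalerA [m + _]addrC; congr (_ + _).
  by rewrite [RHS]linearZ.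
congr (_ *: _); case: eqP => _; rewrite ?mul0r//.
rewrite [_ * _ * a]mulrAC [_ * B _ _]mulrC mulfK// mulf_neq0// pnatr_eq0.
by case: (r) Rr.
Qed.

Lemma far_der_word d q : heis_word R d q -> far_der q = 0.
Proof.
by move=> wq; rewrite /far_der (delta_far _ Rr wq) ?scaler0// height_elt_in.
Qed.

Variable Th : {linear T -> T}.
Hypothesis Th_tau : forall q, Th (tau q) = tau (far_der q).
Hypothesis Th_act : forall y m w, y \in nminus D -> Th (act y m w) = act y m (Th w).

Lemma far_word d w : verma_word R d w -> Th w = 0.
Proof.
elim=> {d w} [d|d k u w _ IHu _ IHw|d e q wq|d y m w ym mR _ IH].
- exact: linear0.
- by rewrite linearP IHu IHw scaler0 addr0.
- by rewrite Th_tau (far_der_word wq) linear0.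
- by rewrite Th_act// IH linear0.
Qed.

(** [Th] commutes with the letters, including the new ones [x, y] in nminus, and kills w; only the
    commutator of [far_der] with x t^m on the coefficients remains. *)
Lemma far_cartan d x m w : x \in h -> verma_word R d w ->
  Th (act x m w) = (if m + r%:Z == 0 then B H0 x else 0) *: w.
Proof.
move=> xh; elim=> {d w} [d|d k u w _ IHu _ IHw|d e q wq|d y k w ym kR wR IH].
- by rewrite scaler0 !linear0.
- by rewrite act_linr linearP IHu IHw scalerDr !scalerA mulrC.
- rewrite act_tau// Th_tau far_der_hop// (far_der_word wq) linear0 add0r.
  exact: linearZ.
rewrite actC !linearD Th_act// IH Th_act ?lie_cartan_nminus// (far_word wR).
rewrite linear0 addr0 [Th (_ *: w)]linearZ/= (far_word wR) scaler0 addr0.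
exact: linearZ.
Qed.

(** When x meets a letter y, [Th] kills the component of [x, y] in nminus and turns the one in h
    into a scalar, while the one in nplus acts on a shorter word: a letter is always lost. *)
Lemma far_nplus d x m w : x \in nplus D -> verma_word R d w ->
  verma_fil d.-1 (Th (act x m w)).
Proof.
move=> xn H; elim: H x m xn => {d w}
  [d|d k u w _ IHu _ IHw|d e q wq|d y k w ym kR wR IH] x m xn.
- by rewrite !linear0; apply: verma_fil0.
- by rewrite !linearP; apply: verma_fil_lin; [apply: IHu|apply: IHw].
- by rewrite act_nplus// linear0; apply: verma_fil0.
have fw : verma_fil d w by exists R.
rewrite actC !linearD [Th (_ *: w)]linearZ/= (far_word wR) scaler0 addr0.
have [b [c [e [bh cp em ->]]]] := triangular_split D (lie x y).
apply: verma_filD.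
  rewrite Th_act//; case: d wR IH fw => [/verma_word_eq0->|d wR IH _].
    by rewrite !linear0 => _ _; apply: verma_fil0.
  by apply: verma_fil_cons => //; apply: IH.
rewrite !act_Dl !linearD (far_cartan _ bh wR) (Th_act _ _ em) (far_word wR) linear0 addr0.
apply: verma_filD; first exact: verma_filZ.
by apply: verma_fil_mono (IH _ _ cp); lia.
Qed.

Section VermaEuler.
Variable s : seq (g * g).
Hypothesis sn : forall p, p \in s -> p.1 \in nplus D /\ p.2 \in nminus D.
Hypothesis sE : forall x, x \in nminus D ->
  x = \sum_(p <- s) B H0 (lie p.1 x) *: p.2.

(** Shifts the index so that it runs over the degrees from -R to R. *)
Let deg (k : 'I_(R.*2.+1)) : int := k%:Z - R%:Z.

(* Up to shorter words, each letter y t^k is removed by e t^(- k - r) together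
   with Th, which detects the new factor [e, y] t^-r, and is then put back. *)
Definition verma_euler w := \sum_(k < R.*2.+1) \sum_(p <- s)
  act p.2 (deg k) (Th (act p.1 (- deg k - r%:Z) w)).

Lemma verma_euler_linear : linear verma_euler.
Proof.
move=> k u w; rewrite /verma_euler scaler_sumr -big_split; apply: eq_bigr => j _.
rewrite scaler_sumr -big_split; apply: eq_bigr => z _ /=.
by rewrite act_linr linearP act_linr.
Qed.
HB.instance Definition _ :=
  GRing.isLinear.Build K T T *:%R verma_euler verma_euler_linear.

(** Commuting e t^(-k-r) past y t^m creates [e, y] t^(m-k-r), from which [Th] extracts (rho^vee |
    [e, y]) exactly when k = m; the dual family sums these terms to y t^m w. The others lie one step
    lower. *)
Lemma verma_euler_act d y (m : int) w : y \in nminus D -> (`|m| <= R)%N ->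
  verma_word R d.+1 w ->
  verma_fil d.+1 (verma_euler (act y m w) - act y m (verma_euler w) - act y m w).
Proof.
move=> ym mR wR.
have mP : (absz (m + R%:Z)%R < R.*2.+1)%N by lia.
have degE k : (deg k == m) = (k == Ordinal mP).
  apply/eqP/eqP => [e|->]; last by rewrite /deg /=; lia.
  by apply: val_inj; rewrite /deg in e; rewrite /=; lia.
(* The subtracted y t^m w is spread over the same double sum, to cancel term by term. *)
rewrite [X in _ - X](_ : _ = \sum_(k < R.*2.+1) \sum_(p <- s)
    (if deg k == m then B H0 (lie p.1 y) else 0) *: act p.2 (deg k) w); last first.
  rewrite (bigD1 (Ordinal mP))//= degE eqxx [X in _ = _ + X]big1 => [|k km].
    rewrite addr0 [in LHS](sE ym) act_suml; apply: eq_bigr => p _.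
    by rewrite act_Zl; congr (_ *: act _ _ _); rewrite /deg/=; lia.
  by rewrite big1// => p _; rewrite degE (negbTE km) scale0r.
rewrite /verma_euler linear_sum /= -!sumrB; apply: verma_fil_sum => k _.
rewrite linear_sum /= -!sumrB big_seq; apply: verma_fil_sum => p /sn[pn pm].
move: (deg k) => l; set n := - l - r%:Z.
rewrite (actC p.1) !linearD [Th (_ *: w)]linearZ/= (far_word wR) scaler0.
rewrite Th_act// linear0 addr0 (actC p.2).
have fu : verma_fil d (Th (act p.1 n w)) by apply: (far_nplus n pn wR).
rewrite (form_nminus B pm ym) mulr0 mul0r if_same scale0r addr0.
rewrite -[_ + _ + act p.2 l _]addrA [act y m _ + _]addrC addrK -addrA.
apply: verma_filD; first by apply: verma_fil_cons => //; apply: (lie_nminus B).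
(* Only the component b in h pairs with rho^vee; it gives the main term. *)
have [b [c [e [bh cp em pyE]]]] := triangular_split D (lie p.1 y).
have -> : B H0 (lie p.1 y) = B H0 b.
  rewrite pyE !formDr (form_cartan_nplus B (height_elt_in D) cp).
  by rewrite (form_cartan_nminus B (height_elt_in D) em) !addr0.
rewrite pyE !act_Dl !linearD /= (far_cartan _ bh wR) (Th_act _ _ em) (far_word wR).
rewrite !linear0 addr0 (_ : (n + m + r%:Z == 0) = (l == m)); last first.
  by rewrite /n; apply/eqP/eqP; lia.
rewrite linearZ/= addrAC subrr add0r; apply: verma_fil_cons => //.
exact: (far_nplus (n + m) cp wR).
Qed.

Lemma verma_euler_word d w : verma_word R d w ->
  verma_fil d.-1 (verma_euler w - d.-1%:R *: w).
Proof.
elim=> {d w} [d|d k u w _ IHu _ IHw|d e q wq|d y m w ym mR wR IH] /=.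
- by rewrite linear0 scaler0 subrr; apply: verma_fil0.
- rewrite linearP/= scalerDr opprD addrACA scalerA mulrC -scalerA -scalerBr.
  exact: verma_fil_lin.
- rewrite [verma_euler _]big1 => [|k _]; last first.
    by rewrite big_seq big1// => p /sn[pn _]; rewrite act_nplus// !linear0.
  case: d => [|d]; first by rewrite scale0r subrr; apply: verma_fil0.
  rewrite sub0r -scaleNr; apply: verma_filZ.
  by exists R; apply: verma_word_tau wq.
case: d wR IH => [/verma_word_eq0->|d wR IH] /=.
  by move=> _; rewrite !linear0 addr0; apply: verma_fil0.
rewrite -[_ - _](_ : verma_euler (act y m w) - act y m (verma_euler w) - act y m w +
   act y m (verma_euler w - d%:R *: w) = _).
  by apply: verma_filD; [apply: verma_euler_act|apply: verma_fil_cons].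
rewrite linearB linearZ/= -[d.+1]addn1 natrD scalerDl scale1r opprD.
rewrite [_ - _ - act y m w]addrAC addrA subrK -addrA.
by congr (_ + _); apply: addrC.
Qed.
End VermaEuler.
End Far.

Lemma killed_tau w :
  (forall x m, x \in nplus D -> act x m w = 0) -> exists q, w = tau q.
Proof.
move=> kw; have [s sn sE] := nminus_dual_family D B.
have [d] := verma_fil_ex w; elim: d => [|[|d] IH] [R wR].
- by exists 0; rewrite (verma_word_eq0 wR) linear0.
- exact: verma_word1 wR.
(* R + 1 is the least r beyond the degrees in w. *)
have [Th [Th_tau Th_act]] := tau_lift (far_der R.+1).
apply: IH; have := verma_euler_word (ltnSn R) Th_tau Th_act sn sE wR.
(* Each summand first applies an element of nplus to w, so the operator kills w, while its
   eigenvalue d + 1 is nonzero. *)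
rewrite [verma_euler _ _ _ _ _]big1 => [|k _]; last first.
  by rewrite big_seq big1// => p /sn[pn _]; rewrite kw// !linear0.
rewrite sub0r => /(verma_filZ (- d.+1%:R^-1)).
by rewrite scaleNr scalerN opprK scalerA mulVf ?scale1r// pnatr_eq0.
Qed.

Lemma act_irreducible (W : T -> Prop) :
  (forall k u w, W u -> W w -> W (k *: u + w)) ->
  (forall x m w, W w -> W (act x m w)) ->
  forall w, W w -> w != 0 -> forall u, W u.
Proof.
move=> WL Wa w Ww w0.
have [H wH] := height_word_ex w.
pose ops (f : T -> T) := exists (n : nat) x m, of_height D n.+1%:Z x /\ f = act x m.
have [||w' [Ww' w'0 kw']] := killed_vector (W := W) (ops := ops)
  height_word_eq0 _ _ wH Ww w0.
- move=> f d u [n [x [m [xn ->]]]] du.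
  by apply: height_word_mono (height_word_raise m xn du); lia.
- by move=> f u [n [x [m [_ ->]]]]; apply: Wa.
have [|q w'E] := @killed_tau w'.
  move=> x m; move: x; apply: nplus_height_ind => [|x y e1 e2|n x _ xn].
  - exact: act_0l.
  - by rewrite act_Dl e1 e2 addr0.
  - by apply: kw'; exists n, x, m.
(* The preimage of W under [tau] is stable under the Heisenberg action and contains q, which is
   nonzero. *)
have Wtau : forall p, W (tau p).
  apply: (hop_irreducible (W := fun p => W (tau p)) _ _ (q := q)) => [k p p'|x m p xh||].
  - by rewrite linearP; apply: WL.
  - by rewrite -act_tau//; apply: Wa.
  - by rewrite -w'E.
  - by apply: contraNneq w'0 => q0; rewrite w'E q0 linear0.
have W0 : W 0 by rewrite -(linear0 tau).
by elim/act_ind=> // y m u _; apply: Wa.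
Qed.

End Verma.
End Heisenberg.

(** * The affine algebra *)

Section LoopMaps.
Variables (K : numFieldType) (g : finLieAlgType K) (B : invForm g).

Definition loop_map (p : int -> 'End(g)) (u : loop g) : loop g :=
  [malg m in msupp u => p m u@_m].
Lemma loop_mapE p u m : (loop_map p u)@_m = p m u@_m.
Proof. by rewrite mcoeffE; case: msuppP => // _; rewrite linear0. Qed.

Definition affine_map p (c : bool) (u : affine B) : affine B :=
  (loop_map p u.1, if c then u.2 else 0).
Lemma affine_map_linear p c : linear (affine_map p c).
Proof.
move=> k u v; congr pair.
  by apply/malgP => m; rewrite loop_coefP !loop_mapE loop_coefP linearP.
by case: c => //=; rewrite scaler0 addr0.
Qed.

Section SubMap.
Variables (L : lieAlgType K) (j : {linear L -> affine B}).
Variables (Q : lieSubalg (affine B)) (p : int -> 'End(g)) (c : bool).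
Hypothesis jQ : forall x, affine_map p c (j x) \in subalg_pred Q.
Definition sub_map (x : L) : subLie Q := SubLie (jQ x).
Fact sub_map_linear : linear sub_map.
Proof.
move=> k x y; apply: sub_elt_inj; rewrite sub_elt_linear /= linearP.
exact: affine_map_linear.
Qed.
HB.instance Definition _ :=
  GRing.isLinear.Build K L (subLie Q) *:%R sub_map sub_map_linear.
End SubMap.

Definition affine_mono (x : g) (m : int) : affine B := (mono x m, 0).

Lemma affine_mono_linear m : linear (affine_mono^~ m).
Proof.
move=> k x y; rewrite /affine_mono mono_linear; congr pair.
by rewrite /= scaler0 addr0.
Qed.

Definition affine_c : affine B := (0, 1).

Lemma lie_affine_mono x y m n : lie (affine_mono x m) (affine_mono y n) =
  (if m + n == 0 then m%:~R * B x y else 0) *: affine_c +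
  affine_mono (lie x y) (m + n).
Proof.
congr pair => /=; first by rewrite scaler0 add0r; apply: loop_lie_mono.
by rewrite addr0 [RHS]mulr1; apply: cocycle_mono.
Qed.

Lemma affine_c_central u : lie affine_c u = 0.
Proof. by congr pair; [apply: loop_lie0l|apply: cocycle0l]. Qed.

Lemma affine_mono_sum (u : affine B) :
  u = u.2 *: affine_c + \sum_(m <- msupp u.1) affine_mono u.1@_m m.
Proof.
have H (s : seq int) :
    \sum_(m <- s) affine_mono u.1@_m m = (\sum_(m <- s) mono u.1@_m m, 0).
  by elim/big_rec2: _ => // m v w _ ->; congr pair; rewrite /= addr0.
rewrite H; case: u {H} => u k; congr pair => /=.
  by rewrite scaler0 add0r {1}[u]monalgE.
by rewrite addr0 [RHS]mulr1.
Qed.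

Lemma affine_mono_graded (S : int -> {vspace g}) c x m : x \in S m ->
  affine_mono x m \in graded (B := B) S c.
Proof.
move=> xS; apply/gradedP; split; last by right.
move=> n; rewrite mcoeffU; case: eqP => [<-|_]; rewrite ?mulr1n ?mulr0n//.
exact: mem0v.
Qed.

End LoopMaps.

(** * Complements of the inducing subalgebras, with their projections *)

Section Splitting.
Variables (K : numFieldType) (g : finLieAlgType K) (B : invForm g).
Variable D : cartan_datum g.
Local Notation h := (cartan D).

Fact nminus_pair (m : int) x y :
  x \in nminus D -> y \in nminus D -> m%:~R * B x y = 0.
Proof. by move=> xm ym; rewrite (form_nminus B xm ym) mulr0. Qed.
Fact nminus_lie (m n : int) x y :
  x \in nminus D -> y \in nminus D -> lie x y \in nminus D.
Proof. exact: (lie_nminus B). Qed.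
(** The cocycle vanishes here because nminus is isotropic, so the subalgebra closes without the
    centre. *)
Definition Nminus : lieSubalg (affine B) :=
  graded_subalg (central := false) nminus_lie (or_intror nminus_pair).

Definition heis_neg_deg (m : int) : {vspace g} := if m < 0 then h else 0%VS.
Lemma heis_neg_degS m : (heis_neg_deg m <= heis_deg D m)%VS.
Proof.
rewrite /heis_neg_deg /heis_deg; case: ltP; rewrite ?sub0v// => m0.
by rewrite lt_eqF// subvv.
Qed.
Fact heis_neg_lie m n x y :
  x \in heis_neg_deg m -> y \in heis_neg_deg n -> lie x y \in heis_neg_deg (m + n).
Proof.
move=> /(subvP (heis_neg_degS m)) xm /(subvP (heis_neg_degS n)) yn.
by rewrite (heis_comm xm yn) mem0v.
Qed.
Fact heis_neg_pair (m : int) x y :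
  x \in heis_neg_deg m -> y \in heis_neg_deg (- m) -> m%:~R * B x y = 0.
Proof.
rewrite /heis_neg_deg oppr_lt0; case: (ltrgtP 0 m) => [m0|m0|<-].
- by rewrite memv0 => /eqP->; rewrite form0l mulr0.
- by rewrite memv0 => _ /eqP->; rewrite form0r mulr0.
- by rewrite mul0r.
Qed.
Definition HeisNeg : lieSubalg (affine B) :=
  graded_subalg (central := false) heis_neg_lie (or_intror heis_neg_pair).

Lemma HeisNeg_Heis : {subset subalg_pred HeisNeg <= subalg_pred (Heis B D)}.
Proof.
move=> u /gradedP[uS _]; apply/gradedP; split; last by left.
by move=> m; apply: (subvP (heis_neg_degS m)).
Qed.

Definition borel_proj : 'End(g) := daddv_pi (borel D) (nminus D).
Definition nminus_proj : 'End(g) := daddv_pi (nminus D) (borel D).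

Lemma borel_nminus_proj x : borel_proj x + nminus_proj x = x.
Proof.
apply: daddv_pi_add; first exact: borel_nminus_direct.
by rewrite borel_nminus_full memvf.
Qed.
Lemma borel_proj_id x : x \in borel D -> borel_proj x = x.
Proof. by move=> xb; apply: daddv_pi_id => //; exact: (borel_nminus_direct D B). Qed.
Lemma nminus_proj_id x : x \in nminus D -> nminus_proj x = x.
Proof.
move=> xb; apply: daddv_pi_id => //.
by rewrite capvC; exact: (borel_nminus_direct D B).
Qed.
Lemma borel_proj0 x : x \in nminus D -> borel_proj x = 0.
Proof.
by move=> xm; apply: (addIr x); rewrite -{2}(nminus_proj_id xm) borel_nminus_proj add0r.
Qed.
Lemma nminus_proj0 x : x \in borel D -> nminus_proj x = 0.
Proof.
by move=> xb; apply: (addrI x); rewrite -{1}(borel_proj_id xb) borel_nminus_proj addr0.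
Qed.

Fact to_Ptilde_subproof u :
  affine_map (fun=> borel_proj) true u \in subalg_pred (Ptilde B D).
Proof.
by apply/gradedP; split=> [m|]; [rewrite loop_mapE; apply: memv_pi|left].
Qed.
Definition to_Ptilde : {linear affine B -> subLie (Ptilde B D)} :=
  sub_map (j := idfun) to_Ptilde_subproof.
Fact to_Nminus_subproof u :
  affine_map (fun=> nminus_proj) false u \in subalg_pred Nminus.
Proof.
by apply/gradedP; split=> [m|]; [rewrite loop_mapE; apply: memv_pi|right].
Qed.
Definition to_Nminus : {linear affine B -> subLie Nminus} :=
  sub_map (j := idfun) to_Nminus_subproof.

Lemma to_Ptilde_id (x : subLie (Ptilde B D)) : to_Ptilde (sub_elt x) = x.
Proof.
apply: sub_elt_inj; rewrite [RHS]surjective_pairing; congr pair.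
by apply/malgP => m; rewrite loop_mapE borel_proj_id// Ptilde_coef.
Qed.

Lemma affine_split u : u = subalg_val (Ptilde B D) (to_Ptilde u) +
  subalg_val Nminus (to_Nminus u).
Proof.
rewrite [LHS]surjective_pairing; congr pair; last by rewrite /= addr0.
by apply/malgP => m; rewrite mcoeffD !loop_mapE borel_nminus_proj.
Qed.

Lemma to_Nminus_Ptilde (x : subLie (Ptilde B D)) : to_Nminus (sub_elt x) = 0.
Proof.
apply: sub_elt_inj; congr pair.
by apply/malgP => m; rewrite loop_mapE mcoeff0 nminus_proj0// Ptilde_coef.
Qed.
Lemma to_Ptilde_Nminus (y : subLie Nminus) : to_Ptilde (sub_elt y) = 0.
Proof.
have /gradedP[yS [//|y0]] := sub_eltP y.
apply: sub_elt_inj; congr pair => //.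
by apply/malgP => m; rewrite loop_mapE mcoeff0 borel_proj0.
Qed.
Lemma to_Nminus_id (y : subLie Nminus) : to_Nminus (sub_elt y) = y.
Proof.
have /gradedP[yS [//|y0]] := sub_eltP y.
apply: sub_elt_inj; rewrite [RHS]surjective_pairing; congr pair => //.
by apply/malgP => m; rewrite loop_mapE nminus_proj_id.
Qed.

Definition pos_id (m : int) : 'End(g) := if 0 < m then \1%VF else 0.
Definition neg_id (m : int) : 'End(g) := if m < 0 then \1%VF else 0.

Fact to_HeisPosC_subproof (x : subLie (Heis B D)) :
  affine_map pos_id true (sub_elt x) \in subalg_pred (HeisPosC B D).
Proof.
have /gradedP[xS _] := sub_eltP x.
apply/gradedP; split=> [m|]; last by left.
rewrite loop_mapE /pos_id /heis_pos_deg; have := xS m; rewrite /heis_deg.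
case: ltrP => [m0|_]; last by rewrite zero_lfunE mem0v.
by rewrite id_lfunE gt_eqF.
Qed.
Definition to_HeisPosC : {linear subLie (Heis B D) -> subLie (HeisPosC B D)} :=
  sub_map to_HeisPosC_subproof.
Fact to_HeisNeg_subproof (x : subLie (Heis B D)) :
  affine_map neg_id false (sub_elt x) \in subalg_pred HeisNeg.
Proof.
have /gradedP[xS _] := sub_eltP x.
apply/gradedP; split=> [m|]; last by right.
rewrite loop_mapE /neg_id /heis_neg_deg; have := xS m; rewrite /heis_deg.
case: ltrP => [m0|_]; last by rewrite zero_lfunE mem0v.
by rewrite id_lfunE lt_eqF.
Qed.
Definition to_HeisNeg : {linear subLie (Heis B D) -> subLie HeisNeg} :=
  sub_map to_HeisNeg_subproof.
Fact to_HeisPos_subproof (u : affine B) :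
  affine_map (fun m => (cartan_proj D \o pos_id m)%VF) false u
    \in subalg_pred (HeisPos B D).
Proof.
apply/gradedP; split=> [m|]; last by right.
rewrite loop_mapE comp_lfunE /pos_id /heis_pos_deg.
by case: ltrP => _; rewrite ?cartan_proj_in// zero_lfunE linear0 mem0v.
Qed.
(** Defined on the whole affine algebra, so that zeta can be evaluated at x t^m for all x and m;
    outside H'(+) the value is a default. *)
Definition to_HeisPos : {linear affine B -> subLie (HeisPos B D)} :=
  sub_map (j := idfun) to_HeisPos_subproof.

Local Notation incP := (sub_incl (@HeisPosC_Heis _ _ B D)).
Local Notation incN := (sub_incl HeisNeg_Heis).

Lemma Heis_split x : x = incP (to_HeisPosC x) + incN (to_HeisNeg x).
Proof.
have /gradedP[xS _] := sub_eltP x.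
apply: sub_elt_inj; rewrite [LHS]surjective_pairing linearD; congr pair => /=.
  apply/malgP => m; rewrite mcoeffD !loop_mapE /pos_id /neg_id.
  case: (ltrgtP 0 m) (xS m) => [_ _|_ _|<-].
  - by rewrite id_lfunE zero_lfunE addr0.
  - by rewrite id_lfunE zero_lfunE add0r.
  - by rewrite /heis_deg eqxx memv0 !zero_lfunE addr0 => /eqP.
by rewrite addr0.
Qed.
Lemma to_HeisPosC_id x : to_HeisPosC (incP x) = x.
Proof.
have /gradedP[xS _] := sub_eltP x.
apply: sub_elt_inj; rewrite [RHS]surjective_pairing; congr pair => /=.
apply/malgP => m; rewrite loop_mapE /pos_id; have := xS m; rewrite /heis_pos_deg.
case: ltrP => _; first by rewrite id_lfunE.
by rewrite memv0 => /eqP->; rewrite linear0.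
Qed.
Lemma to_HeisNeg_HeisPosC x : to_HeisNeg (incP x) = 0.
Proof.
have /gradedP[xS _] := sub_eltP x.
apply: sub_elt_inj; congr pair; apply/malgP => m; rewrite loop_mapE mcoeff0.
have := xS m; rewrite /heis_pos_deg /neg_id.
case: (ltrgtP 0 m) => [_|_|<-]; rewrite ?zero_lfunE//.
by rewrite memv0 => /eqP->; rewrite linear0.
Qed.
Lemma to_HeisPosC_HeisNeg y : to_HeisPosC (incN y) = 0.
Proof.
have /gradedP[yS [//|y0]] := sub_eltP y.
apply: sub_elt_inj; congr pair => //; apply/malgP => m; rewrite loop_mapE mcoeff0.
have := yS m; rewrite /heis_neg_deg /pos_id.
case: (ltrgtP 0 m) => [_|_|<-]; rewrite ?zero_lfunE//.
by rewrite memv0 => /eqP->; rewrite linear0.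
Qed.
Lemma to_HeisNeg_id y : to_HeisNeg (incN y) = y.
Proof.
have /gradedP[yS [//|y0]] := sub_eltP y.
apply: sub_elt_inj; rewrite [RHS]surjective_pairing; congr pair => //=.
apply/malgP => m; rewrite loop_mapE /neg_id; have := yS m; rewrite /heis_neg_deg.
case: ltrP => _; first by rewrite id_lfunE.
by rewrite memv0 => /eqP->; rewrite linear0.
Qed.

End Splitting.

(** * The modules M' and M~ as instances of the abstract setting *)

Section VermaModule.
Variables (K : numFieldType) (g : finLieAlgType K) (B : invForm g).
Variable D : cartan_datum g.
Local Notation h := (cartan D).
Variable zeta : {linear subLie (HeisPos B D) -> K^o}.
Variable lam : {linear (subvs_of h * K^o)%type -> K^o}.
Local Notation a := (level lam).
Local Notation incP := (sub_incl (@HeisPosC_Heis _ _ B D)).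
Local Notation incN := (sub_incl (@HeisNeg_Heis _ _ B D)).
Local Notation M := (MP zeta lam).
Local Notation rM := (MP_rep zeta lam).
Local Notation rH := (Mprime_rep zeta a).
Local Notation T := (Mtilde zeta lam).
Local Notation rT := (Mtilde_rep zeta lam).

Lemma mem_cartan_borel x : x \in h -> x \in borel D.
Proof. exact: (subvP (addvSl _ _)). Qed.
Lemma mem_nplus_borel x : x \in nplus D -> x \in borel D.
Proof. exact: (subvP (addvSr _ _)). Qed.

(** The projection to P~ makes this total in x; it fixes x t^m for x in the Borel subalgebra. *)
Definition hop (x : g) (m : int) (q : M) : M :=
  rM (to_Ptilde B D (affine_mono B x m)) q.
Definition act (x : g) (m : int) (w : T) : T := rT (affine_mono B x m) w.
Definition vac : M := tens1 incP (char_rep zeta a) 1.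
Definition tau : {linear M -> T} := tens1 (subalg_val (Ptilde B D)) rM.
Definition vac_eigen (x : g) (m : int) : K := zeta (to_HeisPos B D (affine_mono B x m)).

Lemma to_Ptilde_mono x m : x \in borel D ->
  sub_elt (to_Ptilde B D (affine_mono B x m)) = affine_mono B x m.
Proof.
move=> xb; congr pair; apply/malgP => n; rewrite loop_mapE mcoeffU.
by case: eqP => _; rewrite ?mulr1n ?mulr0n ?linear0// borel_proj_id.
Qed.

Lemma hop_linl k x y m q : hop (k *: x + y) m q = k *: hop x m q + hop y m q.
Proof. by rewrite /hop affine_mono_linear linearP rep_linearl. Qed.
Lemma MP_hop_0l m q : hop 0 m q = 0.
Proof.
by have := hop_linl (-1) 0 0 m q; rewrite scaler0 addr0 scaleN1r addNr.
Qed.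
Lemma hop_linr x m : linear (hop x m).
Proof. by move=> k u v; apply: rep_linearr. Qed.
Lemma act_linl k x y m w : act (k *: x + y) m w = k *: act x m w + act y m w.
Proof. by rewrite /act affine_mono_linear rep_linearl. Qed.
Lemma act_linr x m : linear (act x m).
Proof. by move=> k u v; apply: rep_linearr. Qed.

(** A multiple of c already lies in H'(+) + K c, where the inducing character takes the value k a;
    being central, it acts by this scalar everywhere. *)
Lemma rM_central (z : subLie (Ptilde B D)) k q :
  sub_elt z = k *: affine_c B -> rM z q = (k * a) *: q.
Proof.
move=> zE.
have zP : k *: affine_c B \in subalg_pred (HeisPosC B D).
  apply/gradedP; split; last by left.
  by move=> m; rewrite /= scaler0 mcoeff0 mem0v.
pose z0 := SubLie zP.
rewrite [LHS](@MP_act_heis _ _ B D zeta lam z (incP z0)) //.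
apply: ind_central => [y|v].
  apply: sub_elt_inj; rewrite sub_elt_lie /= lieZl affine_c_central.
  by rewrite scaler0.
rewrite /rep_act/= /char_act (_ : pos_part z0 = 0).
  by rewrite linear0 add0r /= [k *: _]mulr1 mulrC [_ * k]mulrC mulrC.
by apply: sub_elt_inj; congr pair; rewrite /= scaler0.
Qed.

Lemma hopC x y m n q : x \in h -> y \in h -> hop x m (hop y n q) =
  hop y n (hop x m q) + (if m + n == 0 then m%:~R * B x y * a else 0) *: q.
Proof.
have [hC _ _] := cartanP D.
move=> xh yh; rewrite /hop rep_comm; congr (_ + _).
rewrite (rM_central (k := if m + n == 0 then m%:~R * B x y else 0)).
  by case: eqP => _; rewrite ?mul0r.
rewrite sub_elt_lie !to_Ptilde_mono ?mem_cartan_borel//.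
by rewrite lie_affine_mono hC// /affine_mono /mono monalgU0 addr0.
Qed.

Lemma hop_vac x (m : int) : x \in h -> 0 < m -> hop x m vac = vac_eigen x m *: vac.
Proof.
move=> xh m0.
have xP : affine_mono B x m \in subalg_pred (HeisPosC B D).
  by apply: affine_mono_graded; rewrite /heis_pos_deg m0.
pose x0 := SubLie xP.
rewrite /hop [LHS](@MP_act_heis _ _ B D zeta lam _ (incP x0)); last first.
  by rewrite to_Ptilde_mono// mem_cartan_borel.
rewrite [LHS]ind_rep_tens1 /vac -linearZ; congr (tens1 _ _ _).
rewrite /rep_act/= /char_act mulr0 addr0; congr (zeta _ * _).
apply: sub_elt_inj; congr pair; apply/malgP => n; rewrite loop_mapE.
rewrite mcoeffU comp_lfunE /pos_id; case: eqP => [<-|_]; last first.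
  by rewrite mulr0n !linear0.
rewrite m0 mulr1n id_lfunE /cartan_proj daddv_pi_id//; exact: nplus_direct.
Qed.

Lemma rM_suml (u : affine B) q : u.2 = 0 ->
  rM (to_Ptilde B D u) q = \sum_(m <- msupp u.1) hop u.1@_m m q.
Proof.
move=> u0; rewrite {1}[u]affine_mono_sum u0 scale0r add0r.
by rewrite linear_sum rep_suml.
Qed.

Lemma rH_sub (y : subLie (Heis B D)) q : rH y q = rM (to_Ptilde B D (sub_elt y)) q.
Proof.
have /gradedP[yS _] := sub_eltP y.
symmetry; apply: MP_act_heis; rewrite [RHS]surjective_pairing; congr pair.
apply/malgP => m; rewrite loop_mapE borel_proj_id// mem_cartan_borel//.
exact: (subvP (heis_degS D m)).
Qed.

Lemma hop_ind (P : M -> Prop) :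
  P 0 -> (forall k p q, P p -> P q -> P (k *: p + q)) -> P vac ->
  (forall x (s : nat) q, x \in h -> P q -> P (hop x (- s.+1%:Z) q)) ->
  forall q, P q.
Proof.
move=> P0 PL Pv Ph.
apply: (ind_word_ind (@Heis_split K g B D)) => // [n|y q Pq].
  rewrite -[n]mulr1 -[tens1 _ _ _]addr0 [tens1 _ _ _](linearZ_LR _ n 1).
  exact: PL.
have /gradedP[yS [//|y0]] := sub_eltP y.
rewrite [ind_rep _ _ _ _]rH_sub rM_suml//.
elim/big_rec: _ => // m p _ Pp.
rewrite -[hop _ _ _]scale1r; apply: PL => //.
have := yS m; rewrite /heis_neg_deg; case: ltP => [m0|_].
  rewrite (_ : m = - (`|m|.-1).+1%:Z)%R; last lia.
  by move=> ym; apply: Ph.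
by rewrite memv0 => /eqP->; rewrite MP_hop_0l.
Qed.

Lemma act_c w : rT (affine_c B) w = a *: w.
Proof.
have cP : affine_c B \in subalg_pred (Ptilde B D).
  by apply/gradedP; split=> [m|]; [rewrite mcoeff0 mem0v|left].
apply: (@ind_central _ _ _ (subalg_val (Ptilde B D)) _ rM (SubLie cP)) => [y|q].
  exact: affine_c_central.
by rewrite (rM_central (k := 1)) ?mul1r// scale1r.
Qed.

Lemma actC x y m n w : act x m (act y n w) =
  act y n (act x m w) + act (lie x y) (m + n) w +
  (if m + n == 0 then m%:~R * B x y * a else 0) *: w.
Proof.
rewrite /act rep_comm lie_affine_mono repDl repZl act_c scalerA -addrA.
by congr (_ + _); rewrite addrC; case: eqP => _; rewrite ?mul0r.
Qed.

Lemma act_tau_borel x m q : x \in borel D -> act x m (tau q) = tau (hop x m q).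
Proof.
by move=> xb; rewrite /act -(to_Ptilde_mono m xb); apply: ind_rep_tens1.
Qed.
Lemma act_tau x m q : x \in h -> act x m (tau q) = tau (hop x m q).
Proof. by move=> /mem_cartan_borel; apply: act_tau_borel. Qed.
Lemma act_nplus x m q : x \in nplus D -> act x m (tau q) = 0.
Proof.
move=> xn; rewrite act_tau_borel ?mem_nplus_borel// /hop [rM _ _]MP_act_nplus ?linear0//.
move=> n; rewrite to_Ptilde_mono ?mem_nplus_borel// mcoeffU.
by case: eqP => _; rewrite ?mulr1n// mulr0n mem0v.
Qed.

Lemma rT_suml (u : affine B) w : u.2 = 0 ->
  rT u w = \sum_(m <- msupp u.1) act u.1@_m m w.
Proof. by move=> u0; rewrite {1}[u]affine_mono_sum u0 scale0r add0r rep_suml. Qed.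

Lemma act_ind (P : T -> Prop) :
  P 0 -> (forall k u w, P u -> P w -> P (k *: u + w)) ->
  (forall q, P (tau q)) ->
  (forall y m w, y \in nminus D -> P w -> P (act y m w)) -> forall w, P w.
Proof.
move=> P0 PL Pt Pa.
apply: (ind_word_ind (@affine_split K g B D)) => // y w Pw.
have /gradedP[yS [//|y0]] := sub_eltP y.
rewrite [ind_rep _ _ _ _]rT_suml//.
elim/big_rec: _ => // m u _ Pu; rewrite -[act _ _ _]scale1r; apply: PL => //.
exact: Pa.
Qed.

(** Freeness of M~ over the complement of P~, with M~ itself as target and q sent to tau(th q). *)
Lemma tau_lift (th : {linear M -> M}) : exists Th : {linear T -> T},
  (forall q, Th (tau q) = tau (th q)) /\
  (forall y m w, y \in nminus D -> Th (act y m w) = act y m (Th w)).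
Proof.
pose rN : lieRep (subLie (Nminus B D)) T := LieRep
  (fun k x y w => rep_linearl rT k (sub_elt x) (sub_elt y) w)
  (fun k x u w => rep_linearr rT k (sub_elt x) u w)
  (fun x y w => rep_lie rT (sub_elt x) (sub_elt y) w).
have [Th [ThT ThN]] := ind_free (@affine_split K g B D) (@to_Ptilde_id K g B D)
  (@to_Nminus_Ptilde K g B D) (@to_Ptilde_Nminus K g B D) (@to_Nminus_id K g B D)
  (M := M) rM rN (tau \o th).
exists Th; split=> // y m w ym.
have yP : affine_mono B y m \in subalg_pred (Nminus B D).
  exact: affine_mono_graded.
exact: (ThN (SubLie yP)).
Qed.

(** Freeness with target M' and the identity prescribed on M' gives a left inverse; nminus[t, t^-1]
    may act trivially on the target. *)
Lemma tau_inj : injective tau.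
Proof.
have [S [ST _]] := ind_free (@affine_split K g B D) (@to_Ptilde_id K g B D)
  (@to_Nminus_Ptilde K g B D) (@to_Ptilde_Nminus K g B D) (@to_Nminus_id K g B D)
  rM (trivial_rep _ M) idfun.
exact: (can_inj ST).
Qed.

(** The same argument for M' over the negative Heisenberg part sends [vac] to 1. *)
Lemma vac_neq0 : vac != 0.
Proof.
have [S [ST _]] := ind_free (@Heis_split K g B D) (@to_HeisPosC_id K g B D)
  (@to_HeisNeg_HeisPosC K g B D) (@to_HeisPosC_HeisNeg K g B D)
  (@to_HeisNeg_id K g B D) (char_rep zeta a) (trivial_rep _ K^o) idfun.
apply/eqP => /(congr1 S); rewrite ST linear0 => /eqP.
by rewrite oner_eq0.
Qed.

Theorem Mtilde_irreducible : a != 0 -> irreducible_rep rT.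
Proof.
move=> a0; split.
  exists (tau vac); rewrite -(linear0 tau) (inj_eq tau_inj).
  exact: vac_neq0.
move=> W [W0 WL] Wx.
have [[w Ww w0]|nW] := pselect (exists2 w, w \in W & w != 0).
  right=> u; rewrite [RHS]inE.
  apply: (@act_irreducible K g D B M hop a vac vac_eigen a0 hop_linl hop_linr
    hopC hop_vac hop_ind T act tau act_linl act_linr actC act_tau act_nplus
    act_ind tau_lift (fun w => w \in W) _ _ w Ww w0 u).
  - by move=> k u1 u2; apply: WL.
  - by move=> x m u1; apply: Wx.
left=> w; rewrite inE; apply/idP/eqP => [Ww|->//].
by apply/eqP; apply/negPn/negP => w0; apply: nW; exists w.
Qed.

End VermaModule.

Theorem theorem5p3 (R : realType) (g : finLieAlgType R[i])
    (g_simple : simple_lie g) (B : invForm g) (D : cartan_datum g)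
    (zeta : {linear subLie (HeisPos B D) -> R[i]^o})
    (lam : {linear (subvs_of (cartan D) * R[i]^o)%type -> R[i]^o}) :
  lam (0, 1) != 0 -> irreducible_rep (Mtilde_rep zeta lam).
Proof. exact: Mtilde_irreducible. Qed.
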